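(* Let $k$ be a field. There exist two sequences of natural numbers $\{\gamma_s\}_{s\geq 1}$ and $\{\alpha_s\}_{s\geq 1}$ such that for every $n\geq 3$, writing $S=k[T_1,\ldots,T_n]$: (a) $\varepsilon_s(S/I(\mathcal{P}_n)) = \gamma_s n-\alpha_s$ for all $1\leq s\leq n+1$; (b) $\varepsilon_s(S/I(\mathcal{C}_n)) = \gamma_s n$ for all $1\leq s< n$, and $\varepsilon_n(S/I(\mathcal{C}_n)) = \gamma_n n-1$.
   Context: Natural numbers include $0$. $S=k[T_1,\ldots,T_n]$ is a standard graded polynomial ring over a field $k$. The edge ideal $I(\mathcal{G})\subseteq S$ of a graph $\mathcal{G}$ on vertices $\{1,\ldots,n\}$ is generated by the monomials $T_iT_j$ such that $\{i,j\}$ is an edge. $\mathcal{P}_n$ is the $n$-path, with edges $\{1,2\},\ldots,\{n-1,n\}$; $\mathcal{C}_n$ is the $n$-cycle, with edges $\{1,2\},\ldots,\{n-1,n\},\{n,1\}$. For $R=S/I$ with $I\subseteq (T_1,\ldots,T_n)^2$ a homogeneous ideal, the deviations $\varepsilon_i(R)$, $i\geq 1$, are the numbers of variables in homological degree $i$ in an acyclic closure $R\langle Y\rangle$ of $k$ over $R$. (The acyclic closure is the DG algebra resolution of $k$ obtained by starting with the Koszul complex on the images of $T_1,\ldots,T_n$ in $R$ and inductively applying Tate's process of adjoining variables in homological degree $i+1$ to kill cycles in homological degree $i$ whose classes minimally generate the $i$-th homology, using exterior variables in odd degrees and divided power variables in even degrees.) Equivalently, they are the unique nonnegative integers with $$P^R_k(z)=\sum_{i\geq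 0}\dim_k \operatorname{Tor}^R_i(k,k)z^i=\frac{\prod_{i\geq 1,\ i \text{ odd}}(1+z^i)^{\varepsilon_i(R)}}{\prod_{i\geq 1,\ i\text{ even}}(1-z^i)^{\varepsilon_i(R)}}.$$ *)

(* Defs.v *)
From HB Require Import structures.
From mathcomp Require Import all_boot all_order all_algebra.
From mathcomp Require Import ring_quotient finmap boolp.
From mathcomp Require Import mpoly.

Set Implicit Arguments.
Unset Strict Implicit.
Unset Printing Implicit Defensive.

Import GRing.Theory.
Local Open Scope ring_scope.

(* Variables Y = Y_1 + Y_2 + ..., where Y_i has e i elements, all of
   homological degree i = tag y; the normal monomials of R<Y> are given by
   finitely supported exponents. *)
Definition gvar (e : nat -> nat) : choiceType := {i : nat & 'I_(e i)}.
Notation gmon e := {fsfun gvar e -> nat with 0%N}.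

Section Monomials.
Variable e : nat -> nat.

Definition gvar_of (i : nat) (j : 'I_(e i)) : gvar e :=
  Tagged (fun i => 'I_(e i)) j.

(* exterior variables occur at most once *)
Definition gnormal (m : gmon e) : Prop :=
  forall y : gvar e, odd (tag y) -> (m y <= 1)%N.

Definition gdeg (m : gmon e) : nat := (\sum_(y <- finsupp m) m y * tag y)%N.
Definition gheight (m : gmon e) : nat := \max_(y <- finsupp m) tag y.

End Monomials.

Section Extensions.
Variables (R : comNzRingType) (e : nat -> nat) (A : algType R).
Variable dp : gvar e -> nat -> A.

(* The product of the divided powers y^(m y), with the variables in increasing
   order; those outside the support contribute dp y 0, which is 1 below. *)
Definition gmonval (m : gmon e) : A :=
  \prod_(i < (gheight m).+1) \prod_(j < e i)
     dp (gvar_of j) (m (gvar_of j)).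

Definition gspan (P : gmon e -> Prop) (a : A) : Prop :=
  exists (s : seq (gmon e)) (c : gmon e -> R),
    (forall m, m \in s -> gnormal m /\ P m) /\
    a = \sum_(m <- s) c m *: gmonval m.

(* homogeneous elements of degree p of R<Y>, resp. of R<Y_1, ..., Y_N> *)
Definition ghom (p : nat) : A -> Prop := gspan (fun m => gdeg m = p).
Definition gstage (N p : nat) : A -> Prop :=
  gspan (fun m => gdeg m = p /\ (gheight m <= N)%N).

End Extensions.

(* DG algebras R<Y>: as graded algebras they are the tensor product over R of
   exterior algebras (odd variables) and divided power algebras (even
   variables).  The values of dp y m for y odd and m > 1 are irrelevant. *)
Record dg_gamma_ext (R : comNzRingType) (e : nat -> nat) := DGGammaExt {
  dgg_sort :> algType R;
  dgg_dp : gvar e -> nat -> dgg_sort;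
  dgg_diff : {linear dgg_sort -> dgg_sort};
  dgg_var0 : e 0%N = 0%N;
  (* the normal monomials form an R-basis *)
  dgg_span : forall a, gspan dgg_dp (fun _ => True) a;
  dgg_free : forall (s : seq (gmon e)) (c : gmon e -> R), uniq s ->
        (forall m, m \in s -> gnormal m) ->
        \sum_(m <- s) c m *: gmonval dgg_dp m = 0 ->
        forall m, m \in s -> c m = 0;
  (* divided powers of the variables *)
  dgg_dp0 : forall y, dgg_dp y 0%N = 1;
  dgg_dpM : forall y a b, ~~ odd (tag y) ->
        dgg_dp y a * dgg_dp y b = 'C(a + b, a)%:R * dgg_dp y (a + b)%N;
  (* graded algebra, strictly graded commutative *)
  dgg_homM : forall p q x y, ghom dgg_dp p x -> ghom dgg_dp q y ->
        ghom dgg_dp (p + q)%N (x * y);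
  dgg_comm : forall p q x y, ghom dgg_dp p x -> ghom dgg_dp q y ->
        x * y = (-1) ^+ (p * q)%N * (y * x);
  dgg_sqr0 : forall p x, odd p -> ghom dgg_dp p x -> x * x = 0;
  (* differential of degree -1, compatible with divided powers *)
  dgg_diff0 : forall x, ghom dgg_dp 0 x -> dgg_diff x = 0;
  dgg_diff_hom : forall p x, ghom dgg_dp p.+1 x -> ghom dgg_dp p (dgg_diff x);
  dgg_diffK : forall x, dgg_diff (dgg_diff x) = 0;
  dgg_diffM : forall p x y, ghom dgg_dp p x ->
        dgg_diff (x * y) = dgg_diff x * y + (-1) ^+ p * (x * dgg_diff y);
  dgg_diff_dp : forall y m, ~~ odd (tag y) ->
        dgg_diff (dgg_dp y m.+1) = dgg_diff (dgg_dp y 1%N) * dgg_dp y m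
}.

Section AcyclicClosure.
Variables (R : comNzRingType) (n : nat) (x : 'I_n -> R) (e : nat -> nat).
Variable A : dg_gamma_ext R e.

Local Notation dp := (@dgg_dp R e A).
Local Notation del := (@dgg_diff R e A).

(* the boundary of the j-th variable of degree i *)
Definition dvar (i : nat) (j : 'I_(e i)) : A := del (dp (gvar_of j) 1%N).

Definition stage_cycle (i : nat) (z : A) : Prop :=
  gstage dp i i z /\ del z = 0.
Definition stage_boundary (i : nat) (z : A) : Prop :=
  exists2 b, gstage dp i i.+1 b & z = del b.

(* R<Y_1> is the Koszul complex on x, and for i >= 1 the classes of the
   boundaries of the variables of degree i.+1 are a minimal system of
   generators of the R-module H_i(R<Y_1, ..., Y_i>). *)
Definition acyclic_closure : Prop :=
  [/\ e 1%N = n,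
      forall (j : 'I_(e 1%N)) (j' : 'I_n),
        val j = val j' -> dvar j = (x j')%:A,
      forall i (j : 'I_(e i.+1)), (0 < i)%N -> stage_cycle i (dvar j),
      forall i z, (0 < i)%N -> stage_cycle i z ->
        exists c : 'I_(e i.+1) -> R,
          stage_boundary i (z - \sum_j c j *: dvar j)
    & forall i (j0 : 'I_(e i.+1)) (c : 'I_(e i.+1) -> R), (0 < i)%N ->
        ~ stage_boundary i (dvar j0 - \sum_(j | j != j0) c j *: dvar j)].

End AcyclicClosure.

(* eps i is the number of variables of degree i in an acyclic closure over R
   of R/(x_1, ..., x_n). *)
Definition is_deviations (R : comNzRingType) (n : nat) (x : 'I_n -> R)
    (eps : nat -> nat) : Prop :=
  exists A : dg_gamma_ext R eps, acyclic_closure x A.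

Section EdgeIdeal.
Variables (k : fieldType) (n : nat) (E : rel 'I_n).

Definition edge_ideal : {pred {mpoly k[n]}} := fun p =>
  `[< exists c : 'I_n -> 'I_n -> {mpoly k[n]},
        p = \sum_i \sum_(j | E i j) c i j * ('X_i * 'X_j) >].

Lemma edge_idealP p :
  reflect (exists c : 'I_n -> 'I_n -> {mpoly k[n]},
             p = \sum_i \sum_(j | E i j) c i j * ('X_i * 'X_j))
          (p \in edge_ideal).
Proof. exact: asboolP. Qed.

Fact edge_ideal_zmod_closed : zmod_closed edge_ideal.
Proof.
split=> [|p q /edge_idealP [c ->] /edge_idealP [d ->]]; apply/edge_idealP.
  exists (fun _ _ => 0); rewrite big1 // => i _; rewrite big1 // => j _.
  by rewrite mul0r.
exists (fun i j => c i j - d i j); rewrite -sumrB; apply: eq_bigr => i _.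
by rewrite -sumrB; apply: eq_bigr => j _; rewrite mulrBl.
Qed.

HB.instance Definition _ :=
  GRing.isZmodClosed.Build {mpoly k[n]} edge_ideal edge_ideal_zmod_closed.

Fact edge_ideal_proper : ring_quotient.proper_ideal edge_ideal.
Proof.
split=> [|p q /edge_idealP [c ->]].
  apply/negP => /edge_idealP [c /(congr1 (meval (fun _ => 0)))].
  rewrite rmorph1 rmorph_sum big1 => [/eqP|i _]; first by rewrite oner_eq0.
  rewrite rmorph_sum big1 // => j _.
  by rewrite !rmorphM /= !mevalXU !mulr0.
apply/edge_idealP; exists (fun i j => p * c i j); rewrite mulr_sumr.
apply: eq_bigr => i _; rewrite mulr_sumr; apply: eq_bigr => j _.
exact: mulrA.
Qed.

HB.instance Definition _ :=
  isProperIdeal.Build {mpoly k[n]} edge_ideal edge_ideal_proper.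

Definition edge_ring : comNzRingType := {ideal_quot edge_ideal}.

Definition edge_ring_var (i : 'I_n) : edge_ring :=
  \pi_({ideal_quot edge_ideal})%qT 'X_i.

End EdgeIdeal.

(* Vertices are numbered from 0. *)
Definition path_graph (n : nat) : rel 'I_n :=
  fun i j => (i.+1 == j :> nat) || (j.+1 == i :> nat).

Definition cycle_graph (n : nat) : rel 'I_n :=
  fun i j => [|| path_graph i j, (i == 0%N :> nat) && (j.+1 == n)
                               | (j == 0%N :> nat) && (i.+1 == n)].

Definition is_edge_deviations (k : fieldType) (n : nat) (E : rel 'I_n) :=
  is_deviations (@edge_ring_var k n E).

(* Main.v *)
From HB Require Import structures.
Require Import Defs.
From mathcomp Require Import all_boot all_order all_algebra.
From mathcomp Require Import ring_quotient finmap boolp mpoly ring zify.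
Set Implicit Arguments.
Unset Strict Implicit.
Unset Printing Implicit Defensive.
Import GRing.Theory Num.Theory.
Local Open Scope ring_scope.

(** Let R be the edge ring of a graph, with Hilbert series H(z), let P(z) be the
    Poincare series of k over R, and call exponents of a series the sequence l
    for which it is the product of the (1 + z^s)^(l s) for s odd and of the
    (1 - z^s)^(- l s) for s even.

    Three facts show that the deviations are the exponents of 1 / H(-z).
    First, an acyclic closure of k over R is a minimal free resolution
    ([boundary_minimal], Gulliksen's theorem): a unit coefficient in a boundary
    could be brought down to degree 0 by chain maps that differentiate with
    respect to one variable, where it would contradict the fact that the
    boundaries of degree 0 form the maximal ideal.  So P(z) counts the normal
    monomials of R<Y>, and its exponents are the deviations
    ([poincare_series]).
    Secondly, R is a Koszul algebra: an explicit minimal linear resolution of k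
    consists of the R-valued functions on words in the vertices that vanish on
    words with two equal consecutive letters, and change sign when two
    consecutive letters that are not joined by an edge are exchanged
    ([koszul_resolution]).  Thirdly, two minimal resolutions have the same ranks
    ([minimal_resolution_rank_le]), and the Euler characteristics of the
    graded strands of the Koszul resolution give P(z) H(-z) = 1
    ([poincare_hilbert]).

    A monomial is nonzero in R when its support is independent.  With
    x = - z / (1 + z), the series H(-z) of the paths satisfy
    a_(n+2) = a_(n+1) + x a_n.  If lam and mu are the roots of T^2 = T + x, with
    mu divisible by z, then
      a_n = (lam^(n+2) - mu^(n+2)) / (lam - mu) for the path on n vertices,
      lam^n + mu^n                              for the cycle on n vertices.
    Modulo z^(n+2), resp. z^n, the powers of mu disappear.  What remains is
    lam^n times a series independent of n, so the exponents are affine in n for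
    paths and linear in n for cycles: gamma consists of the exponents of
    1 / lam, and alpha of those of lam^2 / (lam - mu).  For the cycle,
    mu^n = z^n modulo z^(n+1) accounts for the term - 1 in degree n
    ([deviation_pattern]).

    That gamma and alpha are natural numbers follows from the identities
    1 / lam = 1 / (1 - z R) and lam^2 / (lam - mu) = 1 / (1 - z^2 M^2), where R
    and M here denote the generating series of the Riordan and of the Motzkin
    numbers: if f has nonnegative coefficients, then 1 / (1 - f) is the Hilbert
    series of a free algebra, whose exponents count the elements of a basis of a
    free Lie superalgebra ([natural_exponents]). *)

(** * Exponents of a power series *)
Section Nilpotent.
Variables (T : comNzRingType) (z : T).

(** The numerator and the denominator of a product with exponents l are kept
    apart, so that identities between such products need no inverses.  When
    z^N = 0 only the factors with s < N matter. *)
Definition odd_prod N (l : nat -> nat) : T :=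
  \prod_(1 <= s < N | odd s) (1 + z ^+ s) ^+ l s.
Definition even_prod N (l : nat -> nat) : T :=
  \prod_(1 <= s < N | ~~ odd s) (1 - z ^+ s) ^+ l s.

Lemma odd_prodD N l m :
  odd_prod N (fun s => l s + m s)%N = odd_prod N l * odd_prod N m.
Proof. by rewrite -big_split; apply: eq_bigr => s _; rewrite exprD. Qed.
Lemma even_prodD N l m :
  even_prod N (fun s => l s + m s)%N = even_prod N l * even_prod N m.
Proof. by rewrite -big_split; apply: eq_bigr => s _; rewrite exprD. Qed.
Lemma odd_prodM N l n :
  odd_prod N (fun s => l s * n)%N = odd_prod N l ^+ n.
Proof. by rewrite -prodrXl; apply: eq_bigr => s _; rewrite exprM. Qed.
Lemma even_prodM N l n :
  even_prod N (fun s => l s * n)%N = even_prod N l ^+ n.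
Proof. by rewrite -prodrXl; apply: eq_bigr => s _; rewrite exprM. Qed.

Lemma odd_prod1 N s : (0 < s < N)%N -> odd s ->
  odd_prod N (fun t => (t == s) : nat) = 1 + z ^+ s.
Proof.
move=> sN os; rewrite /odd_prod (big_rem s) /= ?mem_index_iota // os eqxx expr1.
rewrite big_seq_cond big1 ?mulr1 // => t /andP[].
by rewrite mem_rem_uniq ?iota_uniq // inE => /andP[/negPf -> _] _; rewrite expr0.
Qed.
Lemma odd_prod1_even N s : ~~ odd s -> odd_prod N (fun t => (t == s) : nat) = 1.
Proof.
move=> os; rewrite /odd_prod big1 // => t ot.
by have [ts|] := eqVneq t s; [move: ot; rewrite ts (negPf os) | rewrite expr0].
Qed.
Lemma even_prod1 N s : (0 < s < N)%N -> ~~ odd s ->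
  even_prod N (fun t => (t == s) : nat) = 1 - z ^+ s.
Proof.
move=> sN os; rewrite /even_prod (big_rem s) /= ?mem_index_iota // os eqxx expr1.
rewrite big_seq_cond big1 ?mulr1 // => t /andP[].
by rewrite mem_rem_uniq ?iota_uniq // inE => /andP[/negPf -> _] _; rewrite expr0.
Qed.
Lemma even_prod1_odd N s : odd s -> even_prod N (fun t => (t == s) : nat) = 1.
Proof.
move=> os; rewrite /even_prod big1 // => t ot.
by have [ts|] := eqVneq t s; [move: ot; rewrite ts os | rewrite expr0].
Qed.

(** For z nilpotent these elements are regular, and they are the only ones that
    have to be cancelled. *)
Definition unipotent (x : T) := exists y, x = 1 + z * y.

Lemma unipotent1 : unipotent 1.
Proof. by exists 0; rewrite mulr0 addr0. Qed.
Lemma unipotentM x y : unipotent x -> unipotent y -> unipotent (x * y).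
Proof. by move=> [a ->] [b ->]; exists (a + b + z * a * b); ring. Qed.
Lemma unipotentX x n : unipotent x -> unipotent (x ^+ n).
Proof.
move=> ux; elim: n => [|n IH]; first exact: unipotent1.
by rewrite exprS; apply: unipotentM.
Qed.

Lemma unipotent_odd_prod N l : unipotent (odd_prod N l).
Proof.
rewrite /odd_prod big_seq_cond.
apply: (big_ind unipotent unipotent1 unipotentM) => s.
rewrite mem_index_iota => /andP[/andP[s0 _] _]; apply: unipotentX.
by exists (z ^+ s.-1); rewrite -exprS prednK.
Qed.
Lemma unipotent_even_prod N l : unipotent (even_prod N l).
Proof.
rewrite /even_prod big_seq_cond.
apply: (big_ind unipotent unipotent1 unipotentM) => s.
rewrite mem_index_iota => /andP[/andP[s0 _] _]; apply: unipotentX.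
by exists (- z ^+ s.-1); rewrite mulrN -exprS prednK.
Qed.

Lemma unipotent_inj N x y1 y2 : z ^+ N = 0 -> unipotent x ->
  x * y1 = x * y2 -> y1 = y2.
Proof.
move=> zN [u ->] /eqP; rewrite -subr_eq0 -mulrBr => /eqP.
move: (y1 - y2) (subr_eq0 y1 y2) => c cP xc; apply/eqP; rewrite -cP; apply/eqP.
have cE : c = (- (z * u)) * c by rewrite -[LHS]subr0 -xc; ring.
have cX m : c = (- (z * u)) ^+ m * c.
  elim: m => [|m IH]; first by rewrite mul1r.
  by rewrite exprSr -mulrA -cE.
by rewrite (cX N) exprNn exprMn zN mul0r mulr0 mul0r.
Qed.

(** The factors with s >= N are 1, because z^s = 0. *)
Lemma odd_prod_trunc N N' l : z ^+ N = 0 -> (N <= N')%N ->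
  odd_prod N' l = odd_prod N l.
Proof.
case: N => [|N] zN NN'.
  have z1 (a : T) : a = 0 by rewrite -[a]mul1r -(expr0 z) zN mul0r.
  by rewrite (z1 (odd_prod N' l)) (z1 (odd_prod 0 l)).
rewrite /odd_prod (big_cat_nat (n := N.+1)) //= [X in _ * X]big_seq_cond.
rewrite [X in _ * X]big1 ?mulr1 // => s.
rewrite mem_index_iota => /andP[/andP[Ns _] _].
by rewrite -(subnK Ns) exprD zN mulr0 addr0 expr1n.
Qed.
Lemma even_prod_trunc N N' l : z ^+ N = 0 -> (N <= N')%N ->
  even_prod N' l = even_prod N l.
Proof.
case: N => [|N] zN NN'.
  have z1 (a : T) : a = 0 by rewrite -[a]mul1r -(expr0 z) zN mul0r.
  by rewrite (z1 (even_prod N' l)) (z1 (even_prod 0 l)).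
rewrite /even_prod (big_cat_nat (n := N.+1)) //= [X in _ * X]big_seq_cond.
rewrite [X in _ * X]big1 ?mulr1 // => s.
rewrite mem_index_iota => /andP[/andP[Ns _] _].
by rewrite -(subnK Ns) exprD zN mulr0 subr0 expr1n.
Qed.

Lemma expr1Dz s n : z ^+ s * z ^+ s = 0 -> (1 + z ^+ s) ^+ n = 1 + z ^+ s *+ n.
Proof.
move=> zs; elim: n => [|n IH]; first by rewrite mulr0n addr0.
rewrite exprS IH mulrDl mul1r mulrDr mulr1 mulrnAr zs mul0rn addr0 mulrS.
by rewrite -addrA [z ^+ s + _]addrC.
Qed.
Lemma expr1Bz s n : z ^+ s * z ^+ s = 0 -> (1 - z ^+ s) ^+ n = 1 - z ^+ s *+ n.
Proof.
move=> zs; elim: n => [|n IH]; first by rewrite mulr0n subr0.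
rewrite exprS IH mulrBl mul1r mulrBr mulr1 mulrnAr zs mul0rn subr0 mulrS.
by rewrite opprD -addrA [- z ^+ s + _]addrC.
Qed.

(** The factors of degree less than s cancel, and (1 +- z^s)^l is linear in l
    because z^s squares to zero. *)
Lemma deviation_unique_step s a b : (0 < s)%N -> z ^+ s.+1 = 0 ->
  (forall j, (0 < j < s)%N -> a j = b j) ->
  even_prod s.+1 a * odd_prod s.+1 b = odd_prod s.+1 a * even_prod s.+1 b ->
  z ^+ s *+ a s = z ^+ s *+ b s.
Proof.
move=> s0 zs ab.
have zz : z ^+ s * z ^+ s = 0.
  by rewrite -exprD -(prednK s0) addSnnS exprD prednK // zs mulr0.
have Oab : odd_prod s a = odd_prod s b.
  by rewrite /odd_prod big_seq_cond [RHS]big_seq_cond; apply: eq_bigr => j /andP[];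
    rewrite mem_index_iota => /ab ->.
have Eab : even_prod s a = even_prod s b.
  by rewrite /even_prod big_seq_cond [RHS]big_seq_cond; apply: eq_bigr => j /andP[];
    rewrite mem_index_iota => /ab ->.
have Os l : odd_prod s.+1 l = odd_prod s l * (if odd s then 1 + z ^+ s *+ l s else 1).
  by rewrite /odd_prod big_mkcond big_nat_recr //= -big_mkcond expr1Dz.
have Es l : even_prod s.+1 l = even_prod s l * (if odd s then 1 else 1 - z ^+ s *+ l s).
  by rewrite /even_prod big_mkcond big_nat_recr //= -big_mkcond expr1Bz //; case: odd.
have uOE := unipotentM (unipotent_odd_prod s b) (unipotent_even_prod s b).
rewrite !Os !Es Oab Eab; case: odd; rewrite ?mulr1 => h.
  suff : 1 + z ^+ s *+ b s = 1 + z ^+ s *+ a s by move/addrI.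
  by apply: (unipotent_inj zs uOE); rewrite mulrAC -mulrA [RHS]mulrAC -h; ring.
suff : 1 - z ^+ s *+ a s = 1 - z ^+ s *+ b s by move/addrI/oppr_inj.
by apply: (unipotent_inj zs uOE); rewrite -[RHS]mulrA -h; ring.
Qed.

(* M and R are the generating series of the Motzkin and of the Riordan numbers,
   given by their functional equations.  The third series x is t / (1 - t) at
   t = - z, where t / (1 - t) counts the powers of one vertex. *)
Variables M R x : T.
Hypothesis MP : M = 1 + z * M + z ^+ 2 * M ^+ 2.
Hypothesis RP : R = 1 + z ^+ 2 * M * R.
Hypothesis xP : (1 + z) * x = - z.

Let lam := 1 - z * R.
Let mu := z * R.

Lemma riordan_motzkin : M = R * (1 + z * M).
Proof.
have RM : R * (1 - z ^+ 2 * M) = 1 by rewrite mulrBr mulr1 {1}RP; ring.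
have MM : (1 - z ^+ 2 * M) * M = 1 + z * M by rewrite mulrBl mul1r {1}MP; ring.
by rewrite -MM mulrA RM mul1r.
Qed.

Lemma riordan_motzkin1 : R * (1 + z) = 1 + z * M.
Proof.
have RM : R * (1 - z ^+ 2 * M) = 1 by rewrite mulrBr mulr1 {1}RP; ring.
have -> : 1 + z = (1 - z ^+ 2 * M) * (1 + z * M).
  have -> : (1 - z ^+ 2 * M) * (1 + z * M) =
            1 + z * M - z * (1 + z * M + z ^+ 2 * M ^+ 2) + z by ring.
  by rewrite -MP; ring.
by rewrite mulrA RM mul1r.
Qed.

Lemma lam_inv : lam * (1 + z * M) = 1.
Proof.
have -> : lam * (1 + z * M) = 1 + z * M - z * (R * (1 + z * M)).
  by rewrite /lam; ring.
by rewrite -riordan_motzkin addrK.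
Qed.

Variable N : nat.
Hypothesis zN : z ^+ N = 0.

Lemma lam_mu : lam * mu = - x.
Proof.
have u1z : unipotent (1 + z) by exists 1; rewrite mulr1.
apply: (unipotent_inj zN u1z); rewrite mulrN xP opprK.
have -> : (1 + z) * (lam * mu) = z * (lam * (R * (1 + z))) by rewrite /mu; ring.
by rewrite riordan_motzkin1 lam_inv mulr1.
Qed.

Lemma lamDmu : lam + mu = 1.
Proof. by rewrite /lam /mu subrK. Qed.

Lemma unipotent_lam : unipotent lam.
Proof. by exists (- R); rewrite mulrN. Qed.

(** lam and mu are the roots of the characteristic polynomial T^2 - T - x of the
    recursion that the Hilbert series of paths satisfy. *)
Lemma char_root r a : r = lam \/ r = mu -> r ^+ a.+2 = r ^+ a.+1 + x * r ^+ a.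
Proof.
have -> : x = - (lam * mu) by rewrite lam_mu opprK.
have e : r ^+ a.+1 = r ^+ a.+1 * (lam + mu) by rewrite lamDmu mulr1.
by rewrite e => -[->|->]; rewrite !exprS; ring.
Qed.

Variable a : nat -> T.
Hypotheses (a0 : a 0%N = 1) (a1 : a 1%N = 1 + x).
Hypothesis a2 : forall n, a n.+2 = a n.+1 + x * a n.

Lemma path_binet n : (lam - mu) * a n = lam ^+ n.+2 - mu ^+ n.+2.
Proof.
have e : x = - (lam * mu) by rewrite lam_mu opprK.
suff : (lam - mu) * a n = lam ^+ n.+2 - mu ^+ n.+2 /\
       (lam - mu) * a n.+1 = lam ^+ n.+3 - mu ^+ n.+3 by case.
elim: n => [|n [IH1 IH2]]; last first.
  split=> //; rewrite a2 mulrDr IH2 mulrCA IH1.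
  by rewrite (char_root n.+2 (or_introl erefl)) (char_root n.+2 (or_intror erefl)); ring.
rewrite a0 a1; split.
  by rewrite -[LHS]mulr1 -{2}lamDmu; ring.
have -> : (lam - mu) * (1 + x) = (lam - mu) * ((lam + mu) ^+ 2 + x).
  by rewrite lamDmu expr1n.
by rewrite e; ring.
Qed.

(** So 1 / (1 - z^2 M^2) is lam^2 / (lam - mu), the factor by which the series of
    a path deviates from a pure power of lam. *)
Lemma discr_lam : lam ^+ 2 * (1 - z ^+ 2 * M ^+ 2) = lam - mu.
Proof.
have e : lam * (z * M) = mu.
  have -> : lam * (z * M) = lam * (1 + z * M) - lam by ring.
  by rewrite lam_inv -lamDmu; ring.
have -> : lam ^+ 2 * (1 - z ^+ 2 * M ^+ 2) =
   (lam + lam * (z * M)) * (lam - lam * (z * M)) by ring.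
by rewrite e lamDmu mul1r.
Qed.

(** The term mu^(n+2) in Binet's formula is divisible by z^(n+2); this is why the
    formula for paths holds up to degree n + 1. *)
Lemma path_asymptotics n : z ^+ n.+2 = 0 ->
  (1 - z ^+ 2 * M ^+ 2) * a n = lam ^+ n.
Proof.
move=> zn; have u2 := unipotentX 2 unipotent_lam.
apply: (unipotent_inj zN u2); rewrite mulrA discr_lam path_binet.
by rewrite /mu exprMn zn mul0r subr0 -exprD.
Qed.

(** The Lucas sequence attached to the recursion. *)
Lemma cycle_binet n : a n.+2 + x * a n = lam ^+ n.+3 + mu ^+ n.+3.
Proof.
have e : x = - (lam * mu) by rewrite lam_mu opprK.
suff : a n.+2 + x * a n = lam ^+ n.+3 + mu ^+ n.+3 /\
       a n.+3 + x * a n.+1 = lam ^+ n.+4 + mu ^+ n.+4 by case.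
elim: n => [|n [IH1 IH2]]; last first.
  split=> //; rewrite a2 [a n.+2]a2.
  rewrite (char_root n.+3 (or_introl erefl)) (char_root n.+3 (or_intror erefl)).
  have -> : lam ^+ n.+4 + x * lam ^+ n.+3 + (mu ^+ n.+4 + x * mu ^+ n.+3) =
    (lam ^+ n.+4 + mu ^+ n.+4) + x * (lam ^+ n.+3 + mu ^+ n.+3) by ring.
  by rewrite -IH1 -IH2 [a n.+2]a2; ring.
rewrite !a2 a0 a1.
have l3 r : r = lam \/ r = mu -> r ^+ 3 = (1 + x) * r + x.
  move=> h; rewrite (char_root 1 h) (char_root 0 h) expr0 expr1; ring.
have l4 r : r = lam \/ r = mu -> r ^+ 4 = (1 + x) * (r + x) + x * r.
  move=> h; rewrite (char_root 2 h) (char_root 1 h) (char_root 0 h) expr0 expr1; ring.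
rewrite (l3 _ (or_introl erefl)) (l3 _ (or_intror erefl)).
rewrite (l4 _ (or_introl erefl)) (l4 _ (or_intror erefl)).
have -> : (1 + x) * lam + x + ((1 + x) * mu + x) = (1 + x) * (lam + mu) + x + x by ring.
have -> : (1 + x) * (lam + x) + x * lam + ((1 + x) * (mu + x) + x * mu) =
  (1 + x) * (lam + mu + x + x) + x * (lam + mu) by ring.
by rewrite lamDmu; split; ring.
Qed.

(** This power separates the n-th deviation of the n-cycle from the linear
    formula. *)
Lemma mu_pow n : z ^+ n.+1 = 0 -> mu ^+ n = z ^+ n.
Proof.
move=> zn; have [c ->] : exists c, mu ^+ n = z ^+ n * (1 + z * c).
  have [c cP] : unipotent R by exists (z * M * R); rewrite {1}RP; ring.
  have [d dP] : unipotent (R ^+ n) by apply: unipotentX; exists c.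
  by exists d; rewrite /mu exprMn dP.
by rewrite mulrDr mulr1 mulrA -exprSr zn mul0r addr0.
Qed.

(* gamma consists of the exponents of 1 / lam, and alpha of those of
   1 / (1 - z^2 M^2) = lam^2 / (lam - mu). *)
Variables gamma alpha : nat -> nat.
Hypothesis gammaP : even_prod N gamma = odd_prod N gamma * lam.
Hypothesis alphaP :
  even_prod N alpha = odd_prod N alpha * (1 - z ^+ 2 * M ^+ 2).

Lemma path_deviation_prod n eps : z ^+ n.+2 = 0 ->
  even_prod N eps = odd_prod N eps * a n ->
  let l s := (eps s + alpha s)%N in let g s := (gamma s * n)%N in
  even_prod N l * odd_prod N g = odd_prod N l * even_prod N g.
Proof.
move=> zn epsP l g; rewrite even_prodD !odd_prodD odd_prodM even_prodM.
rewrite epsP alphaP gammaP exprMn -(path_asymptotics zn); ring.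
Qed.

Lemma cycle_deviation_prod n eps : (0 < n < N)%N -> z ^+ n.+1 = 0 ->
  even_prod N eps = odd_prod N eps * (lam ^+ n + mu ^+ n) ->
  let l s := (eps s + (s == n))%N in let g s := (gamma s * n)%N in
  even_prod N l * odd_prod N g = odd_prod N l * even_prod N g.
Proof.
move=> nN zn epsP l g; rewrite even_prodD !odd_prodD odd_prodM even_prodM.
rewrite epsP (mu_pow zn) gammaP exprMn.
(* Modulo z^(n+1) the factor z^n absorbs every unipotent factor. *)
have zu (u : T) : unipotent u -> z ^+ n * u = z ^+ n.
  by move=> [c ->]; rewrite mulrDr mulr1 mulrA -exprSr zn mul0r addr0.
set O := odd_prod N eps; set G := odd_prod N gamma ^+ n.
have uG : unipotent G by apply/unipotentX/unipotent_odd_prod.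
have uL : unipotent (lam ^+ n) by apply/unipotentX/unipotent_lam.
have zz : z ^+ n * z ^+ n = 0.
  case/andP: nN => n0 _.
  by rewrite -exprD -(prednK n0) addSnnS exprD prednK // zn mulr0.
have [on|on] := boolP (odd n).
  rewrite odd_prod1 // even_prod1_odd //.
  have -> : O * (1 + z ^+ n) * (G * lam ^+ n) =
    O * G * (lam ^+ n + z ^+ n * lam ^+ n) by ring.
  by rewrite zu //; ring.
rewrite odd_prod1_even // even_prod1 //.
have -> : O * (lam ^+ n + z ^+ n) * (1 - z ^+ n) * G =
  O * G * (lam ^+ n + z ^+ n - z ^+ n * lam ^+ n - z ^+ n * z ^+ n) by ring.
by rewrite zu // zz; ring.
Qed.

End Nilpotent.

Section Truncation.
Local Notation series := {poly int}.

Definition eqX N (p q : series) := forall i, (i < N)%N -> p`_i = q`_i.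

(** The ring Z[X]/(X^(N+1)), of which only the projection onto it matters. *)
Lemma truncation_ring N :
  {T : comNzRingType & {phi : {rmorphism series -> T} |
    forall p q, phi p = phi q <-> eqX N.+1 p q}}.
Proof.
pose h : series := 'X^(N.+1).
have sz : size (mk_monic h) = N.+2 by rewrite mk_monic_Xn size_polyXn.
have coefT (r : series) i : (i < N.+1)%N -> (in_qpoly h r : series)`_i = r`_i.
  move=> iN; rewrite /= mk_monic_Xn.
  rewrite {2}[r](Pdiv.RingMonic.rdivp_eq (monicXn _ N.+1)).
  by rewrite coefD coefMXn iN add0r.
exists {poly %/ h}; exists (in_qpoly h) => p q; split=> pq.
  move=> i iN; have := coefT q _ iN.
  have -> : in_qpoly h q = in_qpoly h p := esym pq.
  by rewrite coefT.
apply/val_inj/polyP => i /=; have [iN|Ni] := ltnP i N.+1.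
  by rewrite !coefT // pq.
have le r : (size (in_qpoly h r : series) <= i)%N.
  by apply: leq_trans Ni; rewrite -ltnS -[X in (_ < X)%N]sz size_mk_monic.
by rewrite (nth_default _ (le p)) (nth_default _ (le q)).
Qed.

Definition trunc_ring N : comNzRingType := tag (truncation_ring N).
Definition trunc N : {rmorphism series -> trunc_ring N} :=
  sval (tagged (truncation_ring N)).

Lemma trunc_eq N p q : eqX N.+1 p q <-> trunc N p = trunc N q.
Proof. by rewrite /trunc; case: (tagged _) => phi phiP /=; rewrite phiP. Qed.

Lemma trunc_Xn N : (trunc N 'X) ^+ N.+1 = 0.
Proof.
rewrite -rmorphXn -(rmorph0 (trunc N)); apply/trunc_eq => i iN.
by rewrite coefXn coef0 ltn_eqF.
Qed.

Lemma trunc_even_prod N n l :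
  trunc N (even_prod 'X n l) = even_prod (trunc N 'X) n l.
Proof.
rewrite rmorph_prod; apply: eq_bigr => s _.
by rewrite rmorphXn rmorphB rmorph1 rmorphXn.
Qed.
Lemma trunc_odd_prod N n l :
  trunc N (odd_prod 'X n l) = odd_prod (trunc N 'X) n l.
Proof.
rewrite rmorph_prod; apply: eq_bigr => s _.
by rewrite rmorphXn rmorphD rmorph1 rmorphXn.
Qed.

Lemma trunc_leq N N' p q : (N <= N')%N ->
  trunc N' p = trunc N' q -> trunc N p = trunc N q.
Proof.
move=> NN /trunc_eq pq; apply/trunc_eq => i iN; apply: pq.
exact: leq_trans iN _.
Qed.

(** Degree by degree: the equation is pushed to Z[X]/(X^(s+1)), where the
    exponents in degrees less than s are already known to agree. *)
Lemma deviation_unique N a b :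
  even_prod (trunc N 'X) N.+1 a * odd_prod (trunc N 'X) N.+1 b =
    odd_prod (trunc N 'X) N.+1 a * even_prod (trunc N 'X) N.+1 b ->
  forall s, (0 < s <= N)%N -> a s = b s.
Proof.
rewrite -!trunc_even_prod -!trunc_odd_prod -!rmorphM => ab.
elim/ltn_ind => s IH /andP[s0 sN]; have sN1 : (s.+1 <= N.+1)%N := sN.
have := trunc_leq sN ab.
rewrite !rmorphM !trunc_even_prod !trunc_odd_prod.
rewrite !(even_prod_trunc _ (trunc_Xn s) sN1) !(odd_prod_trunc _ (trunc_Xn s) sN1) => e.
have := deviation_unique_step s0 (trunc_Xn s) _ e.
have jh j : (0 < j < s)%N -> a j = b j.
  by case/andP=> j0 js; apply: IH; rewrite // j0 (leq_trans (ltnW js)).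
move/(_ jh); rewrite -rmorphXn -!rmorphMn => /trunc_eq/(_ s (ltnSn s)).
by rewrite !coefMn coefXn eqxx /= => /eqP; rewrite eqr_nat => /eqP.
Qed.

Definition nonneg_coefs (p : series) := forall i, 0 <= p`_i.

Lemma nonneg_coefsM p q : nonneg_coefs p -> nonneg_coefs q -> nonneg_coefs (p * q).
Proof. by move=> hp hq i; rewrite coefM sumr_ge0 // => j _; rewrite mulr_ge0. Qed.
Lemma nonneg_coefsD p q : nonneg_coefs p -> nonneg_coefs q -> nonneg_coefs (p + q).
Proof. by move=> hp hq i; rewrite coefD addr_ge0. Qed.
Lemma nonneg_coefsXn n : nonneg_coefs 'X^n.
Proof. by move=> i; rewrite coefXn ler0n. Qed.

(** Lazard elimination, for series: one of the generators counted by f, of degree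
    s, is split off.  Write f = X^s + f'.  For s even,
      1 - f = (1 - X^s) (1 - f' / (1 - X^s)),
    and for s odd,
      (1 - f) (1 + X^s) = 1 - X^(2 s) - f' (1 + X^s);
    in both cases the new f has nonnegative coefficients. *)
Lemma eliminate_generator N s f : (0 < s <= N)%N -> nonneg_coefs f ->
  (forall i, (i < s)%N -> f`_i = 0) -> 0 < f`_s ->
  exists g, [/\ nonneg_coefs g, forall i, (i < s)%N -> g`_i = 0, g`_s = f`_s - 1 &
    let l t := (t == s) : nat in
    trunc N (even_prod 'X N.+1 l * (1 - g)) =
    trunc N (odd_prod 'X N.+1 l * (1 - f))].
Proof.
move=> sN f0 fs fs1; have s0 : (0 < s)%N by case/andP: sN.
have [f' fE] : exists f', f' = f - 'X^s by eexists.
have f'0 : nonneg_coefs f'.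
  move=> i; rewrite fE coefB coefXn; have [->|_] := eqVneq i s.
    by rewrite subr_ge0 -gtz0_ge1.
  by rewrite subr0.
have f's i : (i < s)%N -> f'`_i = 0.
  by move=> is_; rewrite fE coefB coefXn (fs _ is_) (ltn_eqF is_) subrr.
have f'h h i : (i <= s)%N -> (f' * (1 + h * 'X^s))`_i = f'`_i.
  move=> is_; rewrite mulrDr mulr1 coefD mulrA coefMXn.
  case: ltnP => [_|si]; first by rewrite addr0.
  have -> : i = s by apply/eqP; rewrite eqn_leq is_.
  by rewrite subnn coefM big_ord1 /= (f's 0%N) // mul0r addr0.
have [os|os] := boolP (odd s).
  exists ('X^(s + s) + f' * (1 + 1 * 'X^s)); split.
  - apply: nonneg_coefsD; first exact: nonneg_coefsXn.
    apply: nonneg_coefsM => //; apply: nonneg_coefsD; first exact: (nonneg_coefsXn 0).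
    by rewrite mul1r; apply: nonneg_coefsXn.
  - move=> i is_; rewrite coefD coefXn (f'h _ _ (ltnW is_)) (f's _ is_).
    by rewrite (ltn_eqF (leq_trans is_ (leq_addr _ _))) addr0.
  - have ss : (s < s + s)%N by rewrite -[X in (X < _)%N]addn0 ltn_add2l.
    by rewrite coefD coefXn (f'h _ _ (leqnn s)) fE coefB coefXn eqxx (ltn_eqF ss) add0r.
  - rewrite /= even_prod1_odd ?odd_prod1 //; congr (trunc N _).
    by rewrite fE exprD; ring.
pose h : series := \sum_(j < N) 'X^(s * j).
exists (f' * (1 + h * 'X^s)); split.
- apply: nonneg_coefsM => //; apply: nonneg_coefsD; first exact: (nonneg_coefsXn 0).
  apply: nonneg_coefsM; last exact: nonneg_coefsXn.
  move=> i; rewrite coef_sum sumr_ge0 // => j _; exact: nonneg_coefsXn.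
- by move=> i is_; rewrite (f'h _ _ (ltnW is_)) (f's _ is_).
- by rewrite (f'h _ _ (leqnn s)) fE coefB coefXn eqxx.
rewrite /= even_prod1 ?odd_prod1_even //.
have hP : (1 - 'X^s) * h = 1 - 'X^(s * N).
  have -> : h = \sum_(j < N) 1 ^+ (N.-1 - j) * ('X^s) ^+ j.
    by apply: eq_bigr => j _; rewrite expr1n mul1r exprM.
  by rewrite -subrXX expr1n -exprM.
have -> : (1 - 'X^s) * (1 - f' * (1 + h * 'X^s)) =
  1 * (1 - f) + 'X^(s + s * N) * f'.
  have -> : (1 - 'X^s) * (1 - f' * (1 + h * 'X^s)) =
    (1 - 'X^s) - f' * ((1 - 'X^s) + ((1 - 'X^s) * h) * 'X^s) by ring.
  by rewrite hP fE exprD; ring.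
apply/trunc_eq => i iN; rewrite coefD ['X^(s + _) * _]mulrC coefMXn.
have -> : (i < s + s * N)%N; last by rewrite addr0.
by apply: leq_trans iN _; rewrite -addn1 addnC leq_add // leq_pmull.
Qed.

Lemma eliminate_degree N s f : (0 < s <= N)%N -> nonneg_coefs f ->
  (forall i, (i < s)%N -> f`_i = 0) ->
  exists g l, [/\ nonneg_coefs g, forall i, (i < s.+1)%N -> g`_i = 0 &
    trunc N (even_prod 'X N.+1 l * (1 - g)) =
    trunc N (odd_prod 'X N.+1 l * (1 - f))].
Proof.
move=> sN; have [c] := ubnP (absz f`_s).
elim: c f => // c IH f; rewrite ltnS => fc f0 fs.
have [fs0|fs1] := eqVneq f`_s 0.
  exists f, (fun _ => 0%N); split=> //.
    by move=> i; rewrite ltnS leq_eqVlt => /orP[/eqP ->|/fs].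
  have -> : even_prod 'X N.+1 (fun _ => 0%N) = 1 :> series by apply: big1.
  by have -> : odd_prod 'X N.+1 (fun _ => 0%N) = 1 :> series by apply: big1.
have fpos : 0 < f`_s by rewrite lt0r fs1 f0.
have [g [g0 gs gf gP]] := eliminate_generator sN f0 fs fpos.
have gc : (absz (g`_s)%R < c)%N by move: fc fpos; rewrite gf; lia.
have [h [l [h0 hs hP]]] := IH g gc g0 gs.
exists h, (fun t => l t + (t == s))%N; split=> //.
rewrite even_prodD odd_prodD.
rewrite [even_prod _ _ l * _]mulrC [odd_prod _ _ l * _]mulrC -!mulrA.
rewrite rmorphM hP -rmorphM mulrCA rmorphM gP -rmorphM; congr (trunc N _).
by ring.
Qed.

(** The series 1 / (1 - f) with f >= 0 is the Hilbert series of a free associative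
    algebra, that is, of the enveloping algebra of a free Lie superalgebra; its
    exponents are the dimensions of the latter. *)
Lemma natural_exponents N f : nonneg_coefs f -> f`_0 = 0 ->
  exists l, even_prod (trunc N 'X) N.+1 l =
            odd_prod (trunc N 'X) N.+1 l * trunc N (1 - f).
Proof.
move=> f0 f00.
suff H s : (s <= N)%N -> exists g l, [/\ nonneg_coefs g,
    forall i, (i < s.+1)%N -> g`_i = 0 &
    trunc N (even_prod 'X N.+1 l * (1 - g)) =
    trunc N (odd_prod 'X N.+1 l * (1 - f))].
  have [g [l [_ gs lP]]] := H N (leqnn N); exists l; rewrite -trunc_even_prod -trunc_odd_prod -rmorphM -lP rmorphM.
  have -> : trunc N (1 - g) = 1; last by rewrite mulr1.
  rewrite -(rmorph1 (trunc N)); apply/trunc_eq => i iN.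
  by rewrite coefB gs // subr0.
elim: s => [|s IH] sN.
  exists f, (fun _ => 0%N); split=> //; first by case.
  have -> : even_prod 'X N.+1 (fun _ => 0%N) = 1 :> series by apply: big1.
  by have -> : odd_prod 'X N.+1 (fun _ => 0%N) = 1 :> series by apply: big1.
have [g [l [g0 gs gP]]] := IH (ltnW sN).
have [h [m [h0 hs hP]]] := eliminate_degree (s := s.+1) sN g0 gs.
exists h, (fun t => m t + l t)%N; split=> //.
rewrite even_prodD odd_prodD.
rewrite [even_prod _ _ m * _]mulrC [odd_prod _ _ m * _]mulrC -!mulrA.
rewrite rmorphM hP -rmorphM mulrCA rmorphM gP -rmorphM; congr (trunc N _).
by ring.
Qed.

(** By uniqueness, the exponents found modulo different powers of X agree, and so
    they form a single sequence. *)
Lemma natural_exponents_stable (f : nat -> series) :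
  (forall N, nonneg_coefs (f N)) -> (forall N, (f N)`_0 = 0) ->
  (forall N N', (N <= N')%N -> trunc N (f N') = trunc N (f N)) ->
  exists l, forall N, even_prod (trunc N 'X) N.+1 l =
            odd_prod (trunc N 'X) N.+1 l * trunc N (1 - f N).
Proof.
move=> f0 f00 fst.
have /choice[L LP] := fun N => natural_exponents N (f0 N) (f00 N).
have Lst N N' s : (0 < s <= N)%N -> (N <= N')%N -> L N s = L N' s.
  move=> sN NN'; apply: deviation_unique sN; rewrite LP.
  have : trunc N (even_prod 'X N'.+1 (L N')) =
         trunc N (odd_prod 'X N'.+1 (L N') * (1 - f N')).
    apply: (trunc_leq NN'); rewrite rmorphM trunc_even_prod trunc_odd_prod.
    exact: LP.
  rewrite rmorphM trunc_even_prod trunc_odd_prod.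
  rewrite (even_prod_trunc _ (trunc_Xn N)) // (odd_prod_trunc _ (trunc_Xn N)) // => ->.
  by rewrite !rmorphB (fst _ _ NN'); ring.
exists (fun s => L s s) => N.
have -> : even_prod (trunc N 'X) N.+1 (fun s => L s s) =
          even_prod (trunc N 'X) N.+1 (L N).
  rewrite /even_prod big_seq_cond [RHS]big_seq_cond; apply: eq_bigr => s /andP[].
  by rewrite mem_index_iota => /andP[s0 sN] _; rewrite (Lst s N) // s0 leqnn.
have -> : odd_prod (trunc N 'X) N.+1 (fun s => L s s) =
          odd_prod (trunc N 'X) N.+1 (L N).
  rewrite /odd_prod big_seq_cond [RHS]big_seq_cond; apply: eq_bigr => s /andP[].
  by rewrite mem_index_iota => /andP[s0 sN] _; rewrite (Lst s N) // s0 leqnn.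
exact: LP.
Qed.

(** Iterating the functional equation j times determines its solution modulo
    X^j. *)
Fixpoint motzkin j : series :=
  if j is j.+1 then 1 + 'X * motzkin j + 'X^2 * motzkin j ^+ 2 else 0.
Fixpoint riordan j : series :=
  if j is j.+1 then 1 + 'X^2 * motzkin j * riordan j else 0.

Lemma nonneg_motzkin j : nonneg_coefs (motzkin j).
Proof.
elim: j => [|j IH] /=; first by move=> i; rewrite coef0.
apply: nonneg_coefsD; first apply: nonneg_coefsD.
- exact: (nonneg_coefsXn 0).
- by apply: nonneg_coefsM => //; apply: (nonneg_coefsXn 1).
by apply: nonneg_coefsM; [apply: nonneg_coefsXn | apply: nonneg_coefsM].
Qed.
Lemma nonneg_riordan j : nonneg_coefs (riordan j).
Proof.
elim: j => [|j IH] /=; first by move=> i; rewrite coef0.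
apply: nonneg_coefsD; first exact: (nonneg_coefsXn 0).
apply: nonneg_coefsM => //; apply: nonneg_coefsM; last exact: nonneg_motzkin.
exact: nonneg_coefsXn.
Qed.

Lemma motzkin_step j : exists r : series, motzkin j.+1 = motzkin j + 'X^j * r.
Proof.
elim: j => [|j [r rP]]; first by exists 1; rewrite /= expr0; ring.
exists (r * (1 + 'X * (motzkin j.+1 + motzkin j))).
rewrite -[motzkin j.+2]/(1 + 'X * motzkin j.+1 + 'X^2 * motzkin j.+1 ^+ 2).
have e : motzkin j.+1 = 1 + 'X * motzkin j + 'X^2 * motzkin j ^+ 2 by [].
by rewrite {3}e rP (exprS _ j); ring.
Qed.
Lemma motzkin_stable N N' : (N <= N')%N -> exists r : series, motzkin N' = motzkin N + 'X^N * r.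
Proof.
move=> NN'; rewrite -(subnKC NN'); elim: (N' - N)%N => [|d [r rP]].
  by exists 0; rewrite addn0; ring.
have [u uP] := motzkin_step (N + d).
by exists (r + 'X^d * u); rewrite addnS uP rP exprD; ring.
Qed.

Lemma riordan_step j : exists r : series, riordan j.+1 = riordan j + 'X^j * r.
Proof.
elim: j => [|j [r rP]]; first by exists 1; rewrite /= expr0; ring.
have [u uP] := motzkin_step j.
exists ('X * (u * riordan j.+1 + motzkin j * r)).
rewrite -[riordan j.+2]/(1 + 'X^2 * motzkin j.+1 * riordan j.+1).
have e : riordan j.+1 = 1 + 'X^2 * motzkin j * riordan j by [].
by rewrite {2}e uP rP (exprS _ j); ring.
Qed.

Lemma riordan_stable N N' : (N <= N')%N -> exists r : series, riordan N' = riordan N + 'X^N * r.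
Proof.
move=> NN'; rewrite -(subnKC NN'); elim: (N' - N)%N => [|d [r rP]].
  by exists 0; rewrite addn0; ring.
have [u uP] := riordan_step (N + d).
by exists (r + 'X^d * u); rewrite addnS uP rP exprD; ring.
Qed.

End Truncation.

Section Pattern.
Local Notation series := {poly int}.

(** Here a n is the value at - X of the Hilbert series of the path on n vertices,
    and a (n + 2) + x a n that of the cycle on n + 3 vertices. *)
Lemma deviation_pattern : exists gamma alpha : nat -> nat,
  forall N (x : series) (a : nat -> series) (eps : nat -> nat),
    trunc N ((1 + 'X) * x) = trunc N (- 'X) ->
    a 0%N = 1 -> a 1%N = 1 + x -> (forall m, a m.+2 = a m.+1 + x * a m) ->
    (forall n, N = n.+1 ->
       trunc N (even_prod 'X N.+1 eps) = trunc N (odd_prod 'X N.+1 eps * a n) ->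
       forall s, (0 < s <= N)%N -> (eps s + alpha s = gamma s * n)%N) /\
    (forall n, N = n.+3 ->
       trunc N (even_prod 'X N.+1 eps) =
         trunc N (odd_prod 'X N.+1 eps * (a n.+2 + x * a n)) ->
       forall s, (0 < s <= N)%N -> (eps s + (s == N) = gamma s * N)%N).
Proof.
have [|||gamma gammaP] := @natural_exponents_stable (fun N => 'X * riordan N.+1).
- move=> N; apply: nonneg_coefsM; first exact: (nonneg_coefsXn 1).
  exact: nonneg_riordan.
- by move=> N; rewrite coefXM.
- move=> N N' NN'; have [r rP] := riordan_stable (NN' : (N.+1 <= N'.+1)%N).
  rewrite rmorphM [RHS]rmorphM; congr (_ * _).
  by rewrite rP rmorphD rmorphM rmorphXn trunc_Xn mul0r addr0.
have [|||alpha alphaP] :=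
    @natural_exponents_stable (fun N => 'X^2 * motzkin N.+1 ^+ 2).
- move=> N; apply: nonneg_coefsM; first exact: (nonneg_coefsXn 2).
  by rewrite expr2; apply: nonneg_coefsM; apply: nonneg_motzkin.
- by move=> N; rewrite coefXnM.
- move=> N N' NN'; have [r rP] := motzkin_stable (NN' : (N.+1 <= N'.+1)%N).
  rewrite rmorphM [RHS]rmorphM; congr (_ * _); rewrite rmorphXn [RHS]rmorphXn.
  by rewrite rP rmorphD rmorphM rmorphXn trunc_Xn mul0r addr0.
exists gamma, alpha => N x a eps xP a0 a1 a2.
pose z := trunc N 'X; have zN : z ^+ N.+1 = 0 := trunc_Xn N.
pose M := trunc N (motzkin N.+1); pose R := trunc N (riordan N.+1).
have MP : M = 1 + z * M + z ^+ 2 * M ^+ 2.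
  have [r rP] := motzkin_step N.+1.
  have e : trunc N (motzkin N.+2) = M.
    by rewrite rP rmorphD rmorphM rmorphXn zN mul0r addr0.
  rewrite -{1}e; have -> : motzkin N.+2 = 1 + 'X * motzkin N.+1 + 'X^2 * motzkin N.+1 ^+ 2 by [].
  rewrite rmorphD [trunc N (1 + _)]rmorphD rmorph1.
  rewrite (rmorphM (trunc N) 'X) (rmorphM (trunc N) 'X^2).
  by rewrite (rmorphXn (trunc N) 2 'X) (rmorphXn (trunc N) 2 (motzkin N.+1)).
have RP : R = 1 + z ^+ 2 * M * R.
  have [r rP] := riordan_step N.+1.
  have e : trunc N (riordan N.+2) = R.
    by rewrite rP rmorphD rmorphM rmorphXn zN mul0r addr0.
  rewrite -{1}e; have -> : riordan N.+2 = 1 + 'X^2 * motzkin N.+1 * riordan N.+1 by [].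
  by rewrite rmorphD rmorph1 rmorphM [trunc N (_ * motzkin _)]rmorphM rmorphXn.
pose y := trunc N x; have yP : (1 + z) * y = - z.
  by rewrite -rmorphN -xP rmorphM rmorphD rmorph1.
pose b m := trunc N (a m).
have b0 : b 0%N = 1 by rewrite /b a0 rmorph1.
have b1 : b 1%N = 1 + y by rewrite /b a1 rmorphD rmorph1.
have b2 m : b m.+2 = b m.+1 + y * b m by rewrite /b a2 rmorphD rmorphM.
have gP : even_prod z N.+1 gamma = odd_prod z N.+1 gamma * (1 - z * R).
  by rewrite gammaP rmorphB rmorph1 rmorphM.
have aP : even_prod z N.+1 alpha = odd_prod z N.+1 alpha * (1 - z ^+ 2 * M ^+ 2).
  by rewrite alphaP rmorphB rmorph1 rmorphM !rmorphXn.
split=> n Nn; rewrite rmorphM trunc_even_prod trunc_odd_prod => epsP s sN.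
  have zn : z ^+ n.+2 = 0 by rewrite -Nn.
  have := path_deviation_prod MP RP yP zN b0 b1 b2 gP aP zn epsP.
  by move/deviation_unique; apply.
have cP : even_prod z N.+1 eps =
    odd_prod z N.+1 eps * ((1 - z * R) ^+ N + (z * R) ^+ N).
  have e : (1 - z * R) ^+ N + (z * R) ^+ N = (1 - z * R) ^+ n.+3 + (z * R) ^+ n.+3.
    by congr (_ ^+ _ + _ ^+ _).
  by rewrite epsP rmorphD rmorphM e -(cycle_binet MP RP yP zN b0 b1 b2).
have NN : (0 < N < N.+1)%N by rewrite Nn ltnS leqnn.
have := cycle_deviation_prod RP gP NN zN cP.
by move/deviation_unique; apply.
Qed.
End Pattern.

(** * Hilbert series of paths and cycles *)
(** The condition for the monomial u to be nonzero in the edge ring. *)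
Definition indep n (E : rel 'I_n) (u : 'X_{1..n}) : bool :=
  [forall i, forall j, E i j ==> ((u i == 0%N) || (u j == 0%N))].

Lemma indepP n (E : rel 'I_n) (u : 'X_{1..n}) :
  reflect (forall i j, E i j -> (u i == 0%N) || (u j == 0%N)) (indep E u).
Proof.
apply: (iffP forallP) => [h i j Eij|h i].
  by move: (h i) => /forallP/(_ j)/implyP; apply.
by apply/forallP => j; apply/implyP/h.
Qed.

Definition hilbert n (E : rel 'I_n) j : nat :=
  #|[pred u : 'X_{1..n < j.+1} | (mdeg u == j) && indep E u]|.

Section HilbertSeries.
Variable N : nat.
Local Notation series := {poly int}.

Fixpoint exponents n : seq (seq nat) :=
  if n is n.+1 then [seq r :: l | r <- iota 0 N, l <- exponents n] else [:: [::]].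

Lemma mem_exponents n l :
  (l \in exponents n) = (size l == n) && all (fun r => r < N)%N l.
Proof.
elim: n l => [|n IH] [|r l] //=.
  by apply/negbTE/negP => /allpairsP[[a b] []].
apply/allpairsP/andP => [[[a b] [/= ar bl [-> ->]]]|[/eqP[sl] /andP[rN lN]]].
  by move: ar bl; rewrite mem_iota add0n IH /= => -> /andP[/eqP -> ->].
by exists (r, l); rewrite mem_iota add0n /= IH sl eqxx.
Qed.

Lemma uniq_exponents n : uniq (exponents n).
Proof.
elim: n => // n IH /=; apply: allpairs_uniq; rewrite ?iota_uniq //.
by move=> [a b] [c d] _ _ /= [-> ->].
Qed.

Lemma coef_exprNX s j : (((- 'X) ^+ s : series)`_j) = (-1) ^+ j * (s == j)%:R.
Proof.
have -> : (- 'X) ^+ s = (((-1) ^+ s)%:P : series) * 'X^s.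
  by rewrite polyC_exp polyCN exprNn.
by rewrite coefCM coefXn eq_sym; case: eqP => [->|_] //; rewrite !mulr0.
Qed.

(** The sign of the variable produces the Hilbert series at - X, the form in which
    it is inverse to the Poincare series. *)
Definition gen_sum n (P : pred (seq nat)) : series :=
  \sum_(l <- exponents n | P l) (- 'X) ^+ sumn l.

Lemma coef_gen_sum n P j :
  (gen_sum n P)`_j =
    (-1) ^+ j * (count (fun l => P l && (sumn l == j)) (exponents n))%:R.
Proof.
rewrite /gen_sum coef_sum -sum1_count natr_sum mulr_sumr big_mkcondr /=.
by apply: eq_bigr => l _; rewrite coef_exprNX; case: eqP => _; rewrite ?mulr1 // mulr0.
Qed.

Lemma hilbert_count n (E : rel 'I_n) (P : pred (seq nat)) j :
  (j < N)%N -> (forall u : 'X_{1..n}, P (tval u) = indep E u) ->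
  hilbert E j = count (fun l => P l && (sumn l == j)) (exponents n).
Proof.
move=> jN PE; rewrite /hilbert cardE -size_filter.
rewrite -(size_map (fun u : 'X_{1..n < j.+1} => tval (bmnm u))).
apply/perm_size/uniq_perm.
- rewrite map_inj_uniq ?enum_uniq // => u v uv; apply/val_inj/val_inj/val_inj.
  exact: uv.
- by rewrite filter_uniq // uniq_exponents.
move=> l; rewrite mem_filter mem_exponents; apply/mapP/idP.
  move=> [u]; rewrite mem_enum inE => /andP[/eqP du iu] ->.
  rewrite PE iu; apply/and3P; split.
  - apply/eqP; rewrite -[RHS]du mdegE sumnE big_tuple.
    by apply/eq_bigr => i _; rewrite mnm_tnth.
  - by rewrite size_tuple.
  apply/allP => r /(nthP 0%N)[i]; rewrite size_tuple => iN <-.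
  rewrite -[nth _ _ _]/(nth 0%N (bmnm u) (Ordinal iN)) -tnth_nth -mnm_tnth.
  by apply: leq_ltn_trans jN; rewrite -[X in (_ <= X)%N]du mdegE (bigD1 (Ordinal iN)) //= leq_addr.
move=> /and3P[/andP[Pl /eqP sl] /eqP szl _].
have szl' : size l == n by apply/eqP.
pose u := Multinom (Tuple szl').
have du : mdeg u = j.
  rewrite -sl mdegE sumnE -[l]/(tval (Tuple szl')) big_tuple.
  by apply: eq_bigr => i _; rewrite multinomE.
have lt : (mdeg u < j.+1)%N by rewrite du.
by exists (BMultinom lt) => //; rewrite mem_enum inE /= du eqxx -PE.
Qed.

Let z2 (a b : nat) := (a == 0%N) || (b == 0%N).
Let x : series := \sum_(1 <= r < N) (- 'X) ^+ r.

Lemma trunc_x M : N = M.+1 -> trunc M ((1 + 'X) * x) = trunc M (- 'X).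
Proof.
move=> NM; apply/trunc_eq => i iM.
have -> : (1 + 'X) * x = - 'X - (- 'X) ^+ N.
  have := subrXX 1 (- 'X : series) N; rewrite expr1n opprK => e.
  have xE : \sum_(r < N) (- 'X) ^+ r = 1 + x.
    by rewrite -(big_mkord predT (fun r => (- 'X) ^+ r)) big_ltn ?expr0 // NM.
  have -> : (1 + 'X) * x = (1 + 'X) * \sum_(r < N) (- 'X) ^+ r - (1 + 'X).
    by rewrite xE; ring.
  have -> : (1 + 'X) * \sum_(r < N) (- 'X) ^+ r = 1 - (- 'X : series) ^+ N.
    by rewrite e; congr (_ * _); apply: eq_bigr => r _; rewrite expr1n mul1r.
  by ring.
by rewrite coefB coef_exprNX NM (gtn_eqF iM) mulr0 subr0.
Qed.

Section Walks.
Variable c : pred nat.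
(** Exponents of the monomials on a path, read as walks that leave r, in which one
    of any two consecutive entries is 0.  The condition c on the last entry closes
    the path to a cycle. *)
Definition walk_sum n r := gen_sum n (fun l => path z2 r l && c (last r l)).

Lemma gen_sumS n P :
  gen_sum n.+1 P = \sum_(0 <= r < N) (- 'X) ^+ r * gen_sum n (fun l => P (r :: l)).
Proof.
rewrite /gen_sum /= big_mkcond big_allpairs_dep /= /index_iota subn0.
apply: eq_bigr => r _; rewrite -big_mkcond mulr_sumr.
by apply: eq_bigr => l _; rewrite exprD.
Qed.

Lemma walk_sum0 r : walk_sum 0 r = (c r)%:R.
Proof. by rewrite /walk_sum /gen_sum big_mkcond big_seq1 /= expr0; case: (c r). Qed.

Hypothesis N0 : (0 < N)%N.

Lemma walk_sumS n r : (0 < r)%N -> walk_sum n.+1 r = walk_sum n 0.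
Proof.
move=> r0; rewrite /walk_sum gen_sumS big_ltn // expr0 mul1r.
rewrite big_nat big1 ?addr0 => [|s /andP[s0 _]]; last first.
  rewrite /gen_sum big_pred0 ?mulr0 // => l /=.
  by rewrite /z2 (gtn_eqF r0) (gtn_eqF s0).
by rewrite /gen_sum; apply: eq_bigl => l /=; rewrite /z2 eqxx orbT.
Qed.

Lemma walk_sum0S n : walk_sum n.+1 0 = \sum_(0 <= r < N) (- 'X) ^+ r * walk_sum n r.
Proof. exact: gen_sumS. Qed.

Lemma walk_sumSS n : walk_sum n.+2 0 = walk_sum n.+1 0 + x * walk_sum n 0.
Proof.
rewrite walk_sum0S big_ltn // expr0 mul1r; congr (_ + _).
rewrite /x mulr_suml big_nat [RHS]big_nat; apply: eq_bigr => r /andP[r0 _].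
by rewrite walk_sumS.
Qed.

Lemma walk_sum1 : (forall r, (0 < r)%N -> c r = c 1%N) ->
  walk_sum 1 0 = (c 0%N)%:R + x * (c 1%N)%:R.
Proof.
move=> cr; rewrite walk_sum0S big_ltn // expr0 mul1r walk_sum0; congr (_ + _).
rewrite /x mulr_suml big_nat [RHS]big_nat; apply: eq_bigr => r /andP[r0 _].
by rewrite walk_sum0 cr.
Qed.
End Walks.

Definition path_series n := walk_sum predT n 0.

Hypothesis N0 : (0 < N)%N.

Lemma path_series0 : path_series 0 = 1.
Proof. by rewrite /path_series walk_sum0. Qed.
Lemma path_series1 : path_series 1 = 1 + x.
Proof. by rewrite /path_series walk_sum1 //= mulr1. Qed.
Lemma path_seriesSS n : path_series n.+2 = path_series n.+1 + x * path_series n.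
Proof. exact: walk_sumSS. Qed.

Definition closed_walk (l : seq nat) :=
  path z2 0 l && ((head 0%N l == 0%N) || (last 0%N l == 0%N)).

(** If the first vertex of the cycle has exponent 0, the others form a path;
    otherwise its two neighbours have exponent 0, and the rest is a path. *)
Lemma closed_walk_sum n :
  gen_sum n.+3 closed_walk = path_series n.+2 + x * path_series n.
Proof.
(* Walks returning to 0 are counted by the same recursion, one step later. *)
have ret m : walk_sum (pred1 0%N) m.+1 0 = path_series m.
  suff : walk_sum (pred1 0%N) m.+1 0 = path_series m /\
         walk_sum (pred1 0%N) m.+2 0 = path_series m.+1 by case.
  elim: m => [|m [IH1 IH2]]; last first.
    by split=> //; rewrite walk_sumSS // path_seriesSS IH1 IH2.
  rewrite walk_sumSS // path_series0 path_series1 walk_sum1 //; last by case.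
  by rewrite walk_sum0 /= mulr0 mulr1 addr0.
rewrite gen_sumS big_ltn // expr0 mul1r; congr (_ + _).
rewrite /x mulr_suml big_nat [RHS]big_nat; apply: eq_bigr => r /andP[r0 _].
rewrite -ret -(walk_sumS _ N0 _ r0); congr (_ * _).
rewrite /walk_sum /gen_sum; apply: eq_bigl => l.
by rewrite /closed_walk /= (gtn_eqF r0).
Qed.

Lemma indep_path n (u : 'X_{1..n}) :
  path z2 0%N (tval u) && true = indep (@path_graph n) u.
Proof.
rewrite andbT; apply/(pathP 0%N)/indepP => [h i j /orP[/eqP ij|/eqP ij]|h i].
- have := h j; rewrite size_tuple => /(_ (ltn_ord j)); rewrite -ij /z2 /= ij.
  by rewrite !mnm_tnth !(tnth_nth 0%N).
- have := h i; rewrite size_tuple => /(_ (ltn_ord i)); rewrite -ij /z2 /= ij orbC.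
  by rewrite !mnm_tnth !(tnth_nth 0%N).
rewrite size_tuple; case: i => [|i] // iN; rewrite /z2 /=.
have := h (Ordinal (ltnW iN)) (Ordinal iN); rewrite /path_graph eqxx.
by rewrite !mnm_tnth !(tnth_nth 0%N); apply.
Qed.

Lemma indep_cycle n (u : 'X_{1..n.+1}) :
  closed_walk (tval u) = indep (@cycle_graph n.+1) u.
Proof.
have u0 : head 0%N (tval u) = u ord0 by rewrite mnm_tnth (tnth_nth 0%N) nth0.
have ul : last 0%N (tval u) = u ord_max.
  by rewrite mnm_tnth (tnth_nth 0%N) -nth_last size_tuple.
have := indep_path u; rewrite andbT /closed_walk u0 ul => ->.
apply/andP/indepP => [[/indepP h h0] i j|h].
  case/or3P => [/h //|/andP[/eqP i0 /eqP jn]|/andP[/eqP j0 /eqP ni]].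
    have -> : i = ord0 by apply/val_inj.
    by have -> : j = ord_max by apply/val_inj; case: jn.
  have -> : j = ord0 by apply/val_inj.
  have -> : i = ord_max by apply/val_inj; case: ni.
  by rewrite orbC.
split; first by apply/indepP => i j ij; apply: h; rewrite /cycle_graph ij.
by apply: h; rewrite /cycle_graph /= !eqxx orbT.
Qed.

Lemma coef_path_series n j : (j < N)%N ->
  (path_series n)`_j = (-1) ^+ j * (hilbert (@path_graph n) j)%:R.
Proof.
move=> jN; rewrite coef_gen_sum.
by rewrite (hilbert_count (P := fun l => path z2 0%N l && true) jN (@indep_path n)).
Qed.

Lemma coef_cycle_series n j : (j < N)%N ->
  (path_series n.+2 + x * path_series n)`_j =
    (-1) ^+ j * (hilbert (@cycle_graph n.+3) j)%:R.
Proof.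
by move=> jN; rewrite -closed_walk_sum coef_gen_sum (hilbert_count jN (@indep_cycle _)).
Qed.

End HilbertSeries.

(** * Comparison of free resolutions *)
Section Resolutions.
Variables (R : comNzRingType) (k : fieldType) (eps : {rmorphism R -> k}).

(** Complexes of free modules R^(b i), acting on row vectors from the right; the
    functional a on k^(b 0) makes them resolutions of k. *)
Definition free_resolution (b : nat -> nat) (D : forall i, 'M[R]_(b i.+1, b i))
    (a : 'cV[k]_(b 0%N)) : Prop :=
  [/\ exists v : 'rV_(b 0%N), map_mx eps v *m a = 1,
      forall v : 'rV_(b 0%N),
        map_mx eps v *m a = 0 <-> exists u, v = u *m D 0%N,
      forall i, D i.+1 *m D i = 0
    & forall i (v : 'rV_(b i.+1)), v *m D i = 0 -> exists u, v = u *m D i.+1].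

Lemma rows_lift m n p (M : 'M[R]_(n, p)) (N : 'M[R]_(m, p)) :
  (forall i, exists u, row i N = u *m M) -> exists U, N = U *m M.
Proof.
move=> /choice[u uP]; exists (\matrix_i u i); apply/row_matrixP => i.
by rewrite row_mul rowK uP.
Qed.

Hypothesis eps_surj : forall c, exists r, eps r = c.

Lemma free_resolution_lift b D a c E a' :
  @free_resolution b D a -> @free_resolution c E a' ->
  exists f : forall i, 'M[R]_(b i, c i),
    map_mx eps (f 0%N) *m a' = a /\
    forall i, D i *m f i = f i.+1 *m E i.
Proof.
move=> [_ D0 DD _] [[v0 v0P] E0 EE Eex].
have [f0 f0P] : exists f0 : 'M[R]_(b 0%N, c 0%N), map_mx eps f0 *m a' = a.
  have /choice[r rP] : forall i, exists x : R, eps x = a i 0 by [].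
  exists (\matrix_i (r i *: v0)); apply/row_matrixP => i.
  rewrite row_mul -map_row rowK map_mxZ -scalemxAl v0P rP.
  by apply/rowP => j; rewrite !mxE !ord1 eqxx mulr1.
pose next i (g : 'M[R]_(b i, c i)) : 'M[R]_(b i.+1, c i.+1) :=
  if pselect (exists h, D i *m g = h *m E i) is left ex then sval (cid ex)
  else 0.
pose f := nat_rect (fun i => 'M[R]_(b i, c i)) f0 next.
exists f; split=> // i.
have step j : (exists h, D j *m f j = h *m E j) ->
    D j *m f j = f j.+1 *m E j.
  rewrite [f j.+1]/= /next; case: pselect => // ex _.
  by case: (cid ex).
elim: i => [|i IH]; apply/step/rows_lift => j; rewrite row_mul.
  apply/E0; rewrite map_mxM -mulmxA f0P.
  by apply/D0; exists (delta_mx 0 j); rewrite rowE.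
by apply: Eex; rewrite -mulmxA -IH mulmxA -row_mul DD row0 mul0mx.
Qed.

(** Modulo the maximal ideal a minimal resolution is a direct summand of any other
    one: lifting the identity of k back and forth gives an endomorphism homotopic
    to the identity, and the terms of the homotopy vanish modulo the ideal. *)
Lemma minimal_resolution_rank_le b D a c E a' :
  @free_resolution b D a -> @free_resolution c E a' ->
  (forall i, map_mx eps (D i) = 0) -> forall i, (b i <= c i)%N.
Proof.
move=> resD resE Dmin i.
have [f [f0 fD]] := free_resolution_lift resD resE.
have [g [g0 gE]] := free_resolution_lift resE resD.
have [_ D0 DD Dex] := resD.
pose s i := f i *m g i - 1%:M.
have sD j : D j *m s j = s j.+1 *m D j.
  by rewrite mulmxBr mulmxBl mulmx1 mul1mx mulmxA fD -!mulmxA gE.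
have [h [_ si]] : exists h : 'M_(b i, b i.+1),
    D i *m (s i - h *m D i) = 0 /\ map_mx eps (s i) = 0.
  elim: i => [|i [h [hD _]]].
    have [|h s0] := @rows_lift _ _ _ (D 0%N) (s 0%N).
      move=> j; apply/D0; rewrite map_row -row_mul map_mxB map_mxM mulmxBl.
      by rewrite -mulmxA g0 f0 map_mx1 mul1mx subrr row0.
    by exists h; rewrite {1}s0 subrr mulmx0; split=> //; rewrite s0 map_mxM Dmin mulmx0.
  have [|h' s1] := @rows_lift _ _ _ (D i.+1) (s i.+1 - D i *m h).
    move=> j; apply: Dex; rewrite -row_mul mulmxBl -sD -!mulmxA -mulmxBr.
    by rewrite hD row0.
  exists h'; rewrite -s1 opprB addrCA subrr addr0 mulmxA DD mul0mx; split=> //.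
  rewrite -[s i.+1](subrK (D i *m h)) s1 map_mxD !map_mxM !Dmin.
  by rewrite mulmx0 mul0mx addr0.
have fg1 : map_mx eps (f i) *m map_mx eps (g i) = 1%:M.
  by apply/eqP; rewrite -subr_eq0 -map_mxM -(map_mx1 eps) -map_mxB si.
have := mulmx_max_rank (map_mx eps (f i)) (map_mx eps (g i)).
by rewrite fg1 mxrank1.
Qed.

End Resolutions.

(** * Normal monomials *)
Section Monomials.
Variable e : nat -> nat.
Local Notation gm := (gmon e).
Implicit Types (y z : gvar e) (m : gm).

Definition vars N : seq (gvar e) :=
  [seq gvar_of j | i <- iota 0 N.+1, j <- enum 'I_(e i)].

Lemma tag_gt0 y : e 0%N = 0%N -> (0 < tag y)%N.
Proof.
case: y => [[|i] j] //= e0; have := ltn_ord j.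
by move: (nat_of_ord j) => a; rewrite e0.
Qed.

Lemma mem_vars N y : (y \in vars N) = (tag y <= N)%N.
Proof.
apply/allpairsPdep/idP => [[i [j [iN _ ->]]]|yN].
  by rewrite mem_iota in iN.
case: y yN => i j iN; exists i, j; rewrite mem_iota ltnS iN mem_enum; split=> //.
Qed.

Lemma uniq_vars N : uniq (vars N).
Proof.
apply: allpairs_uniq_dep => [|i _|[i j] [i' j'] _ _ /= [ii]]; rewrite ?iota_uniq ?enum_uniq //.
Qed.

Lemma vars_recr N : vars N.+1 = vars N ++ [seq gvar_of j | j <- enum 'I_(e N.+1)].
Proof. by rewrite /vars -addn1 iotaD map_cat flatten_cat /= cats0. Qed.

Lemma vars_sorted N L y L' : vars N = L ++ y :: L' ->
  forall z, (tag z < tag y)%N -> z \in L.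
Proof.
have pw : pairwise (fun a b : gvar e => tag a <= tag b)%N (vars N).
  elim: N => [|N IH].
    have -> : vars 0 = [seq gvar_of j | j <- enum 'I_(e 0)] by rewrite /vars /= cats0.
    by rewrite pairwise_map; elim: (enum _) => //= a s ->; rewrite andbT; apply/allP.
  rewrite vars_recr pairwise_cat IH /=; apply/andP; split.
    apply/allrelP => a b; rewrite mem_vars => aN /mapP[j _ ->] /=.
    exact: leq_trans aN _.
  by rewrite pairwise_map; elim: (enum _) => //= a s ->; rewrite andbT; apply/allP => b _; exact: leqnn.
move=> eN z zy; move: pw; rewrite eN pairwise_cat /= => /and4P[_ _ /allP yL' _].
have : z \in vars N.
  have : y \in vars N by rewrite eN mem_cat inE eqxx orbT.
  by rewrite !mem_vars => yN; apply: leq_trans (ltnW zy) yN.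
rewrite eN mem_cat inE => /or3P[//|/eqP zE|/yL'].
  by rewrite zE ltnn in zy.
by rewrite leqNgt zy.
Qed.

Definition supported (L : seq (gvar e)) m := forall y, m y != 0%N -> y \in L.

Lemma gdeg_sum (s : seq (gvar e)) m : uniq s -> supported s m ->
  gdeg m = (\sum_(y <- s) m y * tag y)%N.
Proof.
move=> us sm; rewrite /gdeg (bigID (fun y => y \in finsupp m)) /=.
rewrite [X in (_ + X)%N]big_seq_cond [X in (_ + X)%N]big1 ?addn0; last first.
  by move=> y /andP[->].
rewrite [RHS](bigID (fun y => y \in finsupp m)) /=.
rewrite [X in (_ = _ + X)%N]big1 ?addn0 => [|y]; last by move/fsfun_dflt => ->.
rewrite -big_filter -[RHS]big_filter; apply: perm_big; apply: uniq_perm.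
- by rewrite filter_uniq // fset_uniq.
- by rewrite filter_uniq.
move=> y; rewrite !mem_filter; case h: (y \in finsupp m) => //=.
by move: h; rewrite mem_finsupp => /sm ->.
Qed.

Lemma gheight_le m N : (gheight m <= N)%N <-> supported (vars N) m.
Proof.
split=> [h y my|sm].
  rewrite mem_vars; apply: leq_trans h; rewrite /gheight.
  by apply: (leq_bigmax_seq (F := fun y => tag y)) => //; rewrite mem_finsupp.
by apply/bigmax_leqP_seq => y yf _; rewrite -mem_vars sm // -mem_finsupp.
Qed.

Definition setexp m y (r : nat) : gm := [fsfun m with y |-> r].

Lemma setexpE m y r z : setexp m y r z = if z == y then r else m z.
Proof. exact: fsfun_withE. Qed.

Lemma setexp_id m y : setexp m y (m y) = m.
Proof. exact: fsfun_with_id. Qed.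

Lemma setexpK m y r s : setexp (setexp m y r) y s = setexp m y s.
Proof. by apply/fsfunP => z; rewrite !setexpE; case: (eqVneq z y). Qed.

Lemma supported_setexp L m y r : supported L m -> supported (y :: L) (setexp m y r).
Proof.
by move=> sm z; rewrite setexpE inE; case: (eqVneq z y) => //= _; apply: sm.
Qed.

(** Additive form of an equation with subtractions. *)
Lemma gdeg_setexp m y r :
  (gdeg (setexp m y r) + m y * tag y = gdeg m + r * tag y)%N.
Proof.
pose s := vars (maxn (gheight m) (tag y)); have us : uniq s := uniq_vars _.
have sm : supported s m by apply/gheight_le; rewrite leq_maxl.
have ys : y \in s by rewrite mem_vars leq_maxr.
have sm' : supported s (setexp m y r).
  by move=> z; rewrite setexpE; case: (eqVneq z y) => [->|_ /sm].
rewrite (gdeg_sum us sm) (gdeg_sum us sm') !(bigD1_seq y) //= setexpE eqxx.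
rewrite [in LHS](eq_bigr (fun z => m z * tag z)%N) => [|z /negPf zy]; last first.
  by rewrite setexpE zy.
move: (r * _)%N (m y * _)%N (bigop.body _ _ _) => a b c; lia.
Qed.

Lemma gdeg_setexp0 m y r : m y = 0%N -> gdeg (setexp m y r) = (gdeg m + r * tag y)%N.
Proof. by move=> my; rewrite -gdeg_setexp my addn0. Qed.

Definition mon0 : gm := [fsfun].

Lemma mon0E y : mon0 y = 0%N. Proof. by rewrite fsfun0E. Qed.
Lemma gdeg0 : gdeg mon0 = 0%N.
Proof. by rewrite (@gdeg_sum [::]) ?big_nil // => y; rewrite mon0E. Qed.

Definition exps y p : seq nat :=
  [seq r <- iota 0 (if odd (tag y) then 2 else p.+1) | (r * tag y <= p)%N].

Fixpoint normal_mons (L : seq (gvar e)) (p : nat) : seq gm :=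
  if L is y :: L' then
    [seq setexp m y r | r <- exps y p, m <- normal_mons L' (p - r * tag y)]
  else if p == 0%N then [:: mon0] else [::].

Lemma mem_normal_mons L p m : uniq L -> {in L, forall y, (0 < tag y)%N} ->
  m \in normal_mons L p <-> [/\ gnormal m, supported L m & gdeg m = p].
Proof.
elim: L p m => [|y L IH] p m /=.
  move=> _ _; split.
    case: eqP => // ->; rewrite inE => /eqP ->; split; last exact: gdeg0.
      by move=> y _; rewrite mon0E.
    by move=> y; rewrite mon0E.
  move=> [_ sm <-]; have -> : m = mon0.
    by apply/fsfunP => y; rewrite mon0E; apply/eqP/negPn/negP => /sm.
  by rewrite gdeg0 eqxx inE.
move=> /andP[yL uL] tL; have y0 : (0 < tag y)%N by apply: tL; rewrite inE eqxx.
have tL' : {in L, forall z, (0 < tag z)%N} by move=> z zL; apply: tL; rewrite inE zL orbT.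
split.
  move=> /allpairsPdep[r [m' [+ /(IH _ _ uL tL')[nm' sm' dm'] ->]]].
  rewrite mem_filter mem_iota /= => /andP[rp r2].
  have m'y : m' y = 0%N by apply/eqP/negPn/negP => /sm'; rewrite (negPf yL).
  split; last by rewrite gdeg_setexp0 // dm' subnK.
    move=> z oz; rewrite setexpE; case: (eqVneq z y) => [zy|_]; last exact: nm'.
    by move: r2; rewrite -zy oz.
  exact: supported_setexp.
move=> [nm sm dm]; pose m' := setexp m y 0.
have m'y : m' y = 0%N by rewrite setexpE eqxx.
have em : m = setexp m' y (m y) by rewrite setexpK setexp_id.
have dm' : (gdeg m' + m y * tag y = p)%N by rewrite -gdeg_setexp0 // -em.
have le : (m y * tag y <= p)%N by rewrite -dm' leq_addl.
apply/allpairsPdep; exists (m y), m'; split=> //.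
  rewrite mem_filter le mem_iota /=; case: ifP => [/nm //|_].
  by rewrite ltnS; apply: leq_trans le; rewrite leq_pmulr.
apply/(IH _ _ uL tL'); split; last by rewrite -dm' addnK.
  by move=> z oz; rewrite setexpE; case: (eqVneq z y) => // _; apply: nm.
by move=> z; rewrite setexpE; case: (eqVneq z y) => // zy /sm; rewrite inE (negPf zy).
Qed.

Lemma uniq_normal_mons L p : uniq L -> {in L, forall y, (0 < tag y)%N} -> uniq (normal_mons L p).
Proof.
elim: L p => [|y L IH] p /=; first by case: eqP.
move=> /andP[yL uL] tL.
have tL' : {in L, forall z, (0 < tag z)%N} by move=> z zL; apply: tL; rewrite inE zL orbT.
apply: allpairs_uniq_dep => [|r _|].
- by rewrite filter_uniq // iota_uniq.
- exact: IH.
move=> [r m] [r' m'] /allpairsPdep[r1 [m1 [_ h1 [-> e1]]]] /allpairsPdep[r2 [m2 [_ h2 [-> e2]]]] /= em.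
have m1y : m1 y = 0%N.
  by apply/eqP/negPn/negP; have [_ sm _] := (mem_normal_mons _ _ uL tL').1 h1 => /sm; rewrite (negPf yL).
have m2y : m2 y = 0%N.
  by apply/eqP/negPn/negP; have [_ sm _] := (mem_normal_mons _ _ uL tL').1 h2 => /sm; rewrite (negPf yL).
rewrite e1 e2 in em *.
have -> : r1 = r2 by have := congr1 (fun f : gm => f y) em; rewrite !setexpE eqxx.
have -> // : m1 = m2.
by rewrite -[m1](setexp_id _ y) m1y -[m2](setexp_id _ y) m2y -(setexpK m1 y r1) em setexpK.
Qed.

Lemma size_mons_cons y L p :
  size (normal_mons (y :: L) p) = (\sum_(r <- exps y p) size (normal_mons L (p - r * tag y)))%N.
Proof. by rewrite size_allpairs_dep sumnE big_map. Qed.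

Lemma size_mons_odd y L p : odd (tag y) ->
  size (normal_mons (y :: L) p) =
    (size (normal_mons L p) + if tag y <= p then size (normal_mons L (p - tag y)) else 0)%N.
Proof.
move=> oy; rewrite size_mons_cons /exps oy /= mul1n big_cons mul0n subn0.
by case: ifP => _; rewrite ?big_seq1 ?mul1n // big_nil.
Qed.

Lemma size_mons_even y L p : ~~ odd (tag y) -> (0 < tag y)%N ->
  size (normal_mons (y :: L) p) =
    (size (normal_mons L p) + if tag y <= p then size (normal_mons (y :: L) (p - tag y)) else 0)%N.
Proof.
move=> /negPf oy y0; set f := fun q => size (normal_mons L q).
have S K q : (q < K)%N -> size (normal_mons (y :: L) q) =
    (\sum_(0 <= r < K) if r * tag y <= q then f (q - r * tag y) else 0)%N.
  move=> qK; rewrite size_mons_cons /exps oy big_filter big_mkcond.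
  rewrite [RHS](@big_cat_nat _ _ _ q.+1) //= [X in (_ + X)%N]big_nat.
  rewrite [X in (_ + X)%N]big1 ?addn0 //.
  move=> r /andP[qr _]; case: ifP => // le.
  by have := leq_trans (leq_pmulr r y0) le; rewrite leqNgt qr.
rewrite (S p.+1) // big_nat_recl //= mul0n subn0; congr (_ + _)%N.
case: ifP => [yp|yp]; last first.
  by apply: big1_seq => r _; rewrite mulSn; case: ifP => // le;
    rewrite (leq_trans (leq_addr _ _) le) in yp.
have pK : (p - tag y < p)%N by rewrite ltn_subrL y0 (leq_trans y0 yp).
rewrite (S p _ pK); apply: eq_bigr => r _.
by rewrite mulSn subnDA leq_subRL.
Qed.

Section Series.
Variable N : nat.
Local Notation series := {poly int}.

Definition mon_series L : series := \poly_(p < N.+1) (size (normal_mons L p))%:R.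

Lemma mon_series_odd y L : odd (tag y) ->
  trunc N (mon_series (y :: L)) = trunc N ((1 + 'X^(tag y)) * mon_series L).
Proof.
move=> oy; apply/trunc_eq => p pN; rewrite mulrDl mul1r coefD mulrC coefMXn.
rewrite !coef_poly pN (leq_ltn_trans (leq_subr _ _) pN) size_mons_odd // natrD.
by rewrite ltnNge; case: (tag y <= p)%N.
Qed.

Lemma mon_series_even y L : ~~ odd (tag y) -> (0 < tag y)%N ->
  trunc N ((1 - 'X^(tag y)) * mon_series (y :: L)) = trunc N (mon_series L).
Proof.
move=> oy y0; apply/trunc_eq => p pN; rewrite mulrBl mul1r coefB mulrC coefMXn.
rewrite !coef_poly pN (leq_ltn_trans (leq_subr _ _) pN) size_mons_even // natrD.
by rewrite ltnNge; case: (tag y <= p)%N => /=; rewrite ?addrK // addr0 subr0.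
Qed.

Lemma mon_series_prod L : {in L, forall y, (0 < tag y)%N} ->
  trunc N (\prod_(y <- L | ~~ odd (tag y)) (1 - 'X^(tag y)) * mon_series L) =
  trunc N (\prod_(y <- L | odd (tag y)) (1 + 'X^(tag y))).
Proof.
elim: L => [|y L IH] tL.
  rewrite !big_nil mul1r; apply/trunc_eq => p pN; rewrite coef_poly pN coef1 /=.
  by case: (p == 0%N).
have {}IH : trunc N (\prod_(y <- L | ~~ odd (tag y)) (1 - 'X^(tag y)) * mon_series L) =
  trunc N (\prod_(y <- L | odd (tag y)) (1 + 'X^(tag y))).
  by apply: IH => z zL; apply: tL; rewrite inE zL orbT.
have y0 : (0 < tag y)%N by apply: tL; rewrite inE eqxx.
rewrite !big_cons; case: (boolP (odd (tag y))) => oy /=.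
  by rewrite rmorphM mon_series_odd // -rmorphM mulrCA rmorphM IH -rmorphM.
by rewrite mulrAC rmorphM mon_series_even // -rmorphM mulrC IH.
Qed.

Lemma prod_vars (P : pred nat) (F : nat -> series) :
  \prod_(y <- vars N | P (tag y)) F (tag y) = \prod_(0 <= s < N.+1 | P s) F s ^+ e s.
Proof.
rewrite big_mkcond /vars big_allpairs_dep /= /index_iota subn0 [RHS]big_mkcond.
apply: eq_bigr => s _; rewrite /= big_enum /=.
by case: (P s); rewrite ?big1_eq // prodr_const card_ord.
Qed.

(** A variable of odd degree s contributes the factor 1 + X^s, and a variable of
    even degree s, with all its divided powers, the factor 1 / (1 - X^s). *)
Lemma poincare_series : e 0%N = 0%N ->
  trunc N (even_prod 'X N.+1 e * mon_series (vars N)) = trunc N (odd_prod 'X N.+1 e).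
Proof.
move=> e0.
have tv : {in vars N, forall y, (0 < tag y)%N} by move=> y _; apply: tag_gt0.
have := mon_series_prod tv.
rewrite (prod_vars (fun s => ~~ odd s) (fun s => 1 - 'X^s)).
rewrite (prod_vars odd (fun s => 1 + 'X^s)).
by rewrite big_mkcond big_ltn //= e0 expr0 mul1r -big_mkcond
  [in X in _ = X -> _]big_mkcond [in X in _ = X -> _]big_ltn //= mul1r -big_mkcond.
Qed.
End Series.
End Monomials.

(** * Coefficients and products in R<Y> *)
Section Coefficients.
Variables (R : comNzRingType) (e : nat -> nat) (A : dg_gamma_ext R e).
Local Notation gm := (gmon e).
Local Notation dp := (@dgg_dp R e A).
Local Notation del := (@dgg_diff R e A).
Implicit Types (m : gm) (y z : gvar e) (a b : A).

Definition mon_val m : A := gmonval dp m.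

Definition expansion a (f : gm -> R) (s : seq gm) : Prop :=
  [/\ uniq s, forall m, m \in s -> gnormal m, forall m, f m != 0 -> m \in s
    & a = \sum_(m <- s) f m *: mon_val m].

Lemma expansion_widen a f s s' : expansion a f s -> uniq s' -> {subset s <= s'} ->
  a = \sum_(m <- s') f m *: mon_val m.
Proof.
move=> [us _ fs ->] us' ss'; rewrite [RHS](bigID (fun m => m \in s)) /=.
rewrite [X in _ = _ + X]big1 ?addr0 => [|m ms]; last first.
  by have [->|/fs] := eqVneq (f m) 0; rewrite ?scale0r // (negPf ms).
rewrite -[RHS]big_filter; apply: perm_big; apply: uniq_perm => //.
  by rewrite filter_uniq.
by move=> m; rewrite mem_filter; case h: (m \in s) => //=; rewrite ss'.
Qed.

Lemma expansion_exists a : exists f, exists s, expansion a f s.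
Proof.
have [s [c [sP ->]]] := dgg_span a.
exists (fun m => c m *+ count_mem m s), (undup s); split.
- exact: undup_uniq.
- by move=> m; rewrite mem_undup => /sP[].
- move=> m; rewrite mem_undup; apply: contraNT => /count_memPn ->.
  by rewrite mulr0n.
rewrite -big_undup_iterop_count; apply: eq_bigr => m _.
rewrite /mon_val; elim: (count_mem m s) => [|[|r] IH]; first by rewrite mulr0n scale0r.
  by [].
by rewrite mulrS scalerDl -IH.
Qed.

Definition cf a : gm -> R := sval (cid (expansion_exists a)).

Lemma cfP a : exists s, expansion a (cf a) s.
Proof. exact: (svalP (cid (expansion_exists a))). Qed.

Lemma expansion_uniq a f g s s' : expansion a f s -> expansion a g s' -> f =1 g.
Proof.
move=> ef eg m; apply/eqP; rewrite -subr_eq0; apply/eqP.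
pose u := undup (s ++ s').
have us : {subset s <= u} by move=> x xs; rewrite mem_undup mem_cat xs.
have us' : {subset s' <= u} by move=> x xs; rewrite mem_undup mem_cat xs orbT.
have uu : uniq u := undup_uniq _.
have [_ ns fs _] := ef; have [_ ns' gs _] := eg.
have [mu|mu] := boolP (m \in u); last first.
  have f0 : f m = 0 by apply/eqP; apply: contraNT mu => /fs /us.
  have g0 : g m = 0 by apply/eqP; apply: contraNT mu => /gs /us'.
  by rewrite f0 g0 subrr.
apply: (@dgg_free R e A u (fun m => f m - g m) uu _ _ m mu).
  by move=> x; rewrite mem_undup mem_cat => /orP[/ns|/ns'].
have e1 := expansion_widen ef uu us; have e2 := expansion_widen eg uu us'.
rewrite -[RHS](subrr a) {1}e1 e2 -sumrB; apply: eq_bigr => x _.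
by rewrite scalerBl.
Qed.

Lemma cfE a f s : expansion a f s -> cf a =1 f.
Proof. by move=> h; have [s' h'] := cfP a; apply: expansion_uniq h' h. Qed.

Lemma cf_linear m (c : R) a b : cf (c *: a + b) m = c * cf a m + cf b m.
Proof.
have [s ha] := cfP a; have [s' hb] := cfP b.
pose u := undup (s ++ s').
have us : {subset s <= u} by move=> x xs; rewrite mem_undup mem_cat xs.
have us' : {subset s' <= u} by move=> x xs; rewrite mem_undup mem_cat xs orbT.
have uu : uniq u := undup_uniq _.
have [_ ns fs _] := ha; have [_ ns' gs _] := hb.
apply: (@cfE _ (fun m => c * cf a m + cf b m) u _ m); split=> //.
- by move=> x; rewrite mem_undup mem_cat => /orP[/ns|/ns'].
- move=> x; apply: contraNT => xu.
  have f0 : cf a x = 0 by apply/eqP; apply: contraNT xu => /fs /us.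
  have g0 : cf b x = 0 by apply/eqP; apply: contraNT xu => /gs /us'.
  by rewrite f0 g0 mulr0 addr0.
rewrite {1}(expansion_widen ha uu us) {1}(expansion_widen hb uu us').
rewrite scaler_sumr -big_split; apply: eq_bigr => x _.
by rewrite scalerDl scalerA.
Qed.

(** Coefficients as linear forms. *)
Definition coefA m a : R := cf a m.
HB.instance Definition _ m :=
  GRing.isLinear.Build R A R *%R (coefA m) (cf_linear m).

Lemma coefA_mv m m' : gnormal m -> coefA m' (mon_val m) = (m' == m)%:R.
Proof.
move=> nm; apply: (@cfE _ (fun m' => (m' == m)%:R) [:: m]); split=> //.
- by move=> x; rewrite inE => /eqP ->.
- by move=> x; rewrite inE; case: (x == m) => //; rewrite eqxx.
by rewrite big_seq1 eqxx scale1r.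
Qed.

Lemma coefA_normal m a : coefA m a != 0 -> gnormal m.
Proof. by have [s [_ ns fs _]] := cfP a => /fs/ns. Qed.

Lemma coefA_inj a b : (forall m, coefA m a = coefA m b) -> a = b.
Proof.
move=> ab; apply/eqP; rewrite -subr_eq0; apply/eqP.
have [s [_ _ _ ->]] := cfP (a - b); apply: big1 => m _.
by rewrite -/(coefA m (a - b)) raddfB /= ab subrr scale0r.
Qed.

(** The span of the monomials satisfying P, in the form of a condition on
    coefficients; closure under linear combinations is then immediate. *)
Definition within (P : gm -> Prop) a : Prop := forall m, coefA m a != 0 -> P m.

Lemma withinP P a : within P a <-> gspan dp P a.
Proof.
split=> [wa|[s [c [sP ->]]] m].
  have [s [us ns fs aE]] := cfP a.
  exists [seq m <- s | cf a m != 0], (cf a); split=> [m|].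
    by rewrite mem_filter => /andP[/wa Pm /ns nm].
  rewrite {1}aE big_filter [LHS](bigID (fun m => cf a m == 0)) /=.
  by rewrite big1 ?add0r // => m /eqP ->; rewrite scale0r.
rewrite raddf_sum /= => nz.
have [m' m's] : exists2 m', m' \in s & m = m'.
  apply: contrapT => no; move/eqP: nz; apply; apply: big1_seq => m' /andP[_ m's].
  rewrite linearZ /= coefA_mv; last by have [] := sP _ m's.
  by case: eqP => [mm'|_]; rewrite ?mulr0 //; case: no; exists m'.
by move=> ->; have [] := sP _ m's.
Qed.

Lemma within0 P : within P 0.
Proof. by move=> m; rewrite raddf0 eqxx. Qed.
Lemma withinD P a b : within P a -> within P b -> within P (a + b).
Proof.
move=> wa wb m; rewrite raddfD /=; have [->|/wa //] := eqVneq (coefA m a) 0.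
by rewrite add0r => /wb.
Qed.
Lemma withinZ P c a : within P a -> within P (c *: a).
Proof.
by move=> wa m; rewrite linearZ /=; have [->|/wa //] := eqVneq (coefA m a) 0;
  rewrite mulr0 eqxx.
Qed.
Lemma withinN P a : within P a -> within P (- a).
Proof. by rewrite -scaleN1r; apply: withinZ. Qed.
Lemma withinB P a b : within P a -> within P b -> within P (a - b).
Proof. by move=> wa wb; apply: (withinD wa (withinN wb)). Qed.
Lemma within_sum P I (s : seq I) (F : I -> A) :
  (forall i, within P (F i)) -> within P (\sum_(i <- s) F i).
Proof.
move=> wF; elim/big_rec: _ => [|i x _ wx]; first exact: within0.
exact: withinD.
Qed.
Lemma within_mv (P : gm -> Prop) m : gnormal m -> P m -> within P (mon_val m).
Proof. by move=> nm Pm m'; rewrite coefA_mv //; case: (eqVneq m' m) => [->|]//; rewrite eqxx. Qed.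
Lemma within_sub (P Q : gm -> Prop) a : (forall m, P m -> Q m) -> within P a -> within Q a.
Proof. by move=> PQ wa m /wa/PQ. Qed.

Lemma within_ind (P : gm -> Prop) (Q : A -> Prop) :
  Q 0 -> (forall c a b, Q a -> Q b -> Q (c *: a + b)) ->
  (forall m, gnormal m -> P m -> Q (mon_val m)) -> forall a, within P a -> Q a.
Proof.
move=> Q0 Qlin Qmv a /withinP[s [c [sP ->]]].
rewrite big_seq; apply: (big_ind Q) => //.
  by move=> x y Qx Qy; rewrite -[x]scale1r; apply: Qlin.
move=> m ms; have [nm Pm] := sP m ms; rewrite -[_ *: _]addr0.
by apply: Qlin => //; apply: Qmv.
Qed.

Definition hom p := within (fun m => gdeg m = p).

Lemma homP p a : hom p a <-> ghom dp p a.
Proof. exact: withinP. Qed.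

Definition basis_mons p : seq gm := normal_mons (vars e p) p.

Lemma tag_pos y : (0 < tag y)%N.
Proof. by apply: tag_gt0; apply: (dgg_var0 A). Qed.

Lemma supported_vars m N : (gdeg m <= N)%N -> supported (vars e N) m.
Proof.
move=> mN y my; rewrite mem_vars; apply: leq_trans mN.
have ym : y \in finsupp m by rewrite mem_finsupp.
rewrite /gdeg (big_fsetD1 y) //=; apply: leq_trans (leq_addr _ _).
by rewrite leq_pmull // lt0n.
Qed.

Lemma mem_basis_mons p m : m \in basis_mons p <-> gnormal m /\ gdeg m = p.
Proof.
split=> [|[nm dm]].
  by move/mem_normal_mons => [||]//; [exact: uniq_vars|move=> *; exact: tag_pos].
apply/mem_normal_mons => //; [exact: uniq_vars|by move=> *; exact: tag_pos|split=> //].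
by apply: supported_vars; rewrite dm.
Qed.

Lemma uniq_basis_mons p : uniq (basis_mons p).
Proof. by apply: uniq_normal_mons; [exact: uniq_vars|move=> *; exact: tag_pos]. Qed.

Lemma hom_expand p a : hom p a -> a = \sum_(m <- basis_mons p) coefA m a *: mon_val m.
Proof.
move=> ha; apply: coefA_inj => m; rewrite raddf_sum /=.
have [mp|mp] := boolP (m \in basis_mons p).
  rewrite (bigD1_seq m) ?uniq_basis_mons //= linearZ /= coefA_mv; last first.
    by have [] := (mem_basis_mons p m).1 mp.
  rewrite eqxx mulr1 big1_seq ?addr0 // => m' /andP[mm' /mem_basis_mons[nm' _]].
  by rewrite linearZ /= coefA_mv // eq_sym (negPf mm') mulr0.
have -> : coefA m a = 0.
  apply/eqP; apply: contraNT mp => nz; apply/mem_basis_mons; split.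
    exact: coefA_normal nz.
  exact: ha.
rewrite big1_seq // => m' /andP[_ m'p].
have [nm' _] := (mem_basis_mons p m').1 m'p.
rewrite linearZ /= coefA_mv //; case: eqP => [mm'|_]; rewrite ?mulr0 //.
by rewrite mm' m'p in mp.
Qed.

Lemma mvE m N : (gheight m <= N)%N -> mon_val m = \prod_(y <- vars e N) dp y (m y).
Proof.
move=> mN; have -> : mon_val m = \prod_(y <- vars e (gheight m)) dp y (m y).
  rewrite /mon_val /gmonval /vars big_allpairs_dep -[iota _ _]/(index_iota 0 (gheight m).+1).
  rewrite big_mkord; apply: eq_bigr => i _. by rewrite -deprecated_filter_index_enum big_filter.
rewrite -(subnKC mN); elim: (N - _)%N => [|d ->]; first by rewrite addn0.
rewrite addnS vars_recr [RHS]big_cat -[LHS]mulr1; congr (_ * _).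
rewrite big_map big1 // => j _.
rewrite (_ : m _ = 0%N) ?dgg_dp0 //; apply/eqP/negPn/negP.
move=> /((gheight_le m _).1 (leqnn _)); rewrite mem_vars /= leqNgt ltnS.
by rewrite leq_addr.
Qed.

Lemma mv0 : mon_val (mon0 e) = 1.
Proof.
rewrite (@mvE _ 0) ?big1 // => [y _|]; first by rewrite mon0E dgg_dp0.
by apply/gheight_le => y; rewrite mon0E.
Qed.

Lemma normal_mon0 : gnormal (mon0 e).
Proof. by move=> y _; rewrite mon0E. Qed.

Definition var_mon y (r : nat) : gm := setexp (mon0 e) y r.

(** For y of odd degree, dp y r with r > 1 is not a divided power. *)
Definition admissible y (r : nat) := odd (tag y) -> (r <= 1)%N.

Lemma normal_setexp m y r : gnormal m -> admissible y r -> gnormal (setexp m y r).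
Proof.
move=> nm yr z oz; rewrite setexpE; case: (eqVneq z y) => [zy|_]; last exact: nm.
by apply: yr; rewrite -zy.
Qed.

Lemma mv_split N L y L' m : vars e N = L ++ y :: L' -> (gheight m <= N)%N ->
  mon_val m = (\prod_(z <- L) dp z (m z)) * dp y (m y) * \prod_(z <- L') dp z (m z).
Proof. by move=> eN mN; rewrite (mvE mN) eN big_cat /= big_cons mulrA. Qed.

Lemma split_vars N y : (tag y <= N)%N -> exists L L', vars e N = L ++ y :: L'.
Proof. by rewrite -mem_vars => /path.splitPr[L L']; exists L, L'. Qed.

Lemma setexp_prod (L : seq (gvar e)) m y r : y \notin L ->
  \prod_(z <- L) dp z (setexp m y r z) = \prod_(z <- L) dp z (m z).
Proof.
move=> yL; apply: eq_big_seq => z zL; rewrite setexpE.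
by case: (eqVneq z y) => // zy; rewrite -zy zL in yL.
Qed.

Lemma gheight_setexp m y r N : (gheight m <= N)%N -> (tag y <= N)%N ->
  (gheight (setexp m y r) <= N)%N.
Proof.
move=> /gheight_le sm yN; apply/gheight_le => z; rewrite setexpE.
by case: (eqVneq z y) => [->|_ /sm //]; rewrite mem_vars.
Qed.

Lemma mv_var y r : mon_val (var_mon y r) = dp y r.
Proof.
have [L [L' eN]] := split_vars (leqnn (tag y)).
have un := uniq_vars e (tag y); rewrite eN cat_uniq /= negb_or in un.
have /and3P[_ /andP[yL _] /andP[yL' _]] := un.
have h0 : (gheight (mon0 e) <= tag y)%N by apply/gheight_le => z; rewrite mon0E.
rewrite (mv_split eN); last by apply: gheight_setexp.
rewrite !setexp_prod // setexpE eqxx.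
by rewrite !big1 ?mul1r ?mulr1 // => z _; rewrite mon0E dgg_dp0.
Qed.

Lemma hom_mv m : gnormal m -> hom (gdeg m) (mon_val m).
Proof. by move=> nm; apply: within_mv. Qed.

Lemma hom_dp y r : admissible y r -> hom (r * tag y) (dp y r).
Proof.
move=> yr; rewrite -mv_var; apply: within_mv.
  by apply: normal_setexp => //; apply: normal_mon0.
by rewrite gdeg_setexp0 ?mon0E // gdeg0.
Qed.

Lemma homM p q a b : hom p a -> hom q b -> hom (p + q) (a * b).
Proof. by rewrite !homP; apply: dgg_homM. Qed.

Lemma hom1 : hom 0 1.
Proof. by rewrite -mv0; apply: within_mv; [exact: normal_mon0 | exact: gdeg0]. Qed.

Lemma hom_prod (L : seq (gvar e)) m : gnormal m ->
  exists p, hom p (\prod_(z <- L) dp z (m z)).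
Proof.
move=> nm; elim: L => [|y L [p hp]]; first by exists 0%N; rewrite big_nil; exact: hom1.
rewrite big_cons; eexists; apply: homM hp; apply: hom_dp; exact: nm.
Qed.

Lemma signA (p : nat) a : (-1) ^+ p * a = ((-1) ^+ p : R) *: a.
Proof. by rewrite -signr_odd -[in RHS]signr_odd; case: odd;
  rewrite ?expr0 ?expr1 ?mul1r ?scale1r ?mulN1r ?scaleN1r. Qed.

(** The factor dp y r moves to its place by graded commutativity.  There it meets
    the power of y that occurs in m: an exterior variable squares to 0, and divided
    powers combine with a binomial coefficient. *)
Lemma mv_dp m y r : gnormal m -> admissible y r ->
  exists c, mon_val m * dp y r = c *: mon_val (setexp m y (m y + r)) /\
    (c = 0 \/ gnormal (setexp m y (m y + r))).
Proof.
move=> nm yr; pose N := maxn (gheight m) (tag y).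
have mN : (gheight m <= N)%N by rewrite leq_maxl.
have yN : (tag y <= N)%N by rewrite leq_maxr.
have [L [L' eN]] := split_vars yN.
have un := uniq_vars e N; rewrite eN cat_uniq /= negb_or in un.
have /and3P[_ /andP[yL _] /andP[yL' _]] := un.
rewrite (mv_split eN mN) (mv_split eN (gheight_setexp _ mN yN)).
rewrite !setexp_prod // setexpE eqxx.
have [p hp] := hom_prod L' nm.
move: (\prod_(z <- L) _) (\prod_(z <- L') _) hp => P P' hP'.
have -> : P * dp y (m y) * P' * dp y r =
    ((-1) ^+ (p * (r * tag y)) : R) *: (P * (dp y (m y) * dp y r) * P').
  have := hom_dp yr; move: hP'; rewrite !homP => hP' hy.
  rewrite -mulrA (dgg_comm hP' hy) signA -!scalerAr; congr (_ *: _).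
  by rewrite !mulrA.
have [oy|oy] := boolP (odd (tag y)); last first.
  exists ((-1) ^+ (p * (r * tag y)) * 'C(m y + r, m y)%:R); split.
    rewrite dgg_dpM // -scalerA; congr (_ *: _).
    by rewrite mulr_natl scaler_nat mulrnAr mulrnAl.
  by right; apply: normal_setexp => //; rewrite /admissible (negPf oy).
have := nm y oy; have := yr oy; case: r yr => [|[|//]] yr _.
  case em : (m y) => [|[|//]] _; rewrite !dgg_dp0 mulr1;
    eexists; (split; first by []); right;
    by apply: normal_setexp => //; rewrite /admissible.
case em : (m y) => [|[|//]] _.
  rewrite !dgg_dp0 mul1r; eexists; (split; first by []); right.
  by apply: normal_setexp => //; rewrite /admissible.
exists 0; split; last by left.
have -> : dp y 1 * dp y 1 = 0.
  by apply: (dgg_sqr0 oy); apply/homP; rewrite -[tag y]mul1n; apply: hom_dp.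
by rewrite mulr0 mul0r scaler0 scale0r.
Qed.

(** The subalgebra R<L> generated by the variables in L. *)
Definition sub_alg (L : seq (gvar e)) : A -> Prop := within (supported L).

Lemma sub_alg_dp L a y r : sub_alg L a -> y \in L -> admissible y r ->
  sub_alg L (a * dp y r).
Proof.
move=> La yL yr.
move: a La; apply: within_ind => [|c a b ha hb|m nm sm].
- by rewrite mul0r; apply: within0.
- by rewrite mulrDl -scalerAl; apply: withinD => //; apply: withinZ.
have [c [-> [->|nm']]] := mv_dp nm yr; first by rewrite scale0r; apply: within0.
apply: withinZ; apply: within_mv => // z; rewrite setexpE.
by case: (eqVneq z y) => [->|_ /sm].
Qed.

Lemma sub_algM L a b : sub_alg L a -> sub_alg L b -> sub_alg L (a * b).
Proof.
move=> La; move: b; apply: within_ind => [|c b b' hb hb'|m nm sm].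
- by rewrite mulr0; apply: within0.
- by rewrite mulrDr -scalerAr; apply: withinD => //; apply: withinZ.
rewrite (mvE (leqnn _)); elim: (vars e _) a La => [|y s IH] a La.
  by rewrite big_nil mulr1.
rewrite big_cons mulrA; apply: IH; have [my|/sm yL] := eqVneq (m y) 0%N.
  by rewrite my dgg_dp0 mulr1.
by apply: sub_alg_dp => //; apply: nm.
Qed.

Lemma sub_alg1 L : sub_alg L 1.
Proof. by rewrite -mv0; apply: within_mv; [exact: normal_mon0 | move=> y; rewrite mon0E]. Qed.

Lemma sub_alg_widen L L' a : {subset L <= L'} -> sub_alg L a -> sub_alg L' a.
Proof. by move=> LL'; apply: within_sub => m sm y /sm/LL'. Qed.

Lemma mv_setexp N L y L' m r : vars e N = L ++ y :: L' -> supported L m ->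
  mon_val (setexp m y r) = mon_val m * dp y r.
Proof.
move=> eN sm.
have un := uniq_vars e N; rewrite eN cat_uniq /= negb_or in un.
have /and3P[_ /andP[yL LL'] /andP[yL' _]] := un.
have mz z : z \notin L -> m z = 0%N by move=> zL; apply/eqP; apply: contraNT zL => /sm.
have mN : (gheight m <= N)%N.
  by apply/gheight_le => z /sm zL; rewrite eN mem_cat zL.
have yN : (tag y <= N)%N by rewrite -mem_vars eN mem_cat inE eqxx orbT.
rewrite (mv_split eN mN) (mv_split eN (gheight_setexp _ mN yN)).
rewrite !setexp_prod // setexpE eqxx mz // dgg_dp0 mulr1.
rewrite [\prod_(z <- L') _]big1_seq ?mulr1 // => z /andP[_ zL'].
rewrite mz ?dgg_dp0 //; apply/negP => zL.
by move/negP: LL'; apply; apply/hasP; exists z.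
Qed.

End Coefficients.

(** * The differential of an acyclic closure *)
Section Closure.
Variables (R : comNzRingType) (e : nat -> nat) (A : dg_gamma_ext R e).
Variables (k : fieldType) (eps : {rmorphism R -> k}) (n : nat) (x : 'I_n -> R).
Hypothesis eps_surj : forall c, exists r, eps r = c.
Hypothesis eps_x : forall i, eps (x i) = 0.
Hypothesis eps_ker : forall r, eps r = 0 -> exists u, r = \sum_i u i * x i.
Hypothesis x_indep : forall c : 'I_n -> R, \sum_i c i * x i = 0 -> forall i, eps (c i) = 0.
Hypothesis clA : acyclic_closure x A.

Local Notation gm := (gmon e).
Local Notation dp := (@dgg_dp R e A).
Local Notation del := (@dgg_diff R e A).
Local Notation mon_val := (@mon_val R e A).
Local Notation hom := (@hom R e A).
Local Notation coefA := (@coefA R e A).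
Local Notation sub_alg := (@sub_alg R e A).
Local Notation basis_mons := (@basis_mons e).
Local Notation mon0 := (mon0 e).
Implicit Types (m : gm) (y z : gvar e) (a b : A).

Lemma del_hom p a : hom p.+1 a -> hom p (del a).
Proof. by rewrite !homP; apply: dgg_diff_hom. Qed.

Lemma del_hom0 a : hom 0 a -> del a = 0.
Proof. by rewrite homP; apply: dgg_diff0. Qed.

Lemma leibniz p a b : hom p a ->
  del (a * b) = del a * b + ((-1) ^+ p : R) *: (a * del b).
Proof. by rewrite homP => ha; rewrite (dgg_diffM _ ha) signA. Qed.

Lemma hom_var y : hom (tag y) (dp y 1).
Proof. by rewrite -[tag y]mul1n; apply: hom_dp. Qed.

Lemma del1 : del 1 = 0.
Proof. by apply: del_hom0; apply: hom1. Qed.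

Lemma supported_nil m : supported [::] m -> m = mon0.
Proof.
by move=> sm; apply/fsfunP => y; rewrite mon0E; apply/eqP/negPn/negP => /sm.
Qed.

Lemma gdeg_eq0 m : gdeg m = 0%N -> m = mon0.
Proof.
move=> dm; apply: supported_nil => y my.
have : y \in vars e 0 by apply: (supported_vars (N := 0) _ my); rewrite dm.
by rewrite mem_vars leqn0 => /eqP ty; have := tag_pos A y; rewrite ty.
Qed.

Lemma hom0E a : hom 0 a -> a = coefA mon0 a *: 1.
Proof.
move=> ha; apply: coefA_inj => m; rewrite linearZ /= -(mv0 A) coefA_mv; last exact: normal_mon0.
case: eqP => [->|mm]; first by rewrite mulr1.
rewrite mulr0; apply/eqP; apply: contra_notT mm => /ha/gdeg_eq0 //.
Qed.

Lemma top_var m y : m y != 0%N -> (gdeg m <= tag y)%N ->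
  m = var_mon y 1 /\ gdeg m = tag y.
Proof.
move=> my dm; have := gdeg_setexp m y 0; rewrite mul0n addn0 => dE.
have ty := tag_pos A y.
have le : (tag y <= m y * tag y)%N by rewrite leq_pmull // lt0n.
have d0 : gdeg (setexp m y 0) = 0%N by lia.
have my1 : m y = 1%N.
  move: dE; rewrite d0 add0n => dE; have : (m y * tag y <= 1 * tag y)%N by rewrite mul1n dE.
  by rewrite leq_pmul2r //; case: (m y) my => [|[]].
split; last by rewrite -dE d0 my1 mul1n.
by rewrite /var_mon -(gdeg_eq0 d0) setexpK -my1 setexp_id.
Qed.

(** A cycle of degree p + 1 lies in stage p + 1.  There it becomes a boundary after
    subtracting a combination of the boundaries of the new variables, and these
    also bound in A. *)
Lemma cycle_is_boundary p (z : A) : hom p.+1 z -> del z = 0 -> exists2 b, hom p.+2 b & z = del b.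
Proof.
move=> hz dz; have [_ _ _ ex _] := clA.
have cz : stage_cycle p.+1 z.
  split=> //; apply/withinP; apply: within_sub hz => m dm; split=> //.
  by apply/gheight_le; apply: supported_vars; rewrite dm.
have [c [b hb zb]] := ex p.+1 z isT cz.
exists (b + \sum_j c j *: dp (gvar_of j) 1).
  apply: withinD.
    by move/withinP: hb; apply: within_sub => m [].
  apply: within_sum => j; apply: withinZ. exact: (@hom_var (gvar_of j)).
have dvE : del (\sum_j c j *: dp (gvar_of j) 1) = \sum_j c j *: dvar A j.
  by rewrite linear_sum; apply: eq_bigr => j _; rewrite linearZ.
by rewrite linearD /= dvE -zb subrK.
Qed.

Lemma del_dp y r : admissible y r ->
  del (dp y r) = if r is s.+1 then del (dp y 1) * dp y s else 0.
Proof.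
case: r => [_|s adm]; first by rewrite dgg_dp0 del1.
have [oy|oy] := boolP (odd (tag y)); last exact: dgg_diff_dp.
by move: (adm oy); case: s {adm} => // _; rewrite dgg_dp0 mulr1.
Qed.

Lemma del_var1 y : tag y = 1%N -> exists i, del (dp y 1) = x i *: 1.
Proof.
case: y => i j /= i1; move: j; rewrite i1 => j.
have [e1 dv _ _ _] := clA.
have jn : (j < n)%N by rewrite -e1.
by exists (Ordinal jn); rewrite -(dv j (Ordinal jn)).
Qed.

Lemma del_var_exists (i : 'I_n) : exists y, tag y = 1%N /\ del (dp y 1) = x i *: 1.
Proof.
have [e1 dv _ _ _] := clA.
have ie : (i < e 1)%N by rewrite e1.
by exists (gvar_of (Ordinal ie)); split=> //; rewrite -(dv (Ordinal ie) i).
Qed.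

Lemma del_hom1 a : hom 1 a -> exists2 r, del a = r *: 1 & eps r = 0.
Proof.
move=> ha; rewrite (hom_expand ha) raddf_sum big_seq /=.
apply: (big_ind (fun b => exists2 r, b = r *: 1 & eps r = 0)).
- by exists 0; rewrite ?scale0r ?rmorph0.
- move=> b c [r -> r0] [s -> s0]; exists (r + s); first by rewrite scalerDl.
  by rewrite rmorphD r0 s0 addr0.
move=> m /(mem_basis_mons A)[nm dm].
have [y my] : exists y, m y != 0%N.
  apply: contrapT => no; have m0 : m = mon0.
    apply: supported_nil => y my; by case: no; exists y.
  by rewrite m0 gdeg0 in dm.
have [mE ty] : m = var_mon y 1 /\ gdeg m = tag y.
  by apply: top_var => //; rewrite dm; apply: (tag_pos A).
have [i iE] := del_var1 (etrans (esym ty) dm).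
exists (coefA m a * x i); last by rewrite rmorphM eps_x mulr0.
by rewrite linearZ /= {2}mE mv_var iE scalerA.
Qed.

Lemma hom1_lift r : eps r = 0 -> exists2 a, hom 1 a & del a = r *: 1.
Proof.
move=> /eps_ker[u ->].
have /choice[y yP] := del_var_exists.
exists (\sum_i u i *: dp (y i) 1).
  apply: within_sum => i; apply: withinZ; have [ty _] := yP i.
  by have := @hom_var (y i); rewrite ty.
rewrite linear_sum scaler_suml; apply: eq_bigr => i _.
by rewrite linearZ /=; have [_ ->] := yP i; rewrite scalerA.
Qed.

Lemma del_var_sub L y : (forall z, (tag z < tag y)%N -> z \in L) ->
  sub_alg L (del (dp y 1)).
Proof.
move=> Ly; have [t1|t1] := eqVneq (tag y) 1%N.
  by have [i ->] := del_var1 t1; apply: withinZ; apply: sub_alg1.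
have [_ _ cyc _ _] := clA.
case: y Ly t1 => [[|[|i]] j] Ly t1 //.
  by have := tag_pos A (Tagged (fun i => 'I_(e i)) j).
have [/withinP w _] := cyc i.+1 j isT.
apply: within_sub w => m [_ /gheight_le sm] z /sm; rewrite mem_vars => zi.
exact: Ly.
Qed.

Definition initial (L : seq (gvar e)) := exists N L', vars e N = L ++ L'.

Lemma initial_rcons L y : initial (rcons L y) -> initial L.
Proof. by move=> [N [L' eN]]; exists N, (y :: L'); rewrite -cat_rcons. Qed.

Lemma supported_split L y m : gnormal m -> supported (rcons L y) m ->
  let m' := setexp m y 0 in
  [/\ gnormal m', supported L m' & m = setexp m' y (m y)].
Proof.
move=> nm sm; split.
- by apply: normal_setexp.
- move=> z; rewrite setexpE; case: (eqVneq z y) => // zy /sm.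
  by rewrite mem_rcons inE (negPf zy).
by rewrite setexpK setexp_id.
Qed.

Lemma sub_alg_rcons L y a : sub_alg L a -> sub_alg (rcons L y) a.
Proof. by apply: sub_alg_widen => z zL; rewrite mem_rcons inE zL orbT. Qed.

Lemma leibniz_mv L y N L' m r : vars e N = L ++ y :: L' -> gnormal m ->
  supported L m -> admissible y r ->
  del (mon_val m * dp y r) = del (mon_val m) * dp y r +
    ((-1) ^+ gdeg m : R) *: (mon_val m * if r is s.+1 then del (dp y 1) * dp y s else 0).
Proof. by move=> eN nm sm yr; rewrite (leibniz _ (@hom_mv R e A m nm)) del_dp. Qed.

(** The variables are ordered by degree, so the boundary of a variable only
    involves earlier ones; the Leibniz rule does the rest. *)
Lemma del_sub_alg L a : initial L -> sub_alg L a -> sub_alg L (del a).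
Proof.
elim/last_ind: L a => [|L y IH] a iL; move: a; apply: within_ind.
- by rewrite raddf0; apply: within0.
- by move=> c a b wa wb; rewrite linearP; apply: withinD => //; apply: withinZ.
- by move=> m _ /supported_nil ->; rewrite mv0 del1; apply: within0.
- by rewrite raddf0; apply: within0.
- by move=> c a b wa wb; rewrite linearP; apply: withinD => //; apply: withinZ.
move=> m nm sm; have [nm' sm' mE] := supported_split nm sm.
have [N [L' eN]] := iL; rewrite cat_rcons in eN.
have yL : y \in rcons L y by rewrite mem_rcons inE eqxx.
have my : admissible y (m y) by apply: nm.
rewrite mE (mv_setexp A _ eN sm') (leibniz_mv eN nm' sm' my).
have w1 : sub_alg (rcons L y) (mon_val (setexp m y 0)).
  by apply/sub_alg_rcons; apply: within_mv.
apply: withinD.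
  apply: sub_alg_dp => //; apply: sub_alg_rcons; apply: IH (initial_rcons iL) _.
  by apply: within_mv.
apply: withinZ; case: (m y) my => [|s] my; first by rewrite mulr0; apply: within0.
rewrite mulrA; apply: sub_alg_dp => //; last by move/my => ss; apply: leq_trans ss.
apply: sub_algM => //; apply: sub_alg_rcons; apply: del_var_sub.
exact: vars_sorted eN.
Qed.

(** This is where the minimality of the set of new variables enters.  Applying del
    to a boundary of degree i gives a relation between the classes of the
    boundaries of the variables of degree i, in the homology of the previous
    stage.  A unit coefficient (modulo the maximal ideal) would make one of these
    classes superfluous, because the maximal ideal annihilates the homology: if
    del z = r and c is a cycle, then r c = del (z c).  For i = 1 the relation is
    one between the x_i instead. *)
Lemma boundary_var_coef i (j0 : 'I_(e i)) a : hom i.+1 a ->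
  eps (coefA (var_mon (gvar_of j0) 1) (del a)) = 0.
Proof.
move=> ha; have hb := del_hom ha.
case: i j0 ha hb => [|i] j0 ha hb.
  by have := tag_pos A (gvar_of j0).
pose c j := coefA (var_mon (@gvar_of e i.+1 j) 1) (del a); rewrite -/(c j0).
pose dec := del a - \sum_j c j *: dp (gvar_of j) 1.
have hdec : hom i.+1 dec.
  apply: withinB => //; apply: within_sum => j; apply: withinZ.
  exact: (@hom_var (gvar_of j)).
have sdec : sub_alg (vars e i) dec.
  move=> m mdec y my; apply: contraNT mdec; rewrite mem_vars -ltnNge => yi.
  have [dm|dm] := eqVneq (gdeg m) i.+1; last first.
    by apply: contraNT dm => /hdec ->.
  have [mE ty] : m = var_mon y 1 /\ gdeg m = tag y by apply: top_var; rewrite // dm.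
  have [j yE] : exists j, y = @gvar_of e i.+1 j.
    have : tag y = i.+1 by rewrite -ty.
    by case: (y) => i' j /= ii; move: j; rewrite ii => j; exists j.
  rewrite /dec raddfB /= linear_sum /= (bigD1 j) //= big1 => [|j' jj'].
    rewrite addr0 linearZ /= -mv_var coefA_mv; last first.
      by apply: normal_setexp => //; apply: normal_mon0.
    by rewrite mE yE eqxx mulr1 subrr.
  rewrite linearZ /= -mv_var coefA_mv; last first.
    by apply: normal_setexp => //; apply: normal_mon0.
  case: eqP => [e'|_]; last by rewrite mulr0.
  have := congr1 (fun f : gm => f (gvar_of j)) e'.
  rewrite mE yE !setexpE eqxx mon0E; case: eqP => // /eqP.
  by rewrite eq_Tagged /= eq_sym (negPf jj').
have ddec : del dec = - \sum_j c j *: dvar A j.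
  rewrite /dec linearB /= dgg_diffK sub0r linear_sum; congr (- _).
  by apply: eq_bigr => j _; rewrite linearZ.
have [e1 dv cyc _ mini] := clA.
case: i j0 ha hb c dec hdec sdec ddec => [|i] j0 ha hb c dec hdec sdec ddec.
  have dec0 : dec = 0.
    apply: coefA_inj => m; rewrite raddf0; apply/eqP/negPn/negP => nz.
    have dm := hdec m nz; have sm := sdec m nz.
    have m0 : m = mon0.
      apply: supported_nil => y /sm; rewrite mem_vars leqn0 => /eqP ty.
      by have := tag_pos A y; rewrite ty.
    by rewrite m0 gdeg0 in dm.
  pose c' := c \o cast_ord (esym e1).
  suff h : \sum_l c' l * x l = 0.
    by have := x_indep h (cast_ord e1 j0); rewrite /c' /= cast_ordK.
  have : (\sum_l c' l * x l) *: (1 : A) = 0.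
    move: ddec; rewrite dec0 linear0 => /eqP; rewrite eq_sym oppr_eq0 => /eqP <-.
    rewrite scaler_suml [RHS](reindex (cast_ord (esym e1))) /=; last first.
      exact/onW_bij/(Bijective (cast_ordK _) (cast_ordKV _)).
    apply: eq_bigr => l _; rewrite (dv _ l) //= scalerA //.
  move/(congr1 (coefA mon0)); rewrite linearZ raddf0 /= -{1}(mv0 A) coefA_mv.
    by rewrite eqxx mulr1.
  exact: normal_mon0.
apply/eqP/negPn/negP => c0.
(* s inverts c j0 modulo the maximal ideal, up to an error r = del zz. *)
have [s sE] := eps_surj (eps (c j0))^-1.
pose r := 1 - s * c j0.
have r0 : eps r = 0 by rewrite rmorphB rmorph1 rmorphM sE mulVf // subrr.
have [zz hzz dzz] := hom1_lift r0.
have [/withinP cyc1 cyc2] := cyc i.+1 j0 isT.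
have hdv : hom i.+1 (dvar A j0) by apply: within_sub cyc1 => m [].
apply: (mini i.+1 j0 (fun j => - (s * c j)) isT).
exists (zz * dvar A j0 - s *: dec).
  have h1 : hom i.+2 (zz * dvar A j0).
    by have := homM hzz hdv; rewrite add1n.
  have h2 : sub_alg (vars e i.+1) (zz * dvar A j0).
    apply: sub_algM; last by apply: within_sub cyc1 => m' [_ /gheight_le].
    by apply: within_sub hzz => m dm; apply: supported_vars; rewrite dm.
  apply/withinP => m nz; split.
    have h : hom i.+2 (zz * dvar A j0 - s *: dec) := withinB h1 (withinZ (c := s) hdec).
    exact: h nz.
  have h : sub_alg (vars e i.+1) (zz * dvar A j0 - s *: dec) := withinB h2 (withinZ (c := s) sdec).
  by apply/gheight_le; exact: h nz.
rewrite linearB /= (leibniz _ hzz) cyc2 mulr0 scaler0 addr0 dzz -scalerAl mul1r.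
rewrite linearZ /= ddec scalerN opprK scaler_sumr.
rewrite [in RHS](bigD1 j0) //= scalerA addrA -scalerDl subrK scale1r.
by congr (_ + _); rewrite -sumrN; apply: eq_bigr => j _; rewrite scaleNr opprK scalerA.
Qed.

End Closure.

(** * Minimality of the acyclic closure *)
Section Derivations.
Variables (R : comNzRingType) (e : nat -> nat) (A : dg_gamma_ext R e).
Variables (k : fieldType) (eps : {rmorphism R -> k}) (n : nat) (x : 'I_n -> R).
Hypothesis eps_surj : forall c, exists r, eps r = c.
Hypothesis eps_x : forall i, eps (x i) = 0.
Hypothesis eps_ker : forall r, eps r = 0 -> exists u, r = \sum_i u i * x i.
Hypothesis x_indep : forall c : 'I_n -> R, \sum_i c i * x i = 0 -> forall i, eps (c i) = 0.
Hypothesis clA : acyclic_closure x A.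

Local Notation gm := (gmon e).
Local Notation dp := (@dgg_dp R e A).
Local Notation del := (@dgg_diff R e A).
Local Notation mon_val := (@mon_val R e A).
Local Notation hom := (@hom R e A).
Local Notation coefA := (@coefA R e A).
Local Notation sub_alg := (@sub_alg R e A).
Local Notation basis_mons := (@basis_mons e).
Local Notation mon0 := (mon0 e).
Implicit Types (m : gm) (a b : A).

Definition extend (V : gm -> A) p a : A :=
  \sum_(m <- basis_mons p) coefA m a *: V m.

Lemma extend_linear V p c a b :
  extend V p (c *: a + b) = c *: extend V p a + extend V p b.
Proof.
rewrite /extend scaler_sumr -big_split; apply: eq_bigr => m _.
by rewrite linearP /= scalerDl scalerA.
Qed.
HB.instance Definition _ V p := GRing.isLinear.Build R A A *:%R (extend V p)
  (fun c a b => extend_linear V p c a b).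

Lemma extend_mv V p m : gnormal m -> gdeg m = p -> extend V p (mon_val m) = V m.
Proof.
move=> nm dm; have mB : m \in basis_mons p by apply/(mem_basis_mons A).
rewrite /extend (bigD1_seq m) ?(uniq_basis_mons A) //= coefA_mv // eqxx scale1r.
rewrite big1 ?addr0 // => m' mm'; by rewrite coefA_mv // (negPf mm') scale0r.
Qed.

Section OneVariable.
Variables (y : gvar e) (N : nat) (L L' : seq (gvar e)).
Hypothesis eN : vars e N = L ++ y :: L'.
Local Notation i := (tag y).

Let old m := `[< supported (rcons L y) m >].
Let deriv m : A := if m y is s.+1 then mon_val (setexp m y s) else 0.
Let wanted V q m b := hom (q.+1 - i)%N b /\ del b = extend V q (del (mon_val m)).

(** The right derivative with respect to y, which sends a y^(r) to a y^(r-1) for a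
    in R<L>, is a chain map on R<L, y>; acting on the right it involves no signs.
    It is extended to all of A as a chain map of degree - tag y.  Being a
    derivation is required on R<L, y> only, so the extension may be chosen freely
    one monomial at a time, in order of increasing degree. *)
Fixpoint stages q m : A :=
  if q is q'.+1 then
    if [|| (gdeg m <= q')%N, old m | (gdeg m <= i)%N] then stages q' m
    else if pselect (exists b, wanted (stages q') q' m b) is left ex
         then sval (cid ex) else 0
  else if old m then deriv m else 0.

Definition theta_val m := stages (gdeg m) m.
Definition theta p a := extend theta_val p a.

Lemma stages_stable q m : (gdeg m <= q)%N -> stages q m = theta_val m.
Proof.
elim: q => [|q IH] dm; first by rewrite /theta_val; move: dm; rewrite leqn0 => /eqP ->.
have [dq|dq] := leqP (gdeg m) q; first by rewrite -IH //= dq.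
have {dm dq} -> : q.+1 = gdeg m by apply/eqP; rewrite eqn_leq dm dq.
by [].
Qed.

Lemma extend_stages q a : extend (stages q) q a = theta q a.
Proof.
apply: eq_big_seq => m /(mem_basis_mons A)[_ dm].
by rewrite stages_stable // dm.
Qed.

Lemma theta_old m : supported (rcons L y) m -> theta_val m = deriv m.
Proof.
move=> sm; have om : old m by apply/asboolP.
by rewrite /theta_val; elim: (gdeg m) => [|q IH] /=; rewrite om // orbT.
Qed.

Lemma theta_low m : (gdeg m <= i)%N -> ~ supported (rcons L y) m -> theta_val m = 0.
Proof.
move=> dm sm; have om : old m = false by apply/negP => /asboolP.
have H q : stages q m = 0 by elim: q => [|q IH] /=; rewrite om // dm !orbT.
exact: H.
Qed.

Lemma theta_new q m : gdeg m = q.+1 -> (i <= q)%N -> ~ supported (rcons L y) m ->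
  (exists b, hom (q.+1 - i)%N b /\ del b = theta q (del (mon_val m))) ->
  hom (q.+1 - i)%N (theta_val m) /\ del (theta_val m) = theta q (del (mon_val m)).
Proof.
move=> dm iq sm ex; have om : old m = false by apply/negP => /asboolP.
rewrite /theta_val dm /= dm ltnn om leqNgt ltnS iq /=.
case: pselect => [ex'|[]]; first by case: (cid ex') => b [hb db]; split=> //=; rewrite db extend_stages.
by case: ex => b hb; exists b; rewrite /wanted extend_stages.
Qed.

Lemma y_notin : y \notin L.
Proof. by have := uniq_vars e N; rewrite eN cat_uniq /= negb_or => /and3P[_ /andP[]]. Qed.

Lemma L_initial : initial L.
Proof. by exists N, (y :: L'). Qed.

Lemma theta_right q p r a : sub_alg L a -> hom q a -> admissible y r ->
  (q + r * i = p)%N -> theta p (a * dp y r) = if r is s.+1 then a * dp y s else 0.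
Proof.
move=> sa ha yr qp; rewrite /theta (hom_expand ha) mulr_suml linear_sum /=.
have -> : (if r is s.+1 then (\sum_(m <- basis_mons q) coefA m a *: mon_val m) * dp y s else 0) =
    \sum_(m <- basis_mons q) coefA m a *: (if r is s.+1 then mon_val m * dp y s else 0).
  case: (r) => [|s]; first by rewrite big1 // => m _; rewrite scaler0.
  by rewrite mulr_suml; apply: eq_bigr => m _; rewrite scalerAl.
apply: eq_big_seq => m /(mem_basis_mons A)[nm dm].
have [->|/sa sm] := eqVneq (coefA m a) 0; first by rewrite scale0r mul0r scale0r linear0.
have my : m y = 0%N by apply/eqP; apply: contraNT y_notin => /sm.
have nm' : gnormal (setexp m y r) by apply: normal_setexp.
rewrite -scalerAl linearZ /= -(mv_setexp A r eN sm) extend_mv //; last first.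
  by rewrite gdeg_setexp0 // dm.
congr (_ *: _); rewrite theta_old /deriv ?setexpE ?eqxx.
  by case: (r) => // s; rewrite setexpK (mv_setexp A s eN sm).
by move=> z; rewrite setexpE mem_rcons inE; case: (eqVneq z y) => //= _ /sm.
Qed.

Lemma theta_chain_old m p : gnormal m -> supported (rcons L y) m -> gdeg m = p.+1 ->
  del (theta_val m) = theta p (del (mon_val m)).
Proof.
move=> nm sm dm; have [nm' sm' mE] := supported_split nm sm.
set m' := setexp m y 0 in nm' sm' mE *.
have yr : admissible y (m y) by apply: nm.
have m'y : m' y = 0%N by rewrite /m' setexpE eqxx.
have d' : (gdeg m' + m y * i = p.+1)%N by rewrite -dm {2}mE gdeg_setexp0.
have iP := tag_pos A y.
have sa : sub_alg L (mon_val m') by apply: within_mv.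
have sda : sub_alg L (del (mon_val m')) by apply: (del_sub_alg clA) => //; exact: L_initial.
have sdv : sub_alg L (mon_val m' * del (dp y 1)).
  by apply: sub_algM => //; apply: (del_var_sub clA); apply: vars_sorted eN.
rewrite theta_old // /deriv [in RHS]mE (mv_setexp A _ eN sm') (leibniz_mv A eN nm' sm' yr).
rewrite /theta linearD /= linearZ /= -!/(theta _ _).
have part1 : theta p (del (mon_val m') * dp y (m y)) =
    if m y is s.+1 then del (mon_val m') * dp y s else 0.
  case e' : (gdeg m') => [|q].
    rewrite del_hom0 ?mul0r; last by rewrite -e'; apply: hom_mv.
    by case: (m y) => [|s]; rewrite ?mul0r /theta linear0.
  apply: (@theta_right q) => //; last by move: d'; rewrite e'; lia.
  by apply: del_hom; rewrite -e'; apply: hom_mv.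
rewrite part1; case my : (m y) yr d' => [|s] yr d'.
  by rewrite linear0 mulr0 /theta linear0 scaler0 addr0.
have -> : setexp m y s = setexp m' y s by rewrite /m' setexpK.
have ys : admissible y s by move/yr => ss; apply: leq_trans ss.
rewrite (mv_setexp A _ eN sm') (leibniz_mv A eN nm' sm' ys) mulrA.
congr (_ + _ *: _).
have hv : hom (gdeg m' + i.-1)%N (mon_val m' * del (dp y 1)).
  apply: homM; first exact: hom_mv.
  by apply: del_hom; rewrite prednK //; apply: hom_var.
rewrite (theta_right sdv hv ys); last by move: d'; rewrite mulSn; lia.
by case: (s) => [|s']; rewrite ?mulr0 // mulrA.
Qed.

Lemma deriv_hom m : gnormal m -> hom (gdeg m - i)%N (deriv m) /\
  ((gdeg m < i)%N -> deriv m = 0).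
Proof.
move=> nm; rewrite /deriv; case my : (m y) => [|s]; first by split=> //; apply: within0.
have := gdeg_setexp m y s; rewrite my mulSn => dE.
split=> [|lt]; last by exfalso; lia.
have -> : (gdeg m - i = gdeg (setexp m y s))%N by lia.
apply: hom_mv; apply: normal_setexp => // oy.
by have := nm y oy; rewrite my; apply: leq_trans.
Qed.

(** The obstruction to extending theta to degree tag y + 1 is thus the coefficient
    of y in a boundary. *)
Lemma theta_degree_i a : hom i a -> theta i a = coefA (var_mon y 1) a *: 1.
Proof.
move=> ha; have nv : gnormal (var_mon y 1) by apply: normal_setexp => //; apply: normal_mon0.
have dv : gdeg (var_mon y 1) = i by rewrite gdeg_setexp0 ?mon0E // gdeg0 mul1n.
have vB : var_mon y 1 \in basis_mons i by apply/(mem_basis_mons A).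
rewrite /theta /extend (bigD1_seq (var_mon y 1)) ?(uniq_basis_mons A) //=.
have -> : theta_val (var_mon y 1) = 1.
  rewrite theta_old; last first.
    move=> z; rewrite setexpE mon0E mem_rcons inE.
    by case: (eqVneq z y).
  rewrite /deriv setexpE eqxx /var_mon setexpK -(mon0E y) setexp_id.
  exact: mv0.
rewrite big1_seq ?addr0 // => m /andP[mon_val /(mem_basis_mons A)[nm dm]].
have [sm|sm] := EM (supported (rcons L y) m); last first.
  by rewrite theta_low ?scaler0 // dm.
rewrite theta_old // /deriv; case my : (m y) => [|s]; first by rewrite scaler0.
have [mE _] : m = var_mon y 1 /\ gdeg m = i.
  by apply: (top_var A); rewrite ?my // dm.
by rewrite mE eqxx in mon_val.
Qed.

(** The value of theta at a monomial m must have the cycle theta (del m) as its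
    boundary.  If this cycle has positive degree, it bounds because A is acyclic;
    in degree 0 it lies in the maximal ideal by boundary_var_coef, and again it
    bounds. *)
Lemma theta_spec p m : gnormal m -> gdeg m = p ->
  [/\ hom (p - i)%N (theta_val m), (p < i)%N -> theta_val m = 0 &
      forall q, p = q.+1 -> del (theta_val m) = theta q (del (mon_val m))].
Proof.
have iP := tag_pos A y.
elim/ltn_ind: p m => p IH m nm dm.
have theta0 q a : (q < p)%N -> (q < i)%N -> theta q a = 0.
  move=> qp qi; rewrite /theta /extend big1_seq // => m' /andP[_].
  move=> /(mem_basis_mons A)[nm' dm']; have [_ -> //] := IH q qp m' nm' dm'.
  by rewrite scaler0.
have thetaH q a : (q < p)%N -> hom (q - i)%N (theta q a).
  move=> qp; rewrite /theta /extend big_seq.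
  elim/big_rec: _ => [|m' b /(mem_basis_mons A)[nm' dm'] hb]; first exact: within0.
  by apply: withinD => //; apply: withinZ; have [] := IH q qp m' nm' dm'.
have chain q a : (q.+1 < p)%N -> hom q.+1 a -> del (theta q.+1 a) = theta q (del a).
  move=> qp ha; have -> : del a = \sum_(m' <- basis_mons q.+1) coefA m' a *: del (mon_val m').
    rewrite {1}(hom_expand ha) linear_sum; apply: eq_bigr => m' _; exact: linearZ.
  rewrite /theta [RHS]linear_sum [X in del X]/extend [LHS]linear_sum.
  apply: eq_big_seq => m' /(mem_basis_mons A)[nm' dm'].
  rewrite linearZ [RHS]linearZ /=; congr (_ *: _).
  by have [_ _ /(_ q erefl) ->] := IH q.+1 qp m' nm' dm'.
have [sm|sm] := EM (supported (rcons L y) m).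
  have [h1 h2] := deriv_hom nm; rewrite theta_old //; rewrite dm in h1 h2; split=> // q pq.
  by rewrite -(theta_old sm); apply: theta_chain_old => //; rewrite dm.
have [pi|pi] := leqP p i.
  have t0 : theta_val m = 0 by apply: theta_low; rewrite ?dm.
  rewrite t0; split=> //; first exact: within0.
  by move=> q pq; rewrite linear0 theta0 // -pq.
case: p IH nm dm theta0 thetaH chain pi => // q IH nm dm theta0 thetaH chain pi.
suff [h1 h2] : hom (q.+1 - i)%N (theta_val m) /\ del (theta_val m) = theta q (del (mon_val m)).
  by split=> // [|q' [<-]//]; rewrite ltnNge ltnW.
apply: theta_new => //.
have hm : hom q.+1 (mon_val m) by rewrite -dm; apply: hom_mv.
have hz := thetaH q (del (mon_val m)) (ltnSn q).
(* q - i is the degree of the cycle theta (del m). *)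
case e' : (q - i)%N hz => [|d] hz.
  have qi : q = i by apply/eqP; rewrite eqn_leq -subn_eq0 e' /= -ltnS.
  move: hm; rewrite {}qi in e' hz *; move=> hm.
  rewrite theta_degree_i; last exact: del_hom.
  have b0 : eps (coefA (var_mon y 1) (del (mon_val m))) = 0.
    have := @boundary_var_coef _ _ _ _ eps _ _ eps_surj eps_ker x_indep clA i (tagged y) _ hm.
    by have -> : gvar_of (tagged y) = y by case: (y).
  have [b hb db] := hom1_lift eps_ker clA b0.
  by exists b; rewrite subSnn.
have dz : del (theta q (del (mon_val m))) = 0.
  case: q {IH nm dm theta0 thetaH pi hz sm} e' hm chain => [|q] e' hm chain.
    by rewrite sub0n in e'.
  by rewrite chain ?dgg_diffK /theta ?linear0 //; apply: del_hom.
have [b hb zb] := cycle_is_boundary clA hz dz.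
by exists b; split=> //; rewrite subSn ?e' //; lia.
Qed.

Lemma theta_hom q a : hom (q - i)%N (theta q a).
Proof.
rewrite /theta /extend big_seq.
elim/big_rec: _ => [|m' b /(mem_basis_mons A)[nm' dm'] hb]; first exact: within0.
by apply: withinD => //; apply: withinZ; have [] := theta_spec nm' dm'.
Qed.

Lemma theta_chain q a : hom q.+1 a -> del (theta q.+1 a) = theta q (del a).
Proof.
move=> ha; have -> : del a = \sum_(m <- basis_mons q.+1) coefA m a *: del (mon_val m).
  rewrite {1}(hom_expand ha) linear_sum; apply: eq_bigr => m' _; exact: linearZ.
rewrite /theta [RHS]linear_sum [X in del X]/extend [LHS]linear_sum.
apply: eq_big_seq => m /(mem_basis_mons A)[nm dm].
rewrite linearZ [RHS]linearZ /=; congr (_ *: _).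
by have [_ _ /(_ q erefl) ->] := theta_spec nm dm.
Qed.

Lemma coef_theta p b m' :
  (forall m, eps (coefA m b) != 0 -> supported (rcons L y) m) ->
  eps (coefA m' (theta p b)) =
    \sum_(m <- basis_mons p) eps (coefA m b) * (((m y != 0%N) && (m' == setexp m y (m y).-1))%:R).
Proof.
move=> sb; rewrite /theta /extend linear_sum rmorph_sum; apply: eq_big_seq => m.
move=> /(mem_basis_mons A)[nm dm]; rewrite linearZ /= rmorphM.
have [->|/sb sm] := eqVneq (eps (coefA m b)) 0; first by rewrite !mul0r.
congr (_ * _); rewrite theta_old // /deriv; case my : (m y) => [|s] /=.
  by rewrite linear0 rmorph0.
rewrite coefA_mv ?rmorph_nat //; apply: normal_setexp => // oy.
by have := nm y oy; rewrite my; apply: leq_trans.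
Qed.

End OneVariable.

(** Gulliksen's argument.  Let y be the last variable occurring in a term of del a
    with unit coefficient.  Then theta takes del a to a boundary which again has a
    unit coefficient, in smaller degree.  In the end a unit remains in degree 0,
    where the boundaries form the maximal ideal. *)
Lemma boundary_minimal_supported L : initial L -> forall p a, hom p.+1 a ->
  (forall m, eps (coefA m (del a)) != 0 -> supported L m) ->
  forall m, eps (coefA m (del a)) = 0.
Proof.
elim/last_ind: L => [|L y IH] iL.
  move=> p a ha sa m; have [m0|m0] := eqVneq m mon0; last first.
    apply/eqP; apply: contraNT m0 => /sa/supported_nil ->; exact: eqxx.
  case: p ha => [|p] ha; last first.
    have -> : coefA m (del a) = 0; last by rewrite rmorph0.
    by apply/eqP/negPn/negP => /(del_hom ha); rewrite m0 gdeg0.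
  have [r -> r0] := del_hom1 eps_x clA ha.
  by rewrite linearZ /= rmorphM r0 mul0r.
have [N [L' eN]] := iL; rewrite cat_rcons in eN.
have iL' := initial_rcons iL.
(* Inner induction on a bound r for the exponent of y. *)
suff H r : forall p a, hom p.+1 a ->
    (forall m, eps (coefA m (del a)) != 0 -> supported (rcons L y) m /\ (m y <= r)%N) ->
    forall m, eps (coefA m (del a)) = 0.
  move=> p a ha sa m; apply: (H p p a ha) => {}m nz; split; first exact: sa.
  have hd : gdeg m = p.
    by apply: (del_hom ha); apply: contraNneq nz => ->; rewrite rmorph0.
  have := gdeg_setexp m y 0; have := tag_pos A y; rewrite hd; nia.
elim: r => [|r IHr] p a ha sa.
  apply: (IH iL' p a ha) => m /sa[sm]; rewrite leqn0 => /eqP my z mz.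
  have := sm z mz; rewrite mem_rcons inE => /orP[/eqP zy|//].
  by rewrite zy my in mz.
have sa1 m : eps (coefA m (del a)) != 0 -> supported (rcons L y) m by case/sa.
have normal_deg m : eps (coefA m (del a)) != 0 -> gnormal m /\ gdeg m = p.
  move=> nz; have nz' : coefA m (del a) != 0 by apply: contraNneq nz => ->; rewrite rmorph0.
  by split; [exact: coefA_normal nz' | exact: (del_hom ha) nz'].
have yterm m : m y != 0%N -> eps (coefA m (del a)) = 0.
  move=> my; apply/eqP/negPn/negP => nz.
  have [nm dm] := normal_deg m nz.
  have tp : (tag y <= p)%N.
    rewrite -dm; have := gdeg_setexp m y 0; move: my; rewrite -lt0n; nia.
  have hb : hom (p - tag y).+1 (theta y L p.+1 a).
    rewrite -subSn //.
    exact: (@theta_hom _ _ _ _ eN p.+1 a).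
  have cb m' : eps (coefA m' (del (theta y L p.+1 a))) =
      \sum_(m <- basis_mons p) eps (coefA m (del a)) *
        (((m y != 0%N) && (m' == setexp m y (m y).-1))%:R).
    by rewrite (theta_chain eN) // coef_theta.
  move/negP: nz; apply; apply/eqP.
  have := IHr _ _ hb _ (setexp m y (m y).-1); rewrite cb.
  rewrite (bigD1_seq m) ?(uniq_basis_mons A) //=; last by apply/(mem_basis_mons A).
  rewrite my eqxx mulr1 big1 => [|m2 m2m].
    rewrite addr0; apply => m'; rewrite cb => nz.
    have [m2 [nz2 m2y m'E]] : exists m2, [/\ eps (coefA m2 (del a)) != 0,
        m2 y != 0%N & m' = setexp m2 y (m2 y).-1].
      apply: contrapT => no; move/eqP: nz; apply; apply: big1 => m2 _.
      have [->|c2] := eqVneq (eps (coefA m2 (del a))) 0; first by rewrite mul0r.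
      case: andP => [[m2y /eqP m'E]|_]; last by rewrite mulr0.
      by case: no; exists m2.
    have [sm2 le2] := sa m2 nz2; rewrite m'E; split; last by rewrite setexpE eqxx; lia.
    move=> z; rewrite setexpE; case: (eqVneq z y) => [->|_ /sm2 //].
    by rewrite mem_rcons inE eqxx.
  case: andP => [[m2y /eqP e2]|_]; last by rewrite mulr0.
  case/negP: m2m; apply/eqP.
  rewrite -(setexp_id m2 y) -(setexpK m2 y (m2 y).-1) -e2 setexpK.
  have := congr1 (fun f : gm => f y) e2; rewrite !setexpE eqxx => e3.
  have -> : m2 y = m y by move: my m2y e3; case: (m y) (m2 y) => [|u] [|v] //= _ _ ->.
  by rewrite setexp_id.
move=> m; apply: (IH iL' p a ha) => {}m nz z mz.
have := sa1 m nz z mz; rewrite mem_rcons inE => /orP[/eqP zy|//].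
by rewrite yterm ?eqxx // -zy in nz.
Qed.

Theorem boundary_minimal p a m : hom p.+1 a -> eps (coefA m (del a)) = 0.
Proof.
move=> ha; apply: (@boundary_minimal_supported (vars e p) _ p a ha).
  by exists p, [::]; rewrite cats0.
move=> m' nz; apply: supported_vars.
have -> // : gdeg m' = p.
by apply: (del_hom ha); apply: contraNneq nz => ->; rewrite rmorph0.
Qed.

Definition rank_A p := size (basis_mons p).
Definition mon_at p (j : 'I_(rank_A p)) : gm := nth mon0 (basis_mons p) j.

Lemma mon_atP p j : gnormal (@mon_at p j) /\ gdeg (@mon_at p j) = p.
Proof. by apply/(mem_basis_mons A); apply: mem_nth. Qed.

Definition vec p (v : 'rV[R]_(rank_A p)) : A := \sum_j v 0 j *: mon_val (mon_at j).

Lemma hom_vec p v : hom p (@vec p v).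
Proof.
apply: within_sum => j; apply: withinZ; have [nm dm] := mon_atP j.
exact: within_mv.
Qed.

Lemma coef_vec p v j : coefA (mon_at j) (@vec p v) = v 0 j.
Proof.
rewrite /vec linear_sum /= (bigD1 j) //= big1 => [|l lj].
  by rewrite addr0 linearZ /= coefA_mv ?eqxx ?mulr1 //; have [] := mon_atP j.
rewrite linearZ /= coefA_mv; last by have [] := mon_atP l.
rewrite /mon_at nth_uniq ?(uniq_basis_mons A) // -[_ == _ :> nat]/(j == l).
by rewrite eq_sym (negPf lj) mulr0.
Qed.

Lemma vec_coef p a : hom p a -> a = vec (\row_j coefA (@mon_at p j) a).
Proof.
move=> ha; rewrite {1}(hom_expand ha) (big_nth mon0) big_mkord.
by apply: eq_bigr => j _; rewrite mxE.
Qed.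

Definition closure_mx p : 'M[R]_(rank_A p.+1, rank_A p) :=
  \matrix_(j, l) coefA (mon_at l) (del (mon_val (mon_at j))).

Lemma vec_closure_mx p v : vec (v *m closure_mx p) = del (vec v).
Proof.
rewrite [RHS](@vec_coef p); last by apply: del_hom; apply: hom_vec.
congr vec; apply/rowP => l; rewrite !mxE /vec !linear_sum /=.
by apply: eq_bigr => j _; rewrite !linearZ mxE.
Qed.

Lemma vec_inj p (u v : 'rV[R]_(rank_A p)) : vec u = vec v -> u = v.
Proof. by move=> uv; apply/rowP => j; rewrite -!coef_vec uv. Qed.

Lemma vec0 p : @vec p 0 = 0.
Proof. by rewrite /vec big1 // => j _; rewrite mxE scale0r. Qed.

Lemma basis_mons0 : basis_mons 0 = [:: mon0].
Proof.
have m0 : mon0 \in basis_mons 0.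
  by apply/(mem_basis_mons A); split; [exact: normal_mon0 | exact: gdeg0].
have all0 m : m \in basis_mons 0 -> m = mon0.
  by move=> /(mem_basis_mons A)[_ /(gdeg_eq0 A)].
have := uniq_basis_mons A 0; case: (basis_mons 0) m0 all0 => [|a [|b s]] //=.
  by move=> _ h _; rewrite (h a) ?inE ?eqxx.
move=> _ h; rewrite (h a) ?inE ?eqxx // (h b) ?inE ?eqxx ?orbT //.
Qed.

Lemma closure_resolution : free_resolution eps closure_mx (const_mx 1).
Proof.
have augE (v : 'rV[R]_(rank_A 0)) :
    map_mx eps v *m const_mx 1 = (eps (coefA mon0 (vec v)))%:M.
  apply/matrixP => i j; rewrite !ord1 !mxE eqxx mulr1n.
  rewrite /vec linear_sum rmorph_sum; apply: eq_bigr => l _.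
  rewrite !mxE mulr1 linearZ /= coefA_mv; last by have [] := mon_atP l.
  have -> : mon_at l = mon0.
    by apply: (gdeg_eq0 A); have [] := mon_atP l.
  by rewrite eqxx mulr1.
split.
- exists (\row_j coefA (@mon_at 0 j) (1 : A)); rewrite augE -vec_coef; last exact: hom1.
  rewrite -{1}(mv0 A) coefA_mv ?eqxx ?rmorph1 //; last exact: normal_mon0.
- move=> v; rewrite augE; split.
    move=> /matrixP/(_ 0 0); rewrite !mxE eqxx mulr1n => v0.
    have [b hb db] := hom1_lift eps_ker clA v0.
    exists (\row_j coefA (@mon_at 1 j) b); apply: vec_inj.
    by rewrite vec_closure_mx -vec_coef // db -hom0E //; apply: hom_vec.
  move=> [u ->]; rewrite vec_closure_mx (@boundary_minimal 0); last exact: hom_vec.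
  by apply/matrixP => i j; rewrite !mxE mul0rn.
- move=> i; apply/row_matrixP => j; rewrite row_mul row0; apply: vec_inj.
  by rewrite vec_closure_mx rowE vec_closure_mx dgg_diffK vec0.
move=> i v vD; have dv : del (vec v) = 0 by rewrite -vec_closure_mx vD vec0.
have [b hb vb] := cycle_is_boundary clA (@hom_vec i.+1 v) dv.
exists (\row_j coefA (@mon_at i.+2 j) b); apply: vec_inj.
by rewrite vec_closure_mx -vec_coef.
Qed.

Lemma closure_mx_minimal p : map_mx eps (closure_mx p) = 0.
Proof.
apply/matrixP => j l; rewrite !mxE; apply: (@boundary_minimal p).
by have [nm dm] := mon_atP j; apply: within_mv.
Qed.

End Derivations.

(** * Alternating functions on words *)
Section AlternatingFunctions.
Variables (n : nat) (E : rel 'I_n).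
Hypotheses (Esym : ssrbool.symmetric E) (Eirr : irreflexive E).
Local Notation word := (seq 'I_n).

(** The dual of the quadratic dual of the edge ring, which is generated by letters
    with a^2 = 0 and a b = - b a for nonadjacent a, b.  Working with functions on
    words avoids normal forms and choices of signs. *)
Definition alternating (K : zmodType) (f : word -> K) : Prop :=
  (forall p q a, f (p ++ a :: a :: q) = 0) /\
  (forall p q a b, a != b -> ~~ E a b ->
     f (p ++ a :: b :: q) = - f (p ++ b :: a :: q)).

Definition signed (K : zmodType) (s : bool) (x : K) := if s then - x else x.

(** Moves the first letter a of a word to the front, if the letters before it
    commute with a; the boolean tells whether the sign changes. *)
Fixpoint pull (a : 'I_n) (w : word) : option (bool * word) :=
  if w is b :: w' then
    if b == a then Some (false, w') else
    if E a b then None else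
    if pull a w' is Some (s, v) then Some (~~ s, b :: v) else None
  else None.

Lemma pullN a b w : b != a -> ~~ E a b ->
  pull a (b :: w) = if pull a w is Some (s, v) then Some (~~ s, b :: v) else None.
Proof. by move=> /negPf /= -> /negPf ->. Qed.

Lemma size_pull a w s v : pull a w = Some (s, v) -> size w = (size v).+1.
Proof.
elim: w s v => //= b w IH s v; case: eqP => [_ [_ <-] //|_].
by case: (E a b) => //; case: pull IH => [[s' v']|] // /(_ _ _ erefl) -> [_ <-].
Qed.

Lemma alternating_pull (K : zmodType) (f : word -> K) a p w s v :
  alternating f -> pull a w = Some (s, v) ->
  f (p ++ w) = signed s (f (p ++ a :: v)).
Proof.
move=> [_ f2]; elim: w s v p => //= b w IH s v p.
case: eqP => [-> [<- <-] //|/eqP ba].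
case Eab: (E a b) => //; case wv: (pull a w) => [[s' v']|] // [<- <-].
rewrite -cat_rcons (IH _ _ _ wv) cat_rcons f2 1?Esym ?Eab //.
by case: s' {wv} => //=; rewrite opprK.
Qed.

(** A word from which a can be pulled twice is equivalent to one beginning with
    a a. *)
Lemma alternating_pull2 (K : zmodType) (f : word -> K) a w s v :
  alternating f -> pull a w = Some (s, v) -> pull a v -> f w = 0.
Proof.
move=> alt wv; case e: (pull a v) => [[s' v']|] // _.
rewrite -[w]cat0s (alternating_pull [::] alt wv) /= -cat1s.
rewrite (alternating_pull [:: a] alt e) /=.
have [f1 _] := alt; have := f1 [::] v' a => /= ->.
by case: s s' {wv e} => [] [] /=; rewrite ?oppr0.
Qed.

Lemma pull_swap a p q b c s v : b != c -> ~~ E b c ->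
  pull a (p ++ b :: c :: q) = Some (s, v) ->
  exists s' v', pull a (p ++ c :: b :: q) = Some (s', v') /\
    (v' = v /\ s' = ~~ s \/
     s' = s /\ exists p' q', v = p' ++ b :: c :: q' /\ v' = p' ++ c :: b :: q').
Proof.
move=> bc Ebc; elim: p s v => [|d p IH] s v.
  rewrite /=; case: (eqVneq b a) => [ba|ba].
    subst a => -[<- <-]; rewrite eq_sym (negPf bc) (negPf Ebc).
    by exists true, (c :: q); split=> //; left.
  case: (eqVneq c a) => [ca|ca].
    case: (E a b) => // -[<- <-]; exists false, (b :: q); split=> //; left.
    by [].
  case: (E a b) => //; case: (E a c) => //.
  case: (pull a q) => [[s' v']|] // [<- <-].
  exists s', (c :: b :: v'); rewrite negbK; split=> //.
  by right; split=> //; exists [::], v'.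
rewrite /=; case: (d == a).
  move=> [<- <-]; exists false, (p ++ c :: b :: q); split=> //; right.
  by split=> //; exists p, q.
case: (E a d) => //; case: pull IH => [[s' v']|] // IH [<- <-].
have [s2 [v2 [-> h]]] := IH _ _ erefl.
exists (~~ s2), (d :: v2); split=> //.
case: h => [[-> ->]|[-> [p' [q' [-> ->]]]]]; first by left.
by right; split=> //; exists (d :: p'), q'.
Qed.

Lemma pull_swap_none a p q b c : b != c -> ~~ E b c ->
  isSome (pull a (p ++ b :: c :: q)) = isSome (pull a (p ++ c :: b :: q)).
Proof.
move=> bc Ebc; apply/idP/idP.
  case e: pull => [[s v]|] // _.
  by have [s' [v' [-> _]]] := pull_swap bc Ebc e.
case e: pull => [[s v]|] // _.
have cb : c != b by rewrite eq_sym.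
have Ecb : ~~ E c b by rewrite Esym.
by have [s' [v' [-> _]]] := pull_swap cb Ecb e.
Qed.

Lemma pull_dup a p q b s v : pull a (p ++ b :: b :: q) = Some (s, v) ->
  (exists p' q', v = p' ++ b :: b :: q') \/ isSome (pull a v).
Proof.
elim: p s v => [|d p IH] s v /=.
  case: (eqVneq b a) => [-> [_ <-]|ba]; first by right; rewrite /= eqxx.
  case: (E a b) => //; case: (pull a q) => [[s' v']|] // [_ <-].
  by left; exists [::], v'.
case: (eqVneq d a) => [_ [_ <-]|da]; first by left; exists p, q.
case Ead: (E a d) => //; case: pull IH => [[s' v']|] // IH [_ <-].
case: (IH _ _ erefl) => [[p' [q' ->]]|h]; first by left; exists (d :: p'), q'.
by right; rewrite pullN ?Ead //; case: (pull a v') h => [[]|].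
Qed.

Section Homotopy.
Variable k : fieldType.
Local Notation cochain := (word -> 'X_{1..n} -> k).
Implicit Types (g : cochain) (u : 'X_{1..n}) (w : word).

(** The coefficient at the monomial u of the sum of the T_b f(b w) over the letters
    b. *)
Definition koszul_diff g : cochain := fun w u =>
  \sum_(b | u b != 0%N) g (b :: w) (u - U_(b))%MM.

(** The letters that can be moved between the monomial u and the front of the word
    w.  Moving one of them does not change this set, see movable_cons. *)
Definition movable u w : pred 'I_n := fun a =>
  (u a != 0%N) ||
  (isSome (pull a w) && [forall c, (u c != 0%N) ==> ~~ E a c]).

Definition push_to (a : 'I_n) g : cochain := fun w u =>
  if pull a w is Some (s, v) then
    if pull a v then 0 else signed s (g v (u + U_(a))%MM)
  else 0.

Definition koszul_htpy g : cochain := fun w u =>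
  if [pick a | movable u w a] is Some a then push_to a g w u else 0.

Lemma movable_swap u p q b c : b != c -> ~~ E b c ->
  movable u (p ++ b :: c :: q) =1 movable u (p ++ c :: b :: q).
Proof. by move=> bc Ebc a; rewrite /movable pull_swap_none. Qed.

Lemma alternating_push a g u :
  (forall u, alternating (g^~ u)) -> alternating ((push_to a g)^~ u).
Proof.
move=> galt; split=> [p q b|p q b c bc Ebc]; rewrite /push_to.
  case e: pull => [[s v]|] //; case: ifP => // vN.
  case: (pull_dup e) => [[p' [q' ->]]|]; last by rewrite vN.
  by have [-> _] := galt (u + U_(a))%MM; case: (s) => //=; rewrite oppr0.
case e: pull => [[s v]|]; last first.
  have := pull_swap_none a p q bc Ebc; rewrite e.
  by case: pull => // _; rewrite oppr0.
have [s' [v' [-> h]]] := pull_swap bc Ebc e.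
case: h => [[-> ->]|[-> [p' [q' [-> ->]]]]].
  by case: ifP => _; rewrite ?oppr0 //; case: (s) => //=; rewrite opprK.
rewrite -(pull_swap_none a p' q' bc Ebc); case: ifP => _; rewrite ?oppr0 //.
have [_ g2] := galt (u + U_(a))%MM.
by rewrite (g2 p' q' b c bc Ebc); case: (s).
Qed.

Lemma alternating_htpy g u :
  (forall u, alternating (g^~ u)) -> alternating ((koszul_htpy g)^~ u).
Proof.
move=> galt; split=> [p q b|p q b c bc Ebc]; rewrite /koszul_htpy.
  case: pickP => // a _; by have [-> _] := alternating_push a u galt.
rewrite (eq_pick (movable_swap u p q bc Ebc)); case: pickP => [a _|_].
  by have [_ h] := alternating_push a u galt; apply: h.
by rewrite oppr0.
Qed.

Lemma movable_cons u w b : indep E u -> u b != 0%N ->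
  movable (u - U_(b))%MM (b :: w) =1 movable u w.
Proof.
move=> /indepP iu ub a; rewrite /movable mnmBE mnm1E.
have nE c : u c != 0%N -> ~~ E b c.
  by move=> uc; apply: contra uc => /iu; rewrite (negPf ub).
have subE c : ((u - U_(b))%MM c != 0%N) ==> (u c != 0%N).
  by rewrite mnmBE; apply/implyP; case: (u c).
have [ba|ba] := eqVneq b a.
  rewrite -ba ub /= eqxx /=; apply/orP; right; apply/forallP => c.
  by apply/implyP => /(implyP (subE c)); apply: nE.
rewrite subn0; case: (u a != 0%N) => //=.
rewrite (negPf ba); have [Eab|Eab] := boolP (E a b) => /=.
  symmetry; apply/negbTE; rewrite negb_and; apply/orP; right; rewrite negb_forall.
  by apply/existsP; exists b; rewrite ub Eab.
have -> : isSome (if pull a w is Some (s, v) then Some (~~ s, b :: v) else None) =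
    isSome (pull a w) by case: pull => [[]|].
congr (_ && _); apply/forallP/forallP => h c; apply/implyP => uc; last first.
  by apply: (implyP (h c)); apply: (implyP (subE c)).
have [<- //|bc] := eqVneq b c.
by apply: (implyP (h c)); rewrite mnmBE mnm1E (negPf bc) subn0.
Qed.

(** The pairs obtained from (w, u) by moving letters back and forth form a full
    simplex on the set of movable letters, which is contracted by coning with one
    chosen letter.  This set is empty only for the empty word and the monomial 1.
    The choice made in koszul_htpy depends only on the set, so it is the same
    letter at all vertices of the simplex. *)
Lemma koszul_homotopy g w u : (forall u, alternating (g^~ u)) -> indep E u ->
  (w != [::]) || (u != 0%MM) ->
  koszul_diff (koszul_htpy g) w u + koszul_htpy (koszul_diff g) w u = g w u.
Proof.
move=> galt iu nz.
have [a0 ma0] : exists a, movable u w a.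
  have [u0|/eqP u0] := eqVneq u 0%MM; last first.
    apply/existsP; apply: contra_notT u0; rewrite negb_exists => /forallP no.
    apply/mnmP => b; rewrite mnm0E; apply/eqP.
    by have := no b; rewrite /movable negb_or negbK => /andP[].
  case: w nz => [|b w]; rewrite u0 ?eqxx // => _; exists b.
  rewrite /movable /= eqxx /=; apply/orP; right.
  by apply/forallP => c; rewrite mnm0E.
case pa: [pick a | movable u w a] => [a|]; last first.
  by move: pa; case: pickP => // no; rewrite no in ma0.
have ma : movable u w a by move: pa; case: pickP => // b mb [<-].
have pb b : u b != 0%N ->
    [pick a | movable (u - U_(b))%MM (b :: w) a] = Some a.
  by move=> ub; rewrite (eq_pick (movable_cons w iu ub)).
have nadj b : u b != 0%N -> ~~ E a b.
  move=> ub; case/orP: ma => [ua|/andP[_ /forallP/(_ b)/implyP]]; last exact.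
  by apply: contraL ub => /(indepP _ _ iu); rewrite (negPf ua) /= negbK.
have -> : koszul_diff (koszul_htpy g) w u =
    \sum_(b | u b != 0%N) push_to a g (b :: w) (u - U_(b))%MM.
  by apply: eq_bigr => b ub; rewrite /koszul_htpy pb.
have -> : koszul_htpy (koszul_diff g) w u = push_to a (koszul_diff g) w u.
  by rewrite /koszul_htpy pa.
have sub_add b : u b != 0%N -> (u - U_(b) + U_(a) = u + U_(a) - U_(b))%MM.
  move=> ub; apply/mnmP => c; rewrite !(mnmBE, mnmDE, mnm1E).
  by case: eqVneq => [<-|_] /=; [rewrite addnBAC // lt0n | rewrite !subn0].
have Ca b : b != a -> u b != 0%N -> pull a (b :: w) =
    if pull a w is Some (s, v) then Some (~~ s, b :: v) else None.
  by move=> ba ub; rewrite pullN // nadj.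
(* The letter a can be pulled out of w not at all, once, or twice; in the last
   case all terms vanish. *)
rewrite {2}/push_to; case wv: (pull a w) => [[s v]|]; last first.
  rewrite addr0; have ua : u a != 0%N by move: ma; rewrite /movable wv orbF.
  rewrite (bigD1 a) //= big1 ?addr0 => [|b /andP[ub ba]]; last first.
    by rewrite /push_to Ca // wv.
  by rewrite /push_to /= eqxx wv /= submK // lep1mP.
have push_a : push_to a g (a :: w) (u - U_(a))%MM = 0.
  by rewrite /push_to /= eqxx wv.
case: ifP => va.
  rewrite (alternating_pull2 (galt u) wv va) addr0 big1 // => b ub.
  have [->//|ba] := eqVneq b a; rewrite /push_to Ca // wv.
  by rewrite pullN ?nadj //; case: (pull a v) va => [[]|].
have -> : \sum_(b | u b != 0%N) push_to a g (b :: w) (u - U_(b))%MM =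
    \sum_(b | (u b != 0%N) && (b != a))
       - signed s (g (b :: v) (u + U_(a) - U_(b))%MM).
  rewrite big_mkcondr; apply: eq_bigr => b ub.
  have [->//|ba] /= := eqVneq b a; rewrite /push_to Ca // wv.
  rewrite pullN ?nadj //; case: (pull a v) va => // _.
  by rewrite sub_add //; case: (s) => /=; rewrite ?opprK.
have sgE x : signed s x = (-1) ^+ s * x :> k.
  by rewrite mulr_sign; case: (s).
rewrite /koszul_diff sgE mulr_sumr [X in _ + X](bigD1 a) /=; last first.
  by rewrite mnmDE mnm1E eqxx addn1.
have := alternating_pull [::] (galt u) wv; rewrite !cat0s => ->.
rewrite addmK sgE addrCA -[RHS]addr0; congr (_ + _).
rewrite sumrN addrC; apply/eqP; rewrite subr_eq0; apply/eqP.
apply: eq_big => [b|b _]; last by rewrite sgE.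
have [->|ba] := eqVneq b a; first by rewrite !andbF.
by rewrite !andbT mnmDE mnm1E [a == b]eq_sym (negPf ba) addn0.
Qed.

End Homotopy.
End AlternatingFunctions.

(** * The edge ring *)
Section EdgeRing.
Variables (k : fieldType) (n : nat) (E : rel 'I_n).
Hypothesis Eirr : irreflexive E.
Local Notation R := (edge_ring k E).
Local Notation poly := {mpoly k[n]}.

Definition residue : {rmorphism poly -> R} := \pi_({ideal_quot (@edge_ideal k n E)})%qT.

Lemma residue_surj (r : R) : exists p, r = residue p.
Proof. by exists (repr r); rewrite /residue /= reprK. Qed.

Lemma residue_eq0 p : (residue p = 0) <-> p \in @edge_ideal k n E.
Proof.
rewrite -(rmorph0 residue) -[p in p \in _]subr0 Quotient.idealrBE.
by split=> [/eqP|/eqP].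
Qed.

Lemma mcoeffMX_if (p : poly) m u :
  (p * 'X_[m])@_u = if (m <= u)%MM then p@_(u - m) else 0.
Proof.
case: ifP => [mu|mu]; first by rewrite -[in LHS](submK mu) addmC mcoeffMX.
rewrite {1}[p]mpolyE mulr_suml raddf_sum big1 //= => m' _.
rewrite -scalerAl -mpolyXD mcoeffZ mcoeffX; case: eqP => [e|_]; rewrite ?mulr0 //.
by rewrite -e lem_addl in mu.
Qed.

Lemma edge_ideal_coef p u : p \in @edge_ideal k n E -> indep E u -> p@_u = 0.
Proof.
move=> /edge_idealP[c ->] /indepP iu.
rewrite raddf_sum big1 //= => i _; rewrite raddf_sum big1 //= => j Eij.
rewrite -mpolyXD mcoeffMX_if; case: ifP => // /mnm_lepP le; exfalso.
have := iu _ _ Eij; have := le i; have := le j; rewrite !mnmDE !mnm1E !eqxx.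
by case: (u i) => [|a]; case: (u j) => [|b]; rewrite ?addn1 ?add1n.
Qed.

Lemma nonindep_residue u : ~~ indep E u -> residue 'X_[u] = 0.
Proof.
rewrite /indep negb_forall => /existsP[i]; rewrite negb_forall => /existsP[j].
rewrite negb_imply negb_or => /and3P[Eij ui uj]; apply/residue_eq0/edge_idealP.
have ij : i != j by apply: contraTneq Eij => ->; rewrite Eirr.
have le : (U_(i) + U_(j) <= u)%MM.
  apply/mnm_lepP => l; rewrite mnmDE !mnm1E.
  have [il|_] := eqVneq i l; last by have [<-|] := eqVneq j l; rewrite ?lt0n.
  by rewrite -il eq_sym (negPf ij) addn0 lt0n.
exists (fun i' j' => if (i' == i) && (j' == j) then 'X_[u - (U_(i) + U_(j))] else 0).
rewrite (bigD1 i) //= (bigD1 j) //= !eqxx -!mpolyXD submK //.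
rewrite big1 ?addr0 => [|j' /andP[_ /negPf ->]]; last by rewrite mul0r.
rewrite big1 ?addr0 // => i' /negPf ->.
by rewrite big1 // => j' _; rewrite mul0r.
Qed.

(** The coordinates of an element of R in the basis of monomials with independent
    support. *)
Definition coefR (u : 'X_{1..n}) (r : R) : k :=
  if indep E u then (repr r)@_u else 0.

Lemma coefR_residue p u : indep E u -> coefR u (residue p) = p@_u.
Proof.
move=> iu; rewrite /coefR iu; apply/eqP; rewrite -subr_eq0 -mcoeffB; apply/eqP.
apply: edge_ideal_coef iu; apply/residue_eq0.
by rewrite rmorphB /residue /= reprK subrr.
Qed.

Lemma coefR_nonindep r u : ~~ indep E u -> coefR u r = 0.
Proof. by rewrite /coefR => /negPf ->. Qed.

Lemma coefRB r s u : coefR u (r - s) = coefR u r - coefR u s.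
Proof.
have [iu|iu] := boolP (indep E u); last by rewrite !coefR_nonindep ?subr0.
have [p ->] := residue_surj r; have [q ->] := residue_surj s.
by rewrite -rmorphB !coefR_residue // mcoeffB.
Qed.
HB.instance Definition _ u :=
  GRing.isZmodMorphism.Build R k (coefR u) (fun r s => coefRB r s u).

Lemma coefR_inj r s : (forall u, indep E u -> coefR u r = coefR u s) -> r = s.
Proof.
move=> rs; apply/eqP; rewrite -subr_eq0; apply/eqP.
have {rs} : forall u, indep E u -> coefR u (r - s) = 0.
  by move=> u iu; rewrite coefRB rs // subrr.
have [p ->] := residue_surj (r - s) => p0.
rewrite [p]mpolyE rmorph_sum big1 // => u _; rewrite -mul_mpolyC rmorphM.
have [iu|iu] := boolP (indep E u); last by rewrite nonindep_residue // mulr0.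
by rewrite -(coefR_residue p iu) p0 // mpolyC0 rmorph0 mul0r.
Qed.

Definition constR : {rmorphism k -> R} := residue \o (@mpolyC n k).

Lemma coefR_const c r u : coefR u (constR c * r) = c * coefR u r.
Proof.
have [iu|iu] := boolP (indep E u); last by rewrite !coefR_nonindep ?mulr0.
have [p ->] := residue_surj r.
by rewrite /constR /= -rmorphM !coefR_residue // mcoeffCM.
Qed.

Lemma indep_sub u v : indep E u -> indep E (u - v)%MM.
Proof.
move=> /indepP iu; apply/indepP => i j /iu; rewrite !mnmBE.
by case/orP => /eqP ->; rewrite sub0n eqxx ?orbT.
Qed.

Lemma coefR_var a r u : indep E u ->
  coefR u (@edge_ring_var k n E a * r) = if u a != 0%N then coefR (u - U_(a))%MM r else 0.
Proof.
move=> iu; have [p ->] := residue_surj r.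
have -> : @edge_ring_var k n E a = residue 'X_a by [].
rewrite mulrC -rmorphM [LHS]coefR_residue // mcoeffMX_if lep1mP.
by case: ifP => // _; rewrite coefR_residue // indep_sub.
Qed.

Lemma indep0 : indep E 0%MM.
Proof. by apply/indepP => i j _; rewrite mnm0E. Qed.

(** The projection of R onto its residue field k. *)
Definition augR (r : R) : k := coefR 0%MM r.
Fact augR_zmod : zmod_morphism augR.
Proof. by move=> r s; rewrite /augR coefRB. Qed.
Fact augR_monoid : monoid_morphism augR.
Proof.
split=> [|r s]; first by rewrite /augR -(rmorph1 residue) coefR_residue ?mcoeff1 ?eqxx // indep0.
have [p ->] := residue_surj r; have [q ->] := residue_surj s.
by rewrite /augR -rmorphM !coefR_residue ?indep0 // (rmorphM (mcoeff 0%MM)).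
Qed.
HB.instance Definition _ := GRing.isZmodMorphism.Build R k augR augR_zmod.
HB.instance Definition _ := GRing.isMonoidMorphism.Build R k augR augR_monoid.

Lemma augR_const c : augR (constR c) = c.
Proof. by rewrite /augR -[constR c]mulr1 coefR_const -/(augR 1) rmorph1 mulr1. Qed.

Lemma augR_var a : augR (@edge_ring_var k n E a) = 0.
Proof. by rewrite /augR -[edge_ring_var k E a]mulr1 coefR_var ?indep0 // mnm0E eqxx. Qed.

Lemma augR_eq0 r : augR r = 0 -> exists u, r = \sum_a u a * @edge_ring_var k n E a.
Proof.
have [p ->] := residue_surj r; rewrite /augR coefR_residue ?indep0 // => p0.
suff [u ->] : exists u : 'I_n -> poly, p = \sum_a u a * 'X_a.
  exists (fun a => residue (u a)); rewrite rmorph_sum.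
  by apply: eq_bigr => a _; rewrite rmorphM.
rewrite [p]mpolyE; elim/big_rec: _ => [|m q _ [u ->]].
  by exists (fun=> 0); rewrite big1 // => a _; rewrite mul0r.
have [->|/eqP m0] := eqVneq m 0%MM; first by rewrite p0 scale0r add0r; exists u.
have /existsP[a ma] : [exists a, m a != 0%N].
  apply: contra_notT m0; rewrite negb_exists => /forallP no.
  by apply/mnmP => a; rewrite mnm0E; apply/eqP; have := no a; rewrite negbK.
exists (fun b => u b + (if b == a then p@_m *: 'X_[m - U_(a)] else 0)).
under [RHS]eq_bigr do rewrite mulrDl; rewrite big_split addrC; congr (_ + _).
rewrite (bigD1 a) //= eqxx big1 ?addr0 => [|b /negPf ->]; last by rewrite mul0r.
by rewrite -scalerAl -mpolyXD submK // lep1mP.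
Qed.

Lemma vars_independent (c : 'I_n -> R) :
  \sum_a c a * @edge_ring_var k n E a = 0 -> forall a, augR (c a) = 0.
Proof.
move=> e a; have iU : indep E U_(a)%MM.
  apply/indepP => i j; rewrite !mnm1E.
  have [<-|//] := eqVneq a i; have [<-|//] := eqVneq a j.
  by rewrite Eirr.
have Ua : (U_(a) - U_(a) = 0)%MM by apply/mnmP => i; rewrite mnmBE subnn mnm0E.
have := congr1 (coefR U_(a)%MM) e; rewrite /= raddf_sum raddf0.
rewrite (bigD1 a) //= mulrC coefR_var // mnm1E eqxx /= Ua big1 ?addr0 //.
by move=> b ba; rewrite mulrC coefR_var // mnm1E [a == b]eq_sym (negPf ba).
Qed.

End EdgeRing.

(** * The Koszul resolution *)
(** A maximal family of points and functions in V that are dual to each other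
    gives coordinates on V: a function vanishing at all the points, but not
    everywhere, would enlarge the family. *)
Lemma interpolation (k : fieldType) (X : finType) (V : (X -> k) -> Prop) :
  (forall c f g, V f -> V g -> V (fun x => c * f x + g x)) ->
  exists t (pt : 'I_t -> X) (phi : 'I_t -> X -> k),
    [/\ forall j, V (phi j), forall i j, phi i (pt j) = (i == j)%:R &
        forall f, V f -> forall x, f x = \sum_j f (pt j) * phi j x].
Proof.
move=> Vlin.
pose good t := exists (pt : 'I_t -> X) (phi : 'I_t -> X -> k),
  (forall j, V (phi j)) /\ (forall i j, phi i (pt j) = (i == j)%:R).
have good0 : exists t, `[< good t >].
  exists 0%N; apply/asboolP.
  by exists (fun i : 'I_0 => match notF (ltn_ord i) with end),
            (fun i : 'I_0 => match notF (ltn_ord i) with end); split; case.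
have good_le t : `[< good t >] -> (t <= #|X|)%N.
  move=> /asboolP[pt [phi [_ d]]]; rewrite -[t]card_ord.
  apply: (leq_card pt) => i j ij; apply/eqP.
  by have := d i j; rewrite -ij d eqxx; case: eqP => // _ /eqP; rewrite oner_eq0.
have Vsum t (phi : 'I_t -> X -> k) (c : 'I_t -> k) f : (forall j, V (phi j)) ->
    V f -> V (fun x => f x - \sum_j c j * phi j x).
  move=> Vphi Vf; have -> : (fun x => f x - \sum_j c j * phi j x) =
      (fun x => \sum_j (- c j) * phi j x + f x).
    apply/funext => x; rewrite addrC -sumrN; congr (_ + _).
    by apply: eq_bigr => j _; rewrite mulNr.
  move: (index_enum _) => s; elim: s => [|j s IH].
    have -> // : (fun x => \sum_(j <- [::]) - c j * phi j x + f x) = f.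
    by apply/funext => x; rewrite big_nil add0r.
  have -> : (fun x => \sum_(j <- j :: s) - c j * phi j x + f x) =
    (fun x => (- c j) * phi j x + (\sum_(j <- s) - c j * phi j x + f x)).
    by apply/funext => x; rewrite big_cons addrA.
  exact: Vlin.
case: (ex_maxnP good0 good_le) => t /asboolP[pt [phi [Vphi d]]] tmax.
exists t, pt, phi; split=> // f Vf x; apply/eqP; rewrite -subr_eq0; apply/negP => /negP nz.
pose h y := f y - \sum_j f (pt j) * phi j y.
have Vh : V h by apply: Vsum.
have hpt i : h (pt i) = 0.
  rewrite /h (bigD1 i) //= d eqxx mulr1 big1 ?addr0 ?subrr // => j ji.
  by rewrite d (negPf ji) mulr0.
(* Otherwise x and a multiple of h enlarge the family. *)
pose pt' (i : 'I_t.+1) := if unlift ord_max i is Some j then pt j else x.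
pose psi y := h y / h x.
have V0 : V (fun=> 0).
  have -> : (fun=> 0) = (fun y => (-1) * h y + h y) by apply/funext => y; rewrite mulN1r addNr.
  exact: Vlin.
have Vpsi : V psi.
  have -> : psi = (fun y => (h x)^-1 * h y + 0); last exact: Vlin.
  by apply/funext => y; rewrite addr0 mulrC.
pose phi' (i : 'I_t.+1) y :=
  if unlift ord_max i is Some j then (- phi j x) * psi y + phi j y else psi y.
suff /tmax : `[< good t.+1 >] by rewrite ltnn.
apply/asboolP; exists pt', phi'; split=> [i|i j]; rewrite /phi' /pt'.
  by case: unliftP => [j _|_] //; apply: Vlin.
have psix : psi x = 1 by rewrite /psi divff.
have psipt l : psi (pt l) = 0 by rewrite /psi hpt mul0r.
case: unliftP => [i' ->|->]; case: unliftP => [j' ->|->].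
- by rewrite psipt mulr0 add0r d (inj_eq lift_inj).
- by rewrite psix mulr1 addNr eq_sym (negPf (neq_lift _ _)).
- by rewrite psipt (negPf (neq_lift _ _)).
by rewrite psix eqxx.
Qed.

Section KoszulResolution.
Variables (k : fieldType) (n : nat) (E : rel 'I_n).
Hypotheses (Esym : ssrbool.symmetric E) (Eirr : irreflexive E).
Local Notation R := (edge_ring k E).
Local Notation x := (@edge_ring_var k n E).
Local Notation word := (seq 'I_n).

(** Coordinates on alternating functions on words of length i.  They are values at
    certain words, so that they make sense for functions with values in R too. *)
Record alt_basis i := AltBasis {
  rk : nat;
  bword : 'I_rk -> word;
  bfun : 'I_rk -> word -> k;
  size_bword : forall j, size (bword j) = i;
  alternating_bfun : forall j, alternating E (bfun j);
  bfun_bword : forall j l, bfun j (bword l) = (j == l)%:R;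
  alternating_interp : forall f, alternating E f -> forall v, size v = i ->
    f v = \sum_j f (bword j) * bfun j v }.

Lemma alternating_basis i : exists B : alt_basis i, True.
Proof.
pose V (f : i.-tuple 'I_n -> k) := exists g, alternating E g /\ forall v, f v = g v.
have [|t [pt [phi [Vphi d int]]]] := interpolation (V := V).
  move=> c f g [f' [[f1 f2] fe]] [g' [[g1 g2] ge]].
  exists (fun v => c * f' v + g' v); split=> [|v]; last by rewrite fe ge.
  split=> [p q a|p q a b ab Eab]; first by rewrite f1 g1 mulr0 addr0.
  by rewrite f2 // g2 // mulrN opprD.
have /choice[psi psiP] := Vphi.
suff B : alt_basis i by exists B.
exists t (fun j => tval (pt j)) psi => [j|j|j l|f falt v vi].
- exact: size_tuple.
- by have [] := psiP j.
- by have [_ <-] := psiP j.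
pose v' := Tuple (introT eqP vi); rewrite -[v]/(tval v').
rewrite (int (fun v : i.-tuple 'I_n => f v)); last by exists f.
by apply: eq_bigr => j _; have [_ ->] := psiP j.
Qed.

Arguments bword {i} a.
Arguments bfun {i} a.
Arguments alternating_bfun {i} a.

Definition basis i : alt_basis i := projT1 (cid (alternating_basis i)).
Local Notation t i := (rk (basis i)).
Local Notation w_ i := (bword (basis i)).
Local Notation phi i := (bfun (basis i)).

(** The matrix of the map that sends f to the function w |-> sum_a x_a f(a w). *)
Definition koszul_mx i : 'M[R]_(t i.+1, t i) :=
  \matrix_(j, l) \sum_a x a * constR k E (phi i.+1 j (a :: w_ i l)).

(** The R-valued alternating function with coordinates v. *)
Definition altR i (v : 'rV[R]_(t i)) (w : word) : R :=
  \sum_j constR k E (phi i j w) * v 0 j.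

Lemma altR_bword i (v : 'rV[R]_(t i)) l : altR v (w_ i l) = v 0 l.
Proof.
rewrite /altR (bigD1 l) //= bfun_bword eqxx rmorph1 mul1r big1 ?addr0 // => j jl.
by rewrite bfun_bword (negPf jl) rmorph0 mul0r.
Qed.

Lemma alternating_altR i (v : 'rV[R]_(t i)) : alternating E (altR v).
Proof.
split=> [p q a|p q a b ab Eab].
  rewrite /altR big1 // => j _; have [-> _] := alternating_bfun (basis i) j.
  by rewrite rmorph0 mul0r.
rewrite /altR -sumrN; apply: eq_bigr => j _.
by have [_ ->] := alternating_bfun (basis i) j; rewrite // rmorphN mulNr.
Qed.

Lemma coef_altR i (v : 'rV[R]_(t i)) u w :
  coefR u (altR v w) = \sum_j phi i j w * coefR u (v 0 j).
Proof. by rewrite raddf_sum; apply: eq_bigr => j _; rewrite /= coefR_const. Qed.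

Lemma alternating_coefR (G : word -> R) u :
  alternating E G -> alternating E (fun w => coefR u (G w)).
Proof.
move=> [G1 G2]; split=> [p q a|p q a b ab Eab]; first by rewrite G1 raddf0.
by rewrite G2 // raddfN.
Qed.

Lemma altR_interp i (G : word -> R) w : alternating E G -> size w = i ->
  G w = altR (\row_j G (w_ i j)) w.
Proof.
move=> Galt wi; apply: (coefR_inj Eirr) => u iu; rewrite coef_altR.
rewrite (alternating_interp (basis i) (alternating_coefR u Galt) wi).
by apply: eq_bigr => j _; rewrite mxE mulrC.
Qed.

Definition koszulR (G : word -> R) (w : word) : R := \sum_a x a * G (a :: w).

Lemma alternating_koszulR G : alternating E G -> alternating E (koszulR G).
Proof.
move=> [G1 G2]; split=> [p q a|p q a b ab Eab].
  by rewrite /koszulR big1 // => c _; rewrite (G1 (c :: p)) mulr0.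
rewrite /koszulR -sumrN; apply: eq_bigr => c _.
by rewrite (G2 (c :: p)) // mulrN.
Qed.

Lemma mul_koszul_mx i (v : 'rV[R]_(t i.+1)) l :
  (v *m koszul_mx i) 0 l = koszulR (altR v) (w_ i l).
Proof.
rewrite mxE /koszulR /altR; under eq_bigr do rewrite mxE mulr_sumr.
rewrite exchange_big; apply: eq_bigr => a _; rewrite mulr_sumr.
by apply: eq_bigr => j _; rewrite mulrCA [v 0 j * _]mulrC.
Qed.

Lemma altR_koszul_mx i (v : 'rV[R]_(t i.+1)) w : size w = i ->
  altR (v *m koszul_mx i) w = koszulR (altR v) w.
Proof.
move=> wi; rewrite (altR_interp (alternating_koszulR (alternating_altR v)) wi).
by congr (altR _ w); apply/rowP => l; rewrite mul_koszul_mx [in RHS]mxE.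
Qed.

Lemma antisym_sum0 (I : finType) (V : zmodType) (G : I -> I -> V) :
  (forall a, G a a = 0) -> (forall a b, a != b -> G a b = - G b a) ->
  \sum_a \sum_b G a b = 0.
Proof.
move=> G0 GN; pose r (a b : I) := (enum_rank a < enum_rank b)%N.
have G3 a b : G a b = (if r a b then G a b else 0) - (if r b a then G b a else 0).
  rewrite /r; case: ltngtP => [_|_|/val_inj/enum_rank_inj ->].
  - by rewrite subr0.
  - rewrite sub0r; have [->|/GN//] := eqVneq a b; by rewrite G0 oppr0.
  by rewrite G0 subr0.
under eq_bigr do under eq_bigr do rewrite G3.
under eq_bigr do rewrite sumrB.
by rewrite sumrB [X in _ - X]exchange_big subrr.
Qed.

Lemma edge_var_mul a b : E a b -> x a * x b = 0.
Proof.
move=> Eab; apply: (coefR_inj Eirr) => u iu; rewrite raddf0 coefR_var //.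
case: ifP => // ua; rewrite -[x b]mulr1 coefR_var ?indep_sub // mnmBE mnm1E.
have [ab|_] := eqVneq a b; first by rewrite ab Eirr in Eab.
by have := indepP _ _ iu _ _ Eab; rewrite (negPf ua) subn0 => /= ->.
Qed.

(** The terms of an edge a b vanish because x_a x_b = 0, and those of the words a b
    and b a cancel when a and b are not adjacent. *)
Lemma koszulR2 G w : alternating E G -> koszulR (koszulR G) w = 0.
Proof.
move=> [G1 G2]; rewrite /koszulR; under eq_bigr do rewrite mulr_sumr.
apply: antisym_sum0 => [a|a b ab]; first by rewrite (G1 [::]) !mulr0.
rewrite !mulrA; have [Eab|Eab] := boolP (E a b).
  by rewrite !edge_var_mul ?mul0r ?oppr0 // Esym.
by rewrite (G2 [::] w a b ab Eab) /= mulrN opprK [x b * _]mulrC.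
Qed.

Lemma koszul_mx2 i : koszul_mx i.+1 *m koszul_mx i = 0.
Proof.
apply/row_matrixP => j; rewrite row_mul row0; apply/rowP => l.
rewrite mul_koszul_mx mxE; set v := row _ _.
have -> : v = delta_mx 0 j *m koszul_mx i.+1 by rewrite -rowE.
rewrite -[RHS](koszulR2 (w_ i l) (alternating_altR (delta_mx 0 j))).
apply: eq_bigr => a _; congr (_ * _); apply: altR_koszul_mx.
by rewrite /= size_bword.
Qed.

Lemma htpy_neq0 (g : word -> 'X_{1..n} -> k) w u : koszul_htpy E g w u != 0 ->
  exists a v, size w = (size v).+1 /\ g v (u + U_(a))%MM != 0.
Proof.
rewrite /koszul_htpy; case: pickP => [a _|_]; last by rewrite eqxx.
rewrite /push_to; case e: pull => [[s v]|]; last by rewrite eqxx.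
case: ifP => _; first by rewrite eqxx.
move=> h; exists a, v; rewrite (size_pull e); split=> //.
by move: h; rewrite /signed; case: ifP => _; rewrite ?oppr_eq0.
Qed.

Lemma movable_indep u w a : indep E u -> movable E u w a ->
  indep E (u + U_(a))%MM.
Proof.
move=> iu ma; have nadj c : u c != 0%N -> ~~ E a c.
  move=> uc; case/orP: ma => [ua|/andP[_ /forallP/(_ c)/implyP]]; last exact.
  by apply: contraL uc => /(indepP _ _ iu); rewrite (negPf ua) /= negbK.
apply/indepP => b c; rewrite !mnmDE !mnm1E.
have [->|ab] := eqVneq b a; have [->|ac] := eqVneq c a; rewrite ?eqxx /=.
- by rewrite Eirr.
- rewrite !addn0 => /(contraL (nadj c)).
  by rewrite negbK => ->; rewrite orbT.
- rewrite Esym !addn0 => /(contraL (nadj b)).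
  by rewrite negbK => ->.
rewrite !addn0.
exact: (indepP _ _ iu).
Qed.

Lemma homotopy_exact i (g : word -> 'X_{1..n} -> k) :
  (forall u, alternating E (g^~ u)) ->
  (forall w u, size w != i -> g w u = 0) ->
  (forall w u, indep E u -> koszul_diff g w u = 0) ->
  (i = 0%N -> g [::] 0%MM = 0) ->
  forall w u, indep E u -> g w u = koszul_diff (koszul_htpy E g) w u.
Proof.
move=> galt gi dg g0 w u iu; have [wu|] := boolP ((w != [::]) || (u != 0%MM)).
  rewrite -[LHS](koszul_homotopy Esym galt iu wu) -[RHS]addr0; congr (_ + _).
  rewrite /koszul_htpy; case: pickP => [a ma|//].
  rewrite /push_to; case e: pull => [[s v]|//]; case: ifP => // _.
  rewrite dg; last exact: movable_indep ma.
  by case: (s); rewrite /= ?oppr0.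
rewrite negb_or !negbK => /andP[/eqP -> /eqP ->].
rewrite /koszul_diff big_pred0 => [|b]; last by rewrite mnm0E eqxx.
by case: (posnP i) => [/g0 //|i0]; apply: gi; rewrite eq_sym -lt0n.
Qed.

(** The bound on degrees makes the coefficients h w those of a polynomial. *)
Lemma lift_coef i K (h : word -> 'X_{1..n} -> k) :
  (forall u, alternating E (h^~ u)) ->
  (forall w u, (K <= mdeg u)%N -> h w u = 0) ->
  exists v : 'rV[R]_(t i), forall w u, size w = i -> indep E u ->
    coefR u (altR v w) = h w u.
Proof.
move=> halt hK.
pose G w : R := residue k E (\sum_(m : 'X_{1..n < K}) h w m *: 'X_[m]).
have GP w u : indep E u -> coefR u (G w) = h w u.
  move=> iu; rewrite coefR_residue // raddf_sum /=.
  have [uK|Ku] := ltnP (mdeg u) K.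
    rewrite (bigD1 (BMultinom uK)) //= mcoeffZ mcoeffX eqxx mulr1 big1 ?addr0 // => m.
    rewrite -val_eqE /= => mu.
    by rewrite mcoeffZ mcoeffX (negPf mu) mulr0.
  rewrite hK // big1 // => m _; rewrite mcoeffZ mcoeffX; case: eqP => [e|_].
    by have := bmdeg m; rewrite e ltnNge Ku.
  by rewrite mulr0.
exists (\row_j G (w_ i j)) => w u wi iu; rewrite coef_altR.
rewrite (alternating_interp (basis i) (halt u) wi).
by apply: eq_bigr => j _; rewrite mxE GP // mulrC.
Qed.

Lemma koszul_mx_exact i (v : 'rV[R]_(t i)) :
  (forall w, (size w).+1 = i -> koszulR (altR v) w = 0) ->
  (i = 0%N -> augR (altR v [::]) = 0) ->
  exists u, v = u *m koszul_mx i.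
Proof.
move=> dv v0.
pose g w u := if size w == i then coefR u (altR v w) else 0.
have galt u : alternating E (g^~ u).
  have [g1 g2] := alternating_coefR u (alternating_altR v).
  split=> [p q a|p q a b ab Eab]; rewrite /g; first by rewrite g1 if_same.
  by rewrite !size_cat /= g2 //; case: ifP => _; rewrite ?oppr0.
have dg w u : indep E u -> koszul_diff g w u = 0.
  move=> iu; have [wi|wi] := eqVneq (size w).+1 i; last first.
    by rewrite /koszul_diff big1 // => b _; rewrite /g /= (negPf wi).
  have := congr1 (coefR u) (dv w wi); rewrite raddf0 raddf_sum => <-.
  rewrite /koszul_diff big_mkcond; apply: eq_bigr => b _ /=.
  by rewrite coefR_var // /g /= wi eqxx.
have gi w u : size w != i -> g w u = 0 by rewrite /g => /negPf ->.
have g0 : i = 0%N -> g [::] 0%MM = 0.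
  by move=> i0; rewrite /g; case: ifP => // _; apply: v0.
have ex := homotopy_exact galt gi dg g0.
pose K := \max_j msize (repr (v 0%R j)).
have gK w u : (K <= mdeg u)%N -> g w u = 0.
  move=> Ku; rewrite /g; case: ifP => // _; rewrite coef_altR big1 // => j _.
  rewrite /coefR; case: ifP => _; rewrite ?mulr0 //.
  have -> : (repr (v 0 j))@_u = 0; last by rewrite mulr0.
  apply/eqP; rewrite mcoeff_eq0; apply: contraL Ku => /msize_mdeg_lt lt.
  rewrite -ltnNge; apply: leq_trans lt _.
  exact: (leq_bigmax (F := fun j => msize (repr (v 0%R j)))).
have hK w u : (K <= mdeg u)%N -> koszul_htpy E g w u = 0.
  move=> Ku; apply/eqP/negPn/negP => /htpy_neq0[a [w' [_ /eqP]]]; apply.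
  by apply: gK; apply: leq_trans Ku _; rewrite mdegD leq_addr.
have [u uP] := lift_coef i.+1 (fun u => alternating_htpy Esym u galt) hK.
exists u; apply/rowP => l; rewrite mul_koszul_mx -altR_bword.
apply: (coefR_inj Eirr) => m im; rewrite [RHS]raddf_sum.
have := ex (w_ i l) m im; rewrite {1}/g size_bword eqxx => ->.
rewrite /koszul_diff big_mkcond; apply: eq_bigr => b _ /=; rewrite coefR_var //.
by case: ifP => // mb; rewrite uP ?indep_sub //= size_bword.
Qed.

Lemma koszul_resolution :
  free_resolution (@augR k n E) koszul_mx (\col_j phi 0 j [::]).
Proof.
split.
- pose f (w : word) : k := (size w == 0%N)%:R.
  have falt : alternating E f.
    by split=> [p q a|p q a b _ _]; rewrite /f !size_cat !addnS ?oppr0.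
  exists (\row_j constR k E (f (w_ 0%N j))); apply/matrixP => i j; rewrite !ord1 !mxE eqxx.
  have := alternating_interp (basis 0) falt (erefl (size [::])); rewrite {1}/f => ->.
  by apply: eq_bigr => l _; rewrite !mxE /= augR_const.
- move=> v.
  have -> : (map_mx (@augR k n E) v *m \col_j phi 0 j [::] = 0) <->
      augR (altR v [::]) = 0.
    have -> : map_mx (@augR k n E) v *m \col_j phi 0 j [::] =
        (augR (altR v [::]))%:M.
      apply/matrixP => i j; rewrite !ord1 !mxE eqxx mulr1n raddf_sum.
      by apply: eq_bigr => l _; rewrite !mxE /= rmorphM /= augR_const mulrC.
    split=> [/matrixP/(_ 0 0)|->]; first by rewrite !mxE eqxx mulr1n.
    by apply/matrixP => i j; rewrite !mxE mul0rn.
  split=> [v0|[u ->]]; first exact: koszul_mx_exact.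
  rewrite altR_koszul_mx // /koszulR raddf_sum big1 // => a _.
  by rewrite /= rmorphM /= augR_var mul0r.
- exact: koszul_mx2.
move=> i v vD; apply: koszul_mx_exact => // w [wi].
by rewrite -altR_koszul_mx // vD /altR big1 // => j _; rewrite mxE mulr0.
Qed.

Lemma koszul_mx_minimal i : map_mx (@augR k n E) (koszul_mx i) = 0.
Proof.
apply/matrixP => j l; rewrite !mxE raddf_sum big1 // => a _.
by rewrite /= rmorphM /= augR_var mul0r.
Qed.

End KoszulResolution.
Arguments bword {k n E i} a.
Arguments bfun {k n E i} a.

(** * Euler characteristics of the strands *)
Section Strands.
Variables (k : fieldType) (n : nat) (E : rel 'I_n).
Hypotheses (Esym : ssrbool.symmetric E) (Eirr : irreflexive E).
Local Notation R := (edge_ring k E).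
Local Notation t i := (rk (basis k E i)).
Local Notation D i := (koszul_mx k E i).

Definition indep_monomials j : seq 'X_{1..n} :=
  [seq bmnm u | u <- enum [pred u : 'X_{1..n < j.+1} | (mdeg u == j) && indep E u]].

Lemma mem_indep_monomials j u :
  (u \in indep_monomials j) = (mdeg u == j) && indep E u.
Proof.
apply/mapP/idP => [[v]|h]; first by rewrite mem_enum => h ->.
have lt : (mdeg u < j.+1)%N by case/andP: h => /eqP ->.
by exists (BMultinom lt) => //; rewrite mem_enum.
Qed.

Variable p : nat.

(** In homological degree i, the part of internal degree p of the Koszul resolution
    has a basis formed by the pairs of a basis function on words of length i and a
    monomial of degree p - i. *)
Definition strand_index i : seq ('I_(t i) * 'X_{1..n}) :=
  [seq (l, u) | l <- enum 'I_(t i), u <- indep_monomials (p - i)].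

Lemma uniq_strand_index i : uniq (strand_index i).
Proof.
apply: allpairs_uniq; first exact: enum_uniq.
  by rewrite map_inj_uniq ?enum_uniq // => u v /val_inj.
by move=> [a b] [c d] _ _ [-> ->].
Qed.

Lemma size_strand_index i : size (strand_index i) = (t i * hilbert E (p - i))%N.
Proof. by rewrite size_allpairs size_enum_ord size_map -cardE. Qed.

Lemma mem_strand_index i l u :
  ((l, u) \in strand_index i) = (mdeg u == (p - i)%N) && indep E u.
Proof.
rewrite -mem_indep_monomials; apply/allpairsP/idP => [[[a b] [_ /= h [_ ->]]] //|h].
by exists (l, u); rewrite mem_enum.
Qed.

Local Notation T i := (seq_sub (strand_index i)).
Local Notation N i := #|{: T i}|.

Definition proj_strand i (V : 'rV[R]_(t i)) : 'rV[k]_(N i) :=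
  \row_y coefR (val (enum_val y)).2 (V 0 (val (enum_val y)).1).

Definition strand_coef i (v : 'rV[k]_(N i)) (l : 'I_(t i)) u : k :=
  if insub (l, u) is Some y then v 0 (enum_rank (y : T i)) else 0.

Definition lift_strand i (v : 'rV[k]_(N i)) : 'rV[R]_(t i) :=
  \row_l residue k E (\sum_(u <- indep_monomials (p - i)) strand_coef v l u *: 'X_[u]).

Lemma coef_lift_strand i v l u : indep E u ->
  coefR u (@lift_strand i v 0 l) = strand_coef v l u.
Proof.
move=> iu; rewrite mxE coefR_residue // raddf_sum /=.
have un : uniq (indep_monomials (p - i)).
  by rewrite map_inj_uniq ?enum_uniq // => a b /val_inj.
have [h|h] := boolP (u \in indep_monomials (p - i)).
  rewrite (bigD1_seq u) //= mcoeffZ mcoeffX eqxx mulr1 big1 ?addr0 // => m mu.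
  by rewrite mcoeffZ mcoeffX (negPf mu) mulr0.
rewrite big1_seq => [|m /andP[_ hm]].
  rewrite /strand_coef insubF // mem_strand_index -mem_indep_monomials.
  exact: negbTE.
rewrite mcoeffZ mcoeffX; case: eqP => [e|_]; rewrite ?mulr0 //.
by rewrite -e hm in h.
Qed.

Lemma strand_coef_deg i v l u : mdeg u != (p - i)%N -> @strand_coef i v l u = 0.
Proof. by move=> h; rewrite /strand_coef insubF // mem_strand_index (negPf h). Qed.

Lemma proj_liftK i v : proj_strand (@lift_strand i v) = v.
Proof.
apply/rowP => y; rewrite mxE coef_lift_strand; last first.
  by have := valP (enum_val y); case: (val _) => l u; rewrite mem_strand_index => /andP[].
rewrite /strand_coef -surjective_pairing; case: insubP => [z _ zy|].
  by rewrite (val_inj zy) enum_valK.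
by rewrite (valP (enum_val y)).
Qed.

Lemma eq_proj_strand i (V W : 'rV[R]_(t i)) :
  (forall l u, indep E u -> mdeg u = (p - i)%N -> coefR u (V 0 l) = coefR u (W 0 l)) ->
  proj_strand V = proj_strand W.
Proof.
move=> VW; apply/rowP => y; rewrite !mxE.
have := valP (enum_val y); case: (val _) => l u; rewrite mem_strand_index.
by case/andP => /eqP du iu; apply: VW.
Qed.

Lemma coef_strand_coef i (V : 'rV[R]_(t i)) l u : indep E u -> mdeg u = (p - i)%N ->
  strand_coef (proj_strand V) l u = coefR u (V 0 l).
Proof.
move=> iu du; rewrite /strand_coef; case: insubP => [z _ zy|].
  by rewrite mxE enum_rankK zy.
by rewrite mem_strand_index du iu eqxx.
Qed.

Lemma coef_mul_koszul i (V : 'rV[R]_(t i.+1)) l u : indep E u ->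
  coefR u ((V *m D i) 0 l) = \sum_(a | u a != 0%N)
     \sum_j bfun (basis k E i.+1) j (a :: bword (basis k E i) l) *
        coefR (u - U_(a))%MM (V 0 j).
Proof.
move=> iu; rewrite mul_koszul_mx raddf_sum [RHS]big_mkcond; apply: eq_bigr => a _ /=.
by rewrite coefR_var //; case: ifP => // _; rewrite coef_altR.
Qed.

Lemma mdeg_sub1 (u : 'X_{1..n}) a : u a != 0%N -> mdeg u = (mdeg (u - U_(a))%MM).+1.
Proof. by move=> ua; rewrite -{1}(@submK _ U_(a)%MM u) ?lep1mP // mdegD mdeg1 addn1. Qed.

(** The strand is a direct summand of the resolution over k, via lift_strand and
    proj_strand; its exactness is inherited from the resolution. *)
Definition strand_diff i (v : 'rV[k]_(N i.+1)) : 'rV[k]_(N i) :=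
  proj_strand (lift_strand v *m D i).

Lemma lift_strand_linear i a (v w : 'rV[k]_(N i)) :
  lift_strand (a *: v + w) = constR k E a *: lift_strand v + lift_strand w.
Proof.
apply/rowP => l; apply: (coefR_inj Eirr) => u iu.
rewrite coef_lift_strand // !mxE raddfD /= coefR_const.
have := coef_lift_strand v l iu; rewrite mxE => ->.
have := coef_lift_strand w l iu; rewrite mxE => ->.
by rewrite /strand_coef; case: insub => [y|]; rewrite ?mxE // mulr0 addr0.
Qed.

Lemma strand_diff_linear i : linear (@strand_diff i).
Proof.
move=> a v w; rewrite /strand_diff lift_strand_linear mulmxDl -scalemxAl.
move: (lift_strand v *m _) (lift_strand w *m _) => P Q.
by apply/rowP => y; rewrite !mxE raddfD /= coefR_const.
Qed.
HB.instance Definition _ i := GRing.isLinear.Build k 'rV[k]_(N i.+1) 'rV[k]_(N i)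
  *:%R (@strand_diff i) (@strand_diff_linear i).

Lemma proj_mul_koszul i (V : 'rV[R]_(t i.+1)) : (i < p)%N ->
  proj_strand (V *m D i) = strand_diff (proj_strand V).
Proof.
move=> ip; apply: eq_proj_strand => l u iu du; rewrite !coef_mul_koszul //.
apply: eq_bigr => a ua; apply: eq_bigr => j _; congr (_ * _).
rewrite coef_lift_strand ?indep_sub // coef_strand_coef ?indep_sub //.
by move: du; rewrite (mdeg_sub1 ua) -(subnSK ip) => -[].
Qed.

Lemma lift_strand_diff i (v : 'rV[k]_(N i.+1)) : (i < p)%N ->
  lift_strand (strand_diff v) = lift_strand v *m D i.
Proof.
move=> ip; apply/rowP => l; apply: (coefR_inj Eirr) => u iu.
rewrite coef_lift_strand //; have [du|du] := eqVneq (mdeg u) (p - i)%N.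
  by rewrite coef_strand_coef.
rewrite strand_coef_deg // coef_mul_koszul // big1 // => a ua.
rewrite big1 // => j _; rewrite coef_lift_strand ?indep_sub //.
rewrite strand_coef_deg ?mulr0 //; apply: contra_neq du => e.
by rewrite (mdeg_sub1 ua) e subnSK.
Qed.

Lemma coef0_koszul i (V : 'rV[R]_(t i.+1)) l : coefR 0%MM ((V *m D i) 0 l) = 0.
Proof.
rewrite coef_mul_koszul; last exact: indep0.
by rewrite big_pred0 // => a; rewrite mnm0E eqxx.
Qed.

Lemma strand_diff_surj (v : 'rV[k]_(N 0)) : (0 < p)%N -> exists u, v = strand_diff u.
Proof.
move=> p0; have [||U UP] := @koszul_mx_exact k n E Esym Eirr 0 (lift_strand v).
- by [].
- move=> _; rewrite raddf_sum big1 // => j _; rewrite /= rmorphM /= /augR.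
  rewrite coef_lift_strand ?strand_coef_deg ?mulr0 //; last exact: indep0.
  by rewrite mdeg0 subn0 eq_sym -lt0n.
by exists (proj_strand U); rewrite -proj_mul_koszul // -UP proj_liftK.
Qed.

Lemma strand_diff_lift i (v : 'rV[k]_(N i.+1)) : (i < p)%N -> strand_diff v = 0 ->
  exists U, lift_strand v = U *m D i.+1.
Proof.
move=> ip dv; apply: koszul_mx_exact => // w [wi].
rewrite -altR_koszul_mx // -lift_strand_diff // dv /altR big1 // => j _.
have -> : lift_strand (0 : 'rV[k]_(N i)) = 0; last by rewrite mxE mulr0.
have := lift_strand_linear 0 (0 : 'rV[k]_(N i)) 0.
by rewrite scale0r addr0 rmorph0 scale0r add0r => h;
  have := lift_strand_linear (-1) (0 : 'rV[k]_(N i)) 0;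
  rewrite scaler0 addr0 rmorphN rmorph1 scaleN1r addNr.
Qed.

Lemma strand_diff2 i (v : 'rV[k]_(N i.+2)) : (i.+1 < p)%N ->
  strand_diff (strand_diff v) = 0.
Proof.
move=> ip; rewrite {1}/strand_diff lift_strand_diff // -mulmxA koszul_mx2 // mulmx0.
by apply/rowP => y; rewrite !mxE raddf0.
Qed.

Lemma strand_rank_step i : (i.+1 < p)%N ->
  N i.+1 = (\rank (lin1_mx (@strand_diff i)) + \rank (lin1_mx (@strand_diff i.+1)))%N.
Proof.
move=> ip; have ip' := ltnW ip.
have -> : \rank (lin1_mx (@strand_diff i.+1)) =
    \rank (kermx (lin1_mx (@strand_diff i))).
  apply/eqP; rewrite eqn_leq; apply/andP; split; apply: mxrankS.
    apply/sub_kermxP/row_matrixP => j; rewrite row_mul mul_rV_lin1 rowE mul_rV_lin1 row0 /=.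
    exact: strand_diff2.
  apply/row_subP => j; set v := row _ _.
  have /eqP : v *m lin1_mx (@strand_diff i) = 0.
    by apply/sub_kermxP; exact: row_sub.
  rewrite mul_rV_lin1 => /eqP/(strand_diff_lift ip')[U UP].
  apply/submxP; exists (proj_strand U).
  by rewrite mul_rV_lin1 /= -proj_mul_koszul // -UP proj_liftK.
by rewrite mxrank_ker subnKC // rank_leq_row.
Qed.

Lemma strand_rank_last i : p = i.+1 ->
  N i.+1 = \rank (lin1_mx (@strand_diff i)).
Proof.
move=> pi; suff : kermx (lin1_mx (@strand_diff i)) = 0.
  move=> k0; have := mxrank_ker (lin1_mx (@strand_diff i)).
  rewrite k0 mxrank0 => /esym/eqP; rewrite subn_eq0 => le.
  by apply/eqP; rewrite eqn_leq le rank_leq_row.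
apply/row_matrixP => j; rewrite row0; set v := row _ _.
have /eqP : v *m lin1_mx (@strand_diff i) = 0.
  by apply/sub_kermxP; exact: row_sub.
rewrite mul_rV_lin1 => /eqP/strand_diff_lift[|U UP]; first by rewrite pi.
rewrite -(proj_liftK v) UP -[RHS](proj_liftK 0); apply: eq_proj_strand => l u iu.
rewrite pi subnn => /eqP; rewrite mdeg_eq0 => /eqP ->.
rewrite coef0_koszul coef_lift_strand; last exact: indep0.
by rewrite /strand_coef; case: insub => // y; rewrite mxE.
Qed.

Lemma strand_rank0 : (0 < p)%N -> N 0 = \rank (lin1_mx (@strand_diff 0)).
Proof.
move=> p0; apply/esym/eqP; rewrite -/(row_full _) -sub1mx; apply/row_subP => j.
have [u uP] := strand_diff_surj (row j 1%:M) p0.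
by rewrite uP -[strand_diff u](mul_rV_lin1 (@strand_diff 0)) submxMl.
Qed.

Lemma card_strand i : N i = (t i * hilbert E (p - i))%N.
Proof. by rewrite card_seq_sub ?uniq_strand_index // size_strand_index. Qed.

(** Rank and nullity along an exact sequence; the sum telescopes. *)
Lemma strand_euler : (0 < p)%N ->
  \sum_(i < p.+1) (-1) ^+ i * (t i * hilbert E (p - i))%N%:R = 0 :> int.
Proof.
move=> p0; pose r i := \rank (lin1_mx (@strand_diff i)).
under eq_bigr do rewrite -card_strand.
have partial j : (j < p)%N ->
    \sum_(i < j.+1) (-1) ^+ i * (N i)%:R = (-1) ^+ j * (r j)%:R :> int.
  elim: j => [|j IH] jp; first by rewrite big_ord1 (strand_rank0 p0).
  rewrite big_ord_recr /= IH ?(ltnW jp) // strand_rank_step // natrD exprS.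
  by rewrite -/(r j) -/(r j.+1); ring.
have [q e] : exists q, p = q.+1 by exists p.-1; rewrite prednK.
have -> : \sum_(i < p.+1) (-1) ^+ i * (N i)%:R =
    \sum_(i < q.+2) (-1) ^+ i * (N i)%:R :> int.
  have F m : \sum_(i < m) (-1) ^+ i * (N i)%:R =
      \sum_(0 <= i < m) (-1) ^+ i * (N i)%:R :> int by rewrite big_mkord.
  by rewrite !F; congr (bigop.body _ (index_iota 0 _.+1) _).
rewrite big_ord_recr /= (strand_rank_last e) partial ?e // exprS.
by rewrite -/(r q); ring.
Qed.
End Strands.

(** * Deviations of paths and cycles *)
Section Assembly.
Variables (k : fieldType) (n : nat) (E : rel 'I_n).
Hypotheses (Esym : ssrbool.symmetric E) (Eirr : irreflexive E).
Variable eps : nat -> nat.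
Hypothesis epsP : is_edge_deviations k E eps.

(** Both resolutions of k are minimal. *)
Lemma betti_numbers p : size (basis_mons eps p) = rk (basis k E p).
Proof.
have [A clA] := epsP.
have surj (c : k) : exists r, @augR k n E r = c.
  by exists (constR k E c); rewrite augR_const.
have resA := @closure_resolution _ _ _ _ (@augR k n E) _ _ surj (@augR_var k n E)
  (@augR_eq0 k n E) (@vars_independent k n E Eirr) clA.
have minA := @closure_mx_minimal _ _ _ _ (@augR k n E) _ _ surj (@augR_var k n E)
  (@augR_eq0 k n E) (@vars_independent k n E Eirr) clA.
have resK := @koszul_resolution k n E Esym Eirr.
have minK := @koszul_mx_minimal k n E.
apply/eqP; rewrite eqn_leq; apply/andP; split.
  exact: (minimal_resolution_rank_le surj resA resK minA p).
exact: (minimal_resolution_rank_le surj resK resA minK p).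
Qed.

Lemma deviation0 : eps 0%N = 0%N.
Proof. by have [A _] := epsP; apply: (dgg_var0 A). Qed.

Lemma coef_mon_series N p : (p <= N)%N ->
  (mon_series N (vars eps N))`_p = (rk (basis k E p))%:R.
Proof.
move=> pN; rewrite coef_poly ltnS pN -betti_numbers; congr (_%:R).
have tv s : {in vars eps s, forall y : gvar eps, (0 < tag y)%N}.
  by move=> y _; apply: tag_gt0 deviation0.
apply/perm_size/uniq_perm.
- by apply: uniq_normal_mons; [exact: uniq_vars | exact: tv].
- by apply: uniq_normal_mons; [exact: uniq_vars | exact: tv].
move=> m; apply/idP/idP => /(mem_normal_mons _ _ (uniq_vars _ _) (tv _)) [nm sm dm];
  apply/(mem_normal_mons _ _ (uniq_vars _ _) (tv _)); split=> //; apply: supported_vars;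
  by rewrite dm.
Qed.

Lemma hilbert0 : hilbert E 0 = 1%N.
Proof.
rewrite /hilbert (@eq_card1 _ (BMultinom (_ : mdeg (0%MM : 'X_{1..n}) < 1)%N)) ?mdeg0 //.
move=> h u; rewrite !inE -val_eqE /= mdeg_eq0.
by case: eqP => [->|] //=; rewrite indep0.
Qed.

(** The identity P(z) H(-z) = 1: the coefficient in degree p > 0 is, up to sign, the
    Euler characteristic of the strand of degree p. *)
Lemma poincare_hilbert N (h : {poly int}) :
  (forall j, (j <= N)%N -> h`_j = (-1) ^+ j * (hilbert E j)%:R) ->
  trunc N (mon_series N (vars eps N) * h) = 1.
Proof.
move=> hP; rewrite -(rmorph1 (trunc N)); apply/trunc_eq => p; rewrite ltnS => pN.
have sign_sub (a b : nat) : (b <= a)%N -> (-1) ^+ (a - b) = (-1) ^+ a * (-1) ^+ b :> int.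
  by move=> ba; rewrite -{2}(subnK ba) exprD -mulrA -exprMn mulrNN mulr1 expr1n mulr1.
have -> : (mon_series N (vars eps N) * h)`_p =
    (-1) ^+ p * \sum_(i < p.+1) (-1) ^+ i * (rk (basis k E i) * hilbert E (p - i))%N%:R.
  rewrite coefM mulr_sumr; apply: eq_bigr => i _.
  have ip : (i <= p)%N by rewrite -ltnS.
  rewrite coef_mon_series ?(leq_trans ip) // hP; last first.
    by apply: leq_trans pN; apply: leq_subr.
  by rewrite natrM (sign_sub _ _ ip); ring.
rewrite coef1; case: p pN => [|p] pN; last by rewrite strand_euler // mulr0.
by rewrite big_ord1 !expr0 !mul1r subnn hilbert0 -betti_numbers;
  have [A _] := epsP; rewrite (basis_mons0 A).
Qed.

Lemma deviation_hilbert N (h : {poly int}) :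
  (forall j, (j <= N)%N -> h`_j = (-1) ^+ j * (hilbert E j)%:R) ->
  trunc N (even_prod 'X N.+1 eps) = trunc N (odd_prod 'X N.+1 eps * h).
Proof.
move=> /poincare_hilbert hP.
by rewrite rmorphM -(poincare_series _ deviation0) -rmorphM -mulrA rmorphM hP mulr1.
Qed.
End Assembly.

Lemma path_graph_sym n : ssrbool.symmetric (@path_graph n).
Proof. by move=> i j; rewrite /path_graph orbC. Qed.
Lemma path_graph_irr n : irreflexive (@path_graph n).
Proof. by move=> i; rewrite /path_graph; apply/negbTE; rewrite negb_or; lia. Qed.
Lemma cycle_graph_sym n : ssrbool.symmetric (@cycle_graph n).
Proof. by move=> i j; rewrite /cycle_graph path_graph_sym [X in _ || X]orbC. Qed.
Lemma cycle_graph_irr n : irreflexive (@cycle_graph n.+2).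
Proof.
move=> i; rewrite /cycle_graph path_graph_irr /=; apply/negbTE.
by rewrite negb_or; case: i => -[|i] ?.
Qed.

Theorem theorem2p6 (k : fieldType) :
  exists gamma alpha : nat -> nat, forall n : nat, (3 <= n)%N ->
    (forall eps : nat -> nat, is_edge_deviations k (@path_graph n) eps ->
       forall s : nat, (1 <= s <= n.+1)%N ->
         (eps s)%:Z = (gamma s)%:Z * n%:Z - (alpha s)%:Z) /\
    (forall eps : nat -> nat, is_edge_deviations k (@cycle_graph n) eps ->
       (forall s : nat, (1 <= s < n)%N ->
          (eps s)%:Z = (gamma s)%:Z * n%:Z) /\
       (eps n)%:Z = (gamma n)%:Z * n%:Z - 1).
Proof.
have [gamma [alpha pattern]] := deviation_pattern.
exists gamma, alpha => n n3; split=> eps epsP.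
  move=> s sn; pose N := n.+1.
  have [path_case _] := pattern N _ (path_series N.+1) eps
    (trunc_x (erefl N.+1)) (path_series0 N.+1) (path_series1 (ltn0Sn N))
    (path_seriesSS (ltn0Sn N)).
  suff e : (eps s + alpha s = gamma s * n)%N by lia.
  apply: path_case sn => //; apply: (deviation_hilbert _ _ epsP).
  - exact: path_graph_sym.
  - exact: path_graph_irr.
  by move=> j jN; apply: coef_path_series.
case: n n3 epsP => [|[|[|n]]] // _ epsP; pose N := n.+3.
have [_ cycle_case] := pattern N _ (path_series N.+1) eps
  (trunc_x (erefl N.+1)) (path_series0 N.+1) (path_series1 (ltn0Sn N))
  (path_seriesSS (ltn0Sn N)).
have H s : (0 < s <= N)%N -> (eps s + (s == N) = gamma s * N)%N.
  apply: (cycle_case n) => //; apply: (deviation_hilbert _ _ epsP).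
  - exact: cycle_graph_sym.
  - exact: cycle_graph_irr.
  by move=> j jN; apply: coef_cycle_series.
split=> [s /andP[s0 sN]|].
  by have := H s; rewrite s0 (ltnW sN) (ltn_eqF sN) => /(_ isT); lia.
by have := H N; rewrite leqnn eqxx => /(_ isT); rewrite /N; lia.
Qed.
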